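(* Let $(E,C)$ be a separated graph, $K$ a commutative unital ring with involution, and $\mathfrak E$ a choice function for $(E,C)$. Let $\mathcal Q$ be the kernel of the canonical projection $\mathcal C_K^{\mathrm{ab}}(E,C)\to\mathcal L_K^{\mathrm{ab}}(E,C)$, i.e. the two-sided ideal of $\mathcal C_K^{\mathrm{ab}}(E,C)$ generated by all $q_X=v-\sum_{e\in X}ee^*$ with $X\in C_v$ finite, $v\in E^0$. Then the canonical $\mathfrak E$-basis $\mathcal B(\mathcal Q)$, consisting of all elements $\mathbf e(T\setminus F)\rtimes g$ such that $T\in\mathcal X_0$, $F$ is a non-empty blocking family for $T$, $g\in\mathbb F_C$ with $g_0\in T$, and $\mathbf e(T\setminus F)$ is $\mathfrak E$-reduced relatively to $g_0$, is a $K$-linear basis of $\mathcal Q$.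
   Context: Graphs and paths. A directed graph $E=(E^0,E^1,s,r)$ has arbitrary sets of vertices and edges and source/range maps $s,r$. A separated graph $(E,C)$ is a directed graph with $C=\bigsqcup_{v\in E^0}C_v$, where $C_v$ is a partition of $s^{-1}(v)$ into pairwise disjoint nonempty subsets ($C_v=\emptyset$ if $s^{-1}(v)=\emptyset$). $C^{\mathrm{fin}}=\{X\in C:|X|<\infty\}$, $C^{\mathrm{fin}}_v=C^{\mathrm{fin}}\cap C_v$. For $e\in E^1$ let $e^{-1}$ be a formal inverse with $s(e^{-1})=r(e)$, $r(e^{-1})=s(e)$; $E^{-1}=\{e^{-1}\}$, $\hat E^1=E^1\cup E^{-1}$. A path is a vertex or a sequence $y_1\cdots y_n$ in $\hat E^1$ with $r(y_i)=s(y_{i+1})$; it is reduced if it has no subpath $xx^{-1}$, $x\in\hat E^1$. $\alpha\cdot\beta$ is the reduction of the concatenation $\alpha\beta$ when $r(\alpha)=s(\beta)$. $A^\downarrow$ is the set of all prefixes of elements of $A$ (the vertex $s(\nu)$ is a prefix of $\nu$); a lower subset is one closed under prefixes; $\max(T)$ is the set of prefix-maximal elements; $[g]_1$ is the first letter of a nontrivial reduced path $g$. $C$-compatible trees. A $C$-separated path is a reduced path with no subpath $x^{-1}y$ with $x,y\in X$, $X\in C$. $\mathbb F_C(v)$ is the set of $C$-separated paths with source $v$; $\mathbb F_C=\bigsqcup_v\mathbb F_C(v)$. $\gamma,\nu\in\mathbb F_C(v)$ are $C$-compatible if $\nu^{-1}\cdot\gamma\in\mathbb F_C$; a set is $C$-compatible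 if its elements are pairwise so. $\mathcal X(v)$ is the set of nonempty finite lower $C$-compatible subsets of $\mathbb F_C(v)$; $\mathcal X_0(v)$ is the set of $T\in\mathcal X(v)$ none of whose maximal elements ends in an element of $E^{-1}$; $\mathcal X_0=\bigsqcup_v\mathcal X_0(v)$. Each $g\in\mathbb F_C$ is uniquely $g=g_0w$ with $g_0$ a vertex or a prefix ending in an element of $E^1$, and $w$ a (possibly empty) product of elements of $E^{-1}$. Neighbors and blocking. $\mathcal N(v)=\{x_1^{-1}\cdots x_n^{-1}y\in\mathbb F_C(v):n\ge0,\ x_i,y\in E^1\}$. For $T\in\mathcal X_0$, $\mathcal N(T)=\{gg'\in\mathbb F_C: g\in T,\ g'\in\mathcal N(r(g)),\ g[g']_1\notin T,\ T\cup\{gg'\}^\downarrow\in\mathcal X_0\}$; each $\lambda\in\mathcal N(T)$ decomposes uniquely as $\lambda=\lambda_0\lambda_1$ with $\lambda_0\in T$, $\lambda_1=x_1^{-1}\cdots x_r^{-1}y$ and $\lambda_0[\lambda_1]_1\notin T$. A blocking family for $T$ is a finite subset $F\subseteq\mathcal N(T)$ of the form $F=\bigsqcup_{i=1}^r\gamma^iX_i$, where $\gamma^iX_i=\{\gamma^ix:x\in X_i\}$, $X_i\in C^{\mathrm{fin}}_{r(\gamma^i)}$, $\gamma^i=\gamma^i_0\gamma^i_1$ with $\gamma_0^i\in T$, and, for each $x\in X_i$, $\gamma^ix=(\gamma_0^i)(\gamma_1^ix)$ is the unique decomposition $\lambda=\lambda_0\lambda_1$ of the element $\lambda=\gamma^ix\in\mathcal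 N(T)$, i.e. $\lambda_0=\gamma_0^i\in T$ and $\lambda_1=\gamma_1^ix$, where $\gamma_1^i$ is a (possibly empty) product of elements of $E^{-1}$ and $\gamma_0^i[\gamma_1^ix]_1\notin T$. An element $h\in\max(T)$ is blocked by $F$ if $F$ contains a block of the form $hwX$ with $w$ a (possibly empty) product of inverse edges and $X\in C^{\mathrm{fin}}$; otherwise it is non-blocked. Reducedness. A choice function is a map $\mathfrak E\colon C^{\mathrm{fin}}\to E^1$ with $\mathfrak E(X)\in X$ for all $X$; $\lambda\in\mathbb F_C$ is $\mathfrak E$-reduced if it does not end with any $\mathfrak E(X)$. If $g\in\mathbb F_C$ and $g_0\in T$, $\mathbf e(T\setminus F)$ is $\mathfrak E$-reduced relatively to $g_0$ if every maximal element of $T$ that is non-blocked by $F$, except possibly $g_0$, is $\mathfrak E$-reduced. Algebras. The Cohn path algebra $\mathcal C_K(E,C)$ is the universal $*$-algebra over $K$ generated by self-adjoint $v\in E^0$ and $e\in E^1$ subject to: $vw=\delta_{v,w}v$; $s(e)e=e=er(e)$; $e^*s(e)=e^*=r(e)e^*$; $e^*f=\delta_{e,f}r(e)$ for $e,f\in X$, $X\in C$. The Leavitt path algebra $\mathcal L_K(E,C)$ has the additional relations $\sum_{e\in X}ee^*=v$ for finite $X\in C_v$. The tame algebras $\mathcal C_K^{\mathrm{ab}}$, $\mathcal L_K^{\mathrm{ab}}$ are the quotients by the two-sided ideal generated by all commutators $[xx^*,yy^*]$, $x,y$ in the multiplicative $*$-subsemigroup generated by $E^0\cup E^1$. Paths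 are viewed as elements of the algebra via products, with $e^{-1}$ interpreted as $e^*$. In $\mathcal C_K^{\mathrm{ab}}(E,C)$: $\mathbf e(T)=\prod_{\lambda\in\max(T)}\lambda\lambda^*$; $\mathbf e(\lambda_0\setminus\lambda)=\lambda_0\lambda_0^*-\lambda\lambda^*$ for $\lambda=\lambda_0\lambda_1\in\mathcal N(T)$; $\mathbf e(T\setminus F)=\mathbf e(T)\prod_{\lambda\in F}\mathbf e(\lambda_0\setminus\lambda)$; and $\mathbf e(T\setminus F)\rtimes g$ denotes $\mathbf e(T\setminus F)\,g$ (where $T\in\mathcal X_0(s(g))$). *)

(* Defs.v *)
From HB Require Import structures.
From mathcomp Require Import all_boot all_algebra finmap all_classical.

Set Implicit Arguments.
Unset Strict Implicit.
Unset Printing Implicit Defensive.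

Import GRing.Theory.
Local Open Scope classical_set_scope.
Local Open Scope ring_scope.
Local Open Scope quotient_scope.

Record involution (K : comPzRingType) := Involution {
  conj_of :> {rmorphism K -> K};
  conj_ofK : involutive conj_of }.

(* MathComp rings are unital, whereas path algebras over infinite graphs are
   not: the product of a *-algebra is a separate operation on a K-module. *)
HB.mixin Record Lmodule_isStarAlgebra (K : comPzRingType) (c : involution K) A
    of GRing.Lmodule K A := {
  amul : A -> A -> A;
  star : A -> A;
  amulA : associative amul;
  amulDl : left_distributive amul +%R;
  amulDr : right_distributive amul +%R;
  amulZl : forall (k : K) (a b : A), amul (k *: a) b = k *: amul a b;
  amulZr : forall (k : K) (a b : A), amul a (k *: b) = k *: amul a b;
  starK : involutive star;
  starD : {morph star : a b / a + b};
  starZ : forall (k : K) (a : A), star (k *: a) = c k *: star a;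
  starM : forall a b : A, star (amul a b) = amul (star b) (star a) }.

#[short(type="starAlgType")]
HB.structure Definition StarAlgebra (K : comPzRingType) (c : involution K) :=
  {A of GRing.Lmodule K A & Lmodule_isStarAlgebra K c A}.

Notation "a · b" := (amul a b) (at level 40, left associativity) : ring_scope.

Section StarAlgebraTheory.
Variables (K : comPzRingType) (c : involution K).

Definition star_morphism (A B : starAlgType c) (f : A -> B) :=
  [/\ linear f, {morph f : a b / a · b} & {morph f : a / star a}].

Definition submodule {M : lmodType K} (N : set M) :=
  [/\ N 0, forall a b, N a -> N b -> N (a + b) & forall k a, N a -> N (k *: a)].

Definition two_sided_ideal {A : starAlgType c} (I : set A) :=
  [/\ submodule I, forall a b, I b -> I (a · b) & forall a b, I a -> I (a · b)].

Definition star_ideal {A : starAlgType c} (I : set A) :=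
  two_sided_ideal I /\ forall a, I a -> I (star a).

Section Basic.
Variable A : starAlgType c.
Implicit Types a b : A.

Lemma amul0r a : 0 · a = 0.
Proof. by rewrite -[in LHS](scale0r (0 : A)) amulZl scale0r. Qed.

Lemma amulr0 a : a · 0 = 0.
Proof. by rewrite -[in LHS](scale0r (0 : A)) amulZr scale0r. Qed.

Lemma star0 : star (0 : A) = 0.
Proof. by rewrite -[in LHS](scale0r (0 : A)) starZ rmorph0 scale0r. Qed.

Lemma amulNl a b : (- a) · b = - (a · b).
Proof. by rewrite -scaleN1r amulZl scaleN1r. Qed.

Lemma amulNr a b : a · (- b) = - (a · b).
Proof. by rewrite -scaleN1r amulZr scaleN1r. Qed.

Lemma starN a : star (- a) = - star a.
Proof. by rewrite -scaleN1r starZ rmorphN rmorph1 scaleN1r. Qed.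

Lemma star_sum (I : Type) (r : seq I) (F : I -> A) :
  star (\sum_(i <- r) F i) = \sum_(i <- r) star (F i).
Proof. exact: (big_morph star (@starD K c A) star0). Qed.

Lemma submoduleN (N : set A) a : submodule N -> N a -> N (- a).
Proof. by case=> _ _ NZ Na; rewrite -scaleN1r; exact: NZ. Qed.

Lemma smallest_two_sided_ideal (S : set A) :
  two_sided_ideal (smallest two_sided_ideal S).
Proof.
split; first split.
- by move=> I [[[]]].
- move=> a b Ia Ib I HI; have [[[_ + _] _ _] _] := HI; apply; [exact: Ia|exact: Ib].
- by move=> k a Ia I HI; have [[[_ _ +] _ _] _] := HI; apply; exact: Ia.
- by move=> a b Ib I HI; have [[_ + _] _] := HI; apply; exact: Ib.
- by move=> a b Ia I HI; have [[_ _ +] _] := HI; apply; exact: Ia.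
Qed.

Lemma smallest_star_ideal (S : set A) : star_ideal (smallest star_ideal S).
Proof.
split; first split; first split.
- by move=> I [[[[]]]].
- move=> a b Ia Ib I HI; have [[[[_ + _] _ _] _] _] := HI; apply; [exact: Ia|exact: Ib].
- by move=> k a Ia I HI; have [[[[_ _ +] _ _] _] _] := HI; apply; exact: Ia.
- by move=> a b Ib I HI; have [[[_ + _] _] _] := HI; apply; exact: Ib.
- by move=> a b Ia I HI; have [[[_ _ +] _] _] := HI; apply; exact: Ia.
- by move=> a Ia I HI; have [[_ +] _] := HI; apply; exact: Ia.
Qed.

(* For generators closed under * up to sign, such as commutators of
   projections, the *-ideal generated is the two-sided ideal generated. *)
Lemma smallest_star_idealE (S : set A) :
  (forall a, S a -> S (star a) \/ S (- star a)) ->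
  smallest star_ideal S = smallest two_sided_ideal S.
Proof.
move=> S_star; apply/seteqP; split=> [a Sa|a Sa I [[HI _] SI]]; last exact: Sa.
apply: (Sa (smallest two_sided_ideal S)); split; last exact: sub_gen_smallest.
have HI := smallest_two_sided_ideal S; split=> // b Ib.
have [[I0 ID IZ] Il Ir] := HI.
apply: (Ib (star @^-1` smallest two_sided_ideal S)); split=> [|d Sd /=]; last first.
  have [Ss|Ss] := S_star _ Sd; first exact: sub_gen_smallest.
  rewrite -[star d]opprK; apply: (@submoduleN (smallest two_sided_ideal S)); first by case: HI.
  exact: sub_gen_smallest.
split; first split.
- by rewrite /= star0.
- by move=> x y Ix Iy /=; rewrite starD; exact: ID.
- by move=> k x Ix /=; rewrite starZ; exact: IZ.
- by move=> x y Iy /=; rewrite starM; exact: Ir.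
- by move=> x y Ix /=; rewrite starM; exact: Il.
Qed.

End Basic.

Section Morphism.
Variables (A B : starAlgType c) (f : A -> B).
Hypothesis f_morph : star_morphism f.

Lemma star_morphD a b : f (a + b) = f a + f b.
Proof. by case: f_morph => fl _ _; rewrite -[a]scale1r fl !scale1r. Qed.

Lemma star_morph0 : f 0 = 0.
Proof. by apply: (addrI (f 0)); rewrite -star_morphD !addr0. Qed.

Lemma star_morphZ k a : f (k *: a) = k *: f a.
Proof. by case: f_morph => fl _ _; rewrite -[k *: a]addr0 fl star_morph0 addr0. Qed.

Lemma star_morphN a : f (- a) = - f a.
Proof. by rewrite -scaleN1r star_morphZ scaleN1r. Qed.

Lemma star_morphM a b : f (a · b) = f a · f b.
Proof. by case: f_morph. Qed.

Lemma star_morphS a : f (star a) = star (f a).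
Proof. by case: f_morph. Qed.

Lemma star_morph_sum (I : Type) (r : seq I) (F : I -> A) :
  f (\sum_(i <- r) F i) = \sum_(i <- r) f (F i).
Proof. exact: (big_morph f star_morphD star_morph0). Qed.

Lemma star_morph_ker : star_ideal [set a | f a = 0].
Proof.
split=> [|x /= fx]; last by rewrite star_morphS fx star0.
split; first split => /=; first exact: star_morph0.
- by move=> x y /= fx fy; rewrite star_morphD fx fy addr0.
- by move=> k x /= fx; rewrite star_morphZ fx scaler0.
- by move=> x y /= fy; rewrite star_morphM fy amulr0.
- by move=> x y /= fx; rewrite star_morphM fx amul0r.
Qed.

End Morphism.

Lemma star_morph_comp (A B D : starAlgType c) (f : A -> B) (g : B -> D) :
  star_morphism f -> star_morphism g -> star_morphism (g \o f).
Proof.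
by case=> fl fM fS [gl gM gS]; split=> [k a b|a b|a] /=;
   rewrite ?fl ?fM ?fS ?gl ?gM ?gS.
Qed.

End StarAlgebraTheory.
Arguments submodule {K M}.
Arguments two_sided_ideal {K c A}.
Arguments star_ideal {K c A}.

Inductive star_term (K G : Type) :=
| TGen of G
| TZero
| TOpp of star_term K G
| TAdd of star_term K G & star_term K G
| TScale of K & star_term K G
| TMul of star_term K G & star_term K G
| TStar of star_term K G.
Arguments TGen {K G}.
Arguments TZero {K G}.

HB.instance Definition _ (K G : Type) := gen_eqMixin (star_term K G).
HB.instance Definition _ (K G : Type) := gen_choiceMixin (star_term K G).

Section FreeStarAlgebra.
Variables (K : comPzRingType) (c : involution K) (G : Type).
Local Notation term := (star_term K G).

Inductive term_eq : term -> term -> Prop :=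
| teq_refl t : term_eq t t
| teq_sym t u : term_eq t u -> term_eq u t
| teq_trans t u w : term_eq t u -> term_eq u w -> term_eq t w
| teq_opp t t' : term_eq t t' -> term_eq (TOpp t) (TOpp t')
| teq_add t t' u u' :
    term_eq t t' -> term_eq u u' -> term_eq (TAdd t u) (TAdd t' u')
| teq_scale k t t' : term_eq t t' -> term_eq (TScale k t) (TScale k t')
| teq_mul t t' u u' :
    term_eq t t' -> term_eq u u' -> term_eq (TMul t u) (TMul t' u')
| teq_star t t' : term_eq t t' -> term_eq (TStar t) (TStar t')
| teq_addA t u w : term_eq (TAdd t (TAdd u w)) (TAdd (TAdd t u) w)
| teq_addC t u : term_eq (TAdd t u) (TAdd u t)
| teq_add0 t : term_eq (TAdd TZero t) t
| teq_addN t : term_eq (TAdd (TOpp t) t) TZero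
| teq_scaleA k l t : term_eq (TScale k (TScale l t)) (TScale (k * l) t)
| teq_scale1 t : term_eq (TScale 1 t) t
| teq_scaleDr k t u :
    term_eq (TScale k (TAdd t u)) (TAdd (TScale k t) (TScale k u))
| teq_scaleDl k l t :
    term_eq (TScale (k + l) t) (TAdd (TScale k t) (TScale l t))
| teq_mulA t u w : term_eq (TMul t (TMul u w)) (TMul (TMul t u) w)
| teq_mulDl t u w :
    term_eq (TMul (TAdd t u) w) (TAdd (TMul t w) (TMul u w))
| teq_mulDr t u w :
    term_eq (TMul t (TAdd u w)) (TAdd (TMul t u) (TMul t w))
| teq_mulZl k t u : term_eq (TMul (TScale k t) u) (TScale k (TMul t u))
| teq_mulZr k t u : term_eq (TMul t (TScale k u)) (TScale k (TMul t u))
| teq_starK t : term_eq (TStar (TStar t)) t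
| teq_starD t u : term_eq (TStar (TAdd t u)) (TAdd (TStar t) (TStar u))
| teq_starZ k t : term_eq (TStar (TScale k t)) (TScale (c k) (TStar t))
| teq_starM t u : term_eq (TStar (TMul t u)) (TMul (TStar u) (TStar t)).

Definition term_eqb (t u : term) : bool := `[< term_eq t u >].

Lemma term_eqb_refl : reflexive term_eqb.
Proof. by move=> t; apply/asboolP; constructor. Qed.

Lemma term_eqb_sym : symmetric term_eqb.
Proof. by move=> t u; apply/asboolP/asboolP => /teq_sym. Qed.

Lemma term_eqb_trans : transitive term_eqb.
Proof.
by move=> u t w /asboolP tu /asboolP uw; apply/asboolP; exact: teq_trans uw.
Qed.

Canonical term_eqb_equiv :=
  EquivRel term_eqb term_eqb_refl term_eqb_sym term_eqb_trans.

Definition free_star : Type := {eq_quot term_eqb}.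
HB.instance Definition _ := Choice.on free_star.
HB.instance Definition _ := EqQuotient.on free_star.

Definition free_pi (t : term) : free_star := \pi_free_star t.

Let free_piP t u : term_eq t u -> free_pi t = free_pi u.
Proof. by move=> tu; apply/eqmodP/asboolP. Qed.

Let free_repr (t : term) : term_eq (repr (free_pi t)) t.
Proof. by apply/asboolP/(@eqmodP _ term_eqb_equiv); rewrite reprK. Qed.

Definition free_gen (g : G) : free_star := free_pi (TGen g).
Definition free_zero : free_star := free_pi TZero.
Definition free_opp (x : free_star) : free_star := free_pi (TOpp (repr x)).
Definition free_add (x y : free_star) : free_star := free_pi (TAdd (repr x) (repr y)).
Definition free_scale (k : K) (x : free_star) : free_star :=
  free_pi (TScale k (repr x)).
Definition free_mul (x y : free_star) : free_star := free_pi (TMul (repr x) (repr y)).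
Definition free_conj (x : free_star) : free_star := free_pi (TStar (repr x)).

Let pi_opp t : free_opp (free_pi t) = free_pi (TOpp t).
Proof. by apply/free_piP/teq_opp/free_repr. Qed.
Let pi_add t u : free_add (free_pi t) (free_pi u) = free_pi (TAdd t u).
Proof. by apply/free_piP/teq_add; exact: free_repr. Qed.
Let pi_scale k t : free_scale k (free_pi t) = free_pi (TScale k t).
Proof. by apply/free_piP/teq_scale/free_repr. Qed.
Let pi_mul t u : free_mul (free_pi t) (free_pi u) = free_pi (TMul t u).
Proof. by apply/free_piP/teq_mul; exact: free_repr. Qed.
Let pi_star t : free_conj (free_pi t) = free_pi (TStar t).
Proof. by apply/free_piP/teq_star/free_repr. Qed.
Let piE := (pi_opp, pi_add, pi_scale, pi_mul, pi_star).
Let reprP (x : free_star) : exists t, x = free_pi t.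
Proof. by exists (repr x); rewrite /free_pi reprK. Qed.

Let free_addA : associative free_add.
Proof.
move=> x y z; have [t ->] := reprP x; have [u ->] := reprP y.
by have [w ->] := reprP z; rewrite !piE; apply/free_piP/teq_addA.
Qed.
Let free_addC : commutative free_add.
Proof.
move=> x y; have [t ->] := reprP x; have [u ->] := reprP y.
by rewrite !piE; apply/free_piP/teq_addC.
Qed.
Let free_add0 : left_id free_zero free_add.
Proof.
by move=> x; have [t ->] := reprP x; rewrite [free_zero]/(free_pi _) !piE;
   apply/free_piP/teq_add0.
Qed.
Let free_addN : left_inverse free_zero free_opp free_add.
Proof.
by move=> x; have [t ->] := reprP x; rewrite !piE; apply/free_piP/teq_addN.
Qed.

HB.instance Definition _ :=
  GRing.isZmodule.Build free_star free_addA free_addC free_add0 free_addN.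

Let addE (x y : free_star) : x + y = free_add x y. Proof. by []. Qed.

Let free_scaleA k l x : free_scale k (free_scale l x) = free_scale (k * l) x.
Proof. by have [t ->] := reprP x; rewrite !piE; apply/free_piP/teq_scaleA. Qed.
Let free_scale1 : left_id 1 free_scale.
Proof. by move=> x; have [t ->] := reprP x; rewrite !piE; apply/free_piP/teq_scale1. Qed.
Let free_scaleDr : right_distributive free_scale +%R.
Proof.
move=> k x y; have [t ->] := reprP x; have [u ->] := reprP y.
by rewrite !addE !piE; apply/free_piP/teq_scaleDr.
Qed.
Let free_scaleDl x : {morph free_scale^~ x : k l / k + l}.
Proof.
by move=> k l; have [t ->] := reprP x; rewrite addE !piE; apply/free_piP/teq_scaleDl.
Qed.

HB.instance Definition _ := GRing.Zmodule_isLmodule.Build K free_star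
  free_scaleA free_scale1 free_scaleDr free_scaleDl.

Let scaleE k (x : free_star) : k *: x = free_scale k x. Proof. by []. Qed.

Let free_mulA : associative free_mul.
Proof.
move=> x y z; have [t ->] := reprP x; have [u ->] := reprP y.
by have [w ->] := reprP z; rewrite !piE; apply/free_piP/teq_mulA.
Qed.
Let free_mulDl : left_distributive free_mul +%R.
Proof.
move=> x y z; have [t ->] := reprP x; have [u ->] := reprP y.
by have [w ->] := reprP z; rewrite !addE !piE; apply/free_piP/teq_mulDl.
Qed.
Let free_mulDr : right_distributive free_mul +%R.
Proof.
move=> x y z; have [t ->] := reprP x; have [u ->] := reprP y.
by have [w ->] := reprP z; rewrite !addE !piE; apply/free_piP/teq_mulDr.
Qed.
Let free_mulZl k (x y : free_star) : free_mul (k *: x) y = k *: free_mul x y.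
Proof.
have [t ->] := reprP x; have [u ->] := reprP y.
rewrite !scaleE !piE.
by apply/free_piP/teq_mulZl.
Qed.
Let free_mulZr k (x y : free_star) : free_mul x (k *: y) = k *: free_mul x y.
Proof.
have [t ->] := reprP x; have [u ->] := reprP y.
rewrite !scaleE !piE.
by apply/free_piP/teq_mulZr.
Qed.
Let free_starK : involutive free_conj.
Proof. by move=> x; have [t ->] := reprP x; rewrite !piE; apply/free_piP/teq_starK. Qed.
Let free_starD : {morph free_conj : x y / x + y}.
Proof.
move=> x y; have [t ->] := reprP x; have [u ->] := reprP y.
rewrite !addE !piE.
by apply/free_piP/teq_starD.
Qed.
Let free_starZ k (x : free_star) : free_conj (k *: x) = c k *: free_conj x.
Proof.
have [t ->] := reprP x.
rewrite !scaleE !piE.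
by apply/free_piP/teq_starZ.
Qed.
Let free_starM (x y : free_star) :
  free_conj (free_mul x y) = free_mul (free_conj y) (free_conj x).
Proof.
have [t ->] := reprP x; have [u ->] := reprP y.
by rewrite !piE; apply/free_piP/teq_starM.
Qed.

HB.instance Definition _ := Lmodule_isStarAlgebra.Build K c free_star
  free_mulA free_mulDl free_mulDr free_mulZl free_mulZr
  free_starK free_starD free_starZ free_starM.

Let mulE (x y : free_star) : x · y = free_mul x y. Proof. by []. Qed.
Let starE (x : free_star) : star x = free_conj x. Proof. by []. Qed.

Section Eval.
Variables (A : starAlgType c) (f : G -> A).

Fixpoint term_eval (t : term) : A :=
  match t with
  | TGen g => f g
  | TZero => 0
  | TOpp t => - term_eval t
  | TAdd t u => term_eval t + term_eval u
  | TScale k t => k *: term_eval t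
  | TMul t u => term_eval t · term_eval u
  | TStar t => star (term_eval t)
  end.

Definition free_eval (x : free_star) : A := term_eval (repr x).

Lemma term_eval_eq t u : term_eq t u -> term_eval t = term_eval u.
Proof.
elim=> {t u} /=; intros; try congruence.
all: first [ exact: addrA | exact: addrC | exact: add0r | exact: addNr
  | exact: scalerA | exact: scale1r | exact: scalerDr | exact: scalerDl
  | exact: amulA | exact: amulDl | exact: amulDr | exact: amulZl
  | exact: amulZr | exact: starK | exact: starD | exact: starZ
  | exact: starM ].
Qed.

Let free_eval_pi t : free_eval (free_pi t) = term_eval t.
Proof. exact/term_eval_eq/free_repr. Qed.

Lemma free_eval_gen g : free_eval (free_gen g) = f g.
Proof. exact: free_eval_pi. Qed.

Lemma free_eval_morphism : star_morphism free_eval.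
Proof.
split=> [k x y|x y|x].
- have [t ->] := reprP x; have [u ->] := reprP y.
  by rewrite scaleE addE !piE !free_eval_pi.
- have [t ->] := reprP x; have [u ->] := reprP y.
  by rewrite mulE !piE !free_eval_pi.
- have [t ->] := reprP x.
  by rewrite starE !piE !free_eval_pi.
Qed.

End Eval.

Lemma free_ind (P : free_star -> Prop) :
  (forall g, P (free_gen g)) -> P 0 -> (forall x, P x -> P (- x)) ->
  (forall x y, P x -> P y -> P (x + y)) -> (forall k x, P x -> P (k *: x)) ->
  (forall x y, P x -> P y -> P (x · y)) -> (forall x, P x -> P (star x)) ->
  forall x, P x.
Proof.
move=> Pg P0 PN PD PZ PM PS x; have [t ->] := reprP x.
elim: t => [g||t|t IHt u IHu|k t|t IHt u IHu|t]; [exact: Pg|exact: P0|..].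
- by move/PN; rewrite -pi_opp.
- by have := PD _ _ IHt IHu; rewrite -pi_add.
- by move/(PZ k); rewrite -pi_scale.
- by have := PM _ _ IHt IHu; rewrite -pi_mul.
- by move/PS; rewrite -pi_star.
Qed.

End FreeStarAlgebra.

Section QuotientStarAlgebra.
Variables (K : comPzRingType) (c : involution K) (A : starAlgType c).
Variable R : A -> A -> Prop.

Definition rel_ideal : set A :=
  smallest star_ideal [set d | exists a b, R a b /\ d = a - b].

Let IP : star_ideal rel_ideal := smallest_star_ideal _.
Let I0 : rel_ideal 0. Proof. by case: IP => [[[]]]. Qed.
Let ID a b : rel_ideal a -> rel_ideal b -> rel_ideal (a + b).
Proof. by have [[[_ H _] _ _] _] := IP; exact: H. Qed.
Let IZ k a : rel_ideal a -> rel_ideal (k *: a).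
Proof. by have [[[_ _ H] _ _] _] := IP; exact: H. Qed.
Let IN a : rel_ideal a -> rel_ideal (- a).
Proof. by rewrite -scaleN1r; exact: IZ. Qed.
Let IMl a b : rel_ideal b -> rel_ideal (a · b).
Proof. by have [[_ H _] _] := IP; exact: H. Qed.
Let IMr a b : rel_ideal a -> rel_ideal (a · b).
Proof. by have [[_ _ H] _] := IP; exact: H. Qed.
Let IS a : rel_ideal a -> rel_ideal (star a).
Proof. by have [_ H] := IP; exact: H. Qed.

Definition quot_eqb (a b : A) : bool := `[< rel_ideal (a - b) >].

Lemma quot_eqb_refl : reflexive quot_eqb.
Proof. by move=> a; apply/asboolP; rewrite subrr. Qed.

Lemma quot_eqb_sym : symmetric quot_eqb.
Proof. by move=> a b; apply/asboolP/asboolP => /IN; rewrite opprB. Qed.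

Lemma quot_eqb_trans : transitive quot_eqb.
Proof.
move=> b a d /asboolP ab /asboolP bd; apply/asboolP.
by rewrite -(subrK b a) -addrA; exact: ID.
Qed.

Canonical quot_eqb_equiv :=
  EquivRel quot_eqb quot_eqb_refl quot_eqb_sym quot_eqb_trans.

Definition quot : Type := {eq_quot quot_eqb}.
HB.instance Definition _ := Choice.on quot.
HB.instance Definition _ := EqQuotient.on quot.

Definition quot_pi (a : A) : quot := \pi_quot a.

Lemma quot_piP a b : quot_pi a = quot_pi b <-> rel_ideal (a - b).
Proof.
split=> [ab|ab]; first by apply/asboolP/(@eqmodP _ quot_eqb_equiv).
by apply/eqmodP/asboolP.
Qed.

Let quot_repr a : rel_ideal (repr (quot_pi a) - a).
Proof. by apply/quot_piP; rewrite /quot_pi reprK. Qed.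

Definition quot_opp (x : quot) : quot := quot_pi (- repr x).
Definition quot_add (x y : quot) : quot := quot_pi (repr x + repr y).
Definition quot_scale (k : K) (x : quot) : quot := quot_pi (k *: repr x).
Definition quot_mul (x y : quot) : quot := quot_pi (repr x · repr y).
Definition quot_star (x : quot) : quot := quot_pi (star (repr x)).

Let pi_opp a : quot_opp (quot_pi a) = quot_pi (- a).
Proof. by apply/quot_piP; rewrite -opprD; apply: IN; exact: quot_repr. Qed.
Let pi_add a b : quot_add (quot_pi a) (quot_pi b) = quot_pi (a + b).
Proof. by apply/quot_piP; rewrite opprD addrACA; apply: ID; exact: quot_repr. Qed.
Let pi_scale k a : quot_scale k (quot_pi a) = quot_pi (k *: a).
Proof. by apply/quot_piP; rewrite -scalerBr; apply: IZ; exact: quot_repr. Qed.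
Let pi_mul a b : quot_mul (quot_pi a) (quot_pi b) = quot_pi (a · b).
Proof.
apply/quot_piP; set a' := repr _; set b' := repr _.
have -> : a' · b' - a · b = (a' - a) · b' + a · (b' - b).
  by rewrite amulDl amulDr amulNl amulNr addrA subrK.
by apply: ID; [apply: IMr|apply: IMl]; exact: quot_repr.
Qed.
Let pi_star a : quot_star (quot_pi a) = quot_pi (star a).
Proof. by apply/quot_piP; rewrite -starN -starD; apply: IS; exact: quot_repr. Qed.
Let piE := (pi_opp, pi_add, pi_scale, pi_mul, pi_star).
Let reprP (x : quot) : exists a, x = quot_pi a.
Proof. by exists (repr x); rewrite /quot_pi reprK. Qed.

Let quot_addA : associative quot_add.
Proof.
move=> x y z; have [a ->] := reprP x; have [b ->] := reprP y.
by have [d ->] := reprP z; rewrite !piE addrA.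
Qed.
Let quot_addC : commutative quot_add.
Proof.
move=> x y; have [a ->] := reprP x; have [b ->] := reprP y.
by rewrite !piE addrC.
Qed.
Let quot_add0 : left_id (quot_pi 0) quot_add.
Proof. by move=> x; have [a ->] := reprP x; rewrite !piE add0r. Qed.
Let quot_addN : left_inverse (quot_pi 0) quot_opp quot_add.
Proof. by move=> x; have [a ->] := reprP x; rewrite !piE addNr. Qed.

HB.instance Definition _ :=
  GRing.isZmodule.Build quot quot_addA quot_addC quot_add0 quot_addN.

Let addE (x y : quot) : x + y = quot_add x y. Proof. by []. Qed.

Let quot_scaleA k l x : quot_scale k (quot_scale l x) = quot_scale (k * l) x.
Proof. by have [a ->] := reprP x; rewrite !piE scalerA. Qed.
Let quot_scale1 : left_id 1 quot_scale.
Proof. by move=> x; have [a ->] := reprP x; rewrite !piE scale1r. Qed.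
Let quot_scaleDr : right_distributive quot_scale +%R.
Proof.
move=> k x y; have [a ->] := reprP x; have [b ->] := reprP y.
by rewrite !addE !piE scalerDr.
Qed.
Let quot_scaleDl x : {morph quot_scale^~ x : k l / k + l}.
Proof.
by move=> k l; have [a ->] := reprP x; rewrite addE !piE scalerDl.
Qed.

HB.instance Definition _ := GRing.Zmodule_isLmodule.Build K quot
  quot_scaleA quot_scale1 quot_scaleDr quot_scaleDl.

Let scaleE k (x : quot) : k *: x = quot_scale k x. Proof. by []. Qed.

Let quot_mulA : associative quot_mul.
Proof.
move=> x y z; have [a ->] := reprP x; have [b ->] := reprP y.
by have [d ->] := reprP z; rewrite !piE amulA.
Qed.
Let quot_mulDl : left_distributive quot_mul +%R.
Proof.
move=> x y z; have [a ->] := reprP x; have [b ->] := reprP y.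
by have [d ->] := reprP z; rewrite !addE !piE amulDl.
Qed.
Let quot_mulDr : right_distributive quot_mul +%R.
Proof.
move=> x y z; have [a ->] := reprP x; have [b ->] := reprP y.
by have [d ->] := reprP z; rewrite !addE !piE amulDr.
Qed.
Let quot_mulZl k (x y : quot) : quot_mul (k *: x) y = k *: quot_mul x y.
Proof.
have [a ->] := reprP x; have [b ->] := reprP y.
by rewrite !scaleE !piE amulZl.
Qed.
Let quot_mulZr k (x y : quot) : quot_mul x (k *: y) = k *: quot_mul x y.
Proof.
have [a ->] := reprP x; have [b ->] := reprP y.
by rewrite !scaleE !piE amulZr.
Qed.
Let quot_starK : involutive quot_star.
Proof. by move=> x; have [a ->] := reprP x; rewrite !piE starK. Qed.
Let quot_starD : {morph quot_star : x y / x + y}.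
Proof.
move=> x y; have [a ->] := reprP x; have [b ->] := reprP y.
by rewrite !addE !piE starD.
Qed.
Let quot_starZ k (x : quot) : quot_star (k *: x) = c k *: quot_star x.
Proof. by have [a ->] := reprP x; rewrite !scaleE !piE starZ. Qed.
Let quot_starM (x y : quot) :
  quot_star (quot_mul x y) = quot_mul (quot_star y) (quot_star x).
Proof.
have [a ->] := reprP x; have [b ->] := reprP y.
by rewrite !piE starM.
Qed.

HB.instance Definition _ := Lmodule_isStarAlgebra.Build K c quot
  quot_mulA quot_mulDl quot_mulDr quot_mulZl quot_mulZr
  quot_starK quot_starD quot_starZ quot_starM.

Let mulE (x y : quot) : x · y = quot_mul x y. Proof. by []. Qed.
Let starE (x : quot) : star x = quot_star x. Proof. by []. Qed.

Lemma quot_pi_morphism : star_morphism (quot_pi : A -> quot).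
Proof.
split=> [k a b|a b|a].
- by rewrite addE scaleE !piE.
- by rewrite mulE piE.
- by rewrite starE piE.
Qed.

Lemma quot_pi_surj x : exists a, x = quot_pi a.
Proof. exact: reprP. Qed.

Lemma quot_pi_rel a b : R a b -> quot_pi a = quot_pi b.
Proof. by move=> Rab; apply/quot_piP; apply: sub_gen_smallest => /=; exists a, b. Qed.

Section Lift.
Variables (B : starAlgType c) (f : A -> B).

Definition quot_lift (x : quot) : B := f (repr x).

Hypothesis f_morph : star_morphism f.
Hypothesis f_rel : forall a b, R a b -> f a = f b.

Lemma quot_lift_pi a : quot_lift (quot_pi a) = f a.
Proof.
suff f_ideal d : rel_ideal d -> f d = 0.
  by apply/eqP; rewrite -subr_eq0 -(star_morphN f_morph) -(star_morphD f_morph) f_ideal //; apply/quot_piP; rewrite /quot_pi reprK.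
move=> Id; apply: (Id [set d | f d = 0]); split; first exact: star_morph_ker.
move=> _ [x [y [Rxy ->]]] /=.
by rewrite (star_morphD f_morph) (star_morphN f_morph) (f_rel Rxy) subrr.
Qed.

Lemma quot_lift_morphism : star_morphism quot_lift.
Proof.
have [pl pM pS] := quot_pi_morphism; have [fl fM fS] := f_morph.
split=> [k x y|x y|x]; have [a ->] := reprP x.
- by have [b ->] := reprP y; rewrite -pl !quot_lift_pi fl.
- by have [b ->] := reprP y; rewrite -pM !quot_lift_pi fM.
- by rewrite -pS !quot_lift_pi fS.
Qed.

End Lift.
End QuotientStarAlgebra.

Record sepGraph := SepGraph {
  vert : choiceType;
  edge : choiceType;
  src : edge -> vert;
  rng : edge -> vert;
  sep : vert -> set (set edge);
  sepP : forall v, partition (sep v) id (src @^-1` [set v]) }.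

Definition sep_all (E : sepGraph) : set (set (edge E)) := \bigcup_v @sep E v.
Definition sep_fin (E : sepGraph) : set (set (edge E)) :=
  @sep_all E `&` [set X | finite_set X].

Section Paths.
Variable E : sepGraph.
Local Notation vert := (vert E).
Local Notation edge := (edge E).

(* [(e, false)] is the edge [e] and [(e, true)] its formal inverse. *)
Definition letter : Type := edge * bool.
HB.instance Definition _ := Choice.on letter.
Definition fwd (e : edge) : letter := (e, false).
Definition bwd (e : edge) : letter := (e, true).
Definition lsrc (y : letter) : vert := if y.2 then rng y.1 else src y.1.
Definition lrng (y : letter) : vert := if y.2 then src y.1 else rng y.1.
Definition linv (y : letter) : letter := (y.1, ~~ y.2).

(* A path is a pair of its source and its word, the vertex [v] being
   [(v, [::])]; [is_path] makes the source of a nonempty word redundant. *)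
Definition gpath : Type := vert * seq letter.
HB.instance Definition _ := Choice.on gpath.
Implicit Types (p q : gpath) (T F : set gpath) (X : set edge).

Definition psrc p : vert := p.1.
Definition prng p : vert := last p.1 [seq lrng y | y <- p.2].

Fixpoint is_walk (v : vert) (w : seq letter) : bool :=
  if w is y :: w' then (lsrc y == v) && is_walk (lrng y) w' else true.
Definition is_path p : bool := is_walk p.1 p.2.

Definition reduced p := forall y, ~~ infix [:: y; linv y] p.2.
Definition separated p := forall X x y,
  @sep_all E X -> X x -> X y -> ~~ infix [:: bwd x; fwd y] p.2.

Definition FC : set gpath :=
  [set p | [/\ is_path p, reduced p & separated p]].
Definition FCv (v : vert) : set gpath := FC `&` [set p | psrc p = v].

Definition pcat p q : gpath := (p.1, p.2 ++ q.2).
Definition reduce_cons (y : letter) (w : seq letter) : seq letter :=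
  if w is z :: w' then if z == linv y then w' else y :: w else [:: y].
Definition pdot p q : gpath := (p.1, foldr reduce_cons [::] (p.2 ++ q.2)).
Definition pinv p : gpath := (prng p, rev [seq linv y | y <- p.2]).

Definition pprefix p q : bool := (p.1 == q.1) && prefix p.2 q.2.
Definition down T : set gpath := [set p | exists2 q, T q & pprefix p q].
Definition lower T := forall p q, T q -> pprefix p q -> T p.
Definition maxl T : set gpath :=
  [set p | T p /\ forall q, T q -> pprefix p q -> q = p].

Definition compatible p q := FC (pdot (pinv q) p).

Definition Xv (v : vert) : set (set gpath) :=
  [set T | [/\ T !=set0, finite_set T, T `<=` FCv v, lower T
             & forall p q, T p -> T q -> compatible p q]].

Definition ends_in_inverse p := exists w x, p.2 = rcons w (bwd x).
Definition ends_in_edge p := exists w x, p.2 = rcons w (fwd x).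
Definition inverse_word p := exists xs : seq edge, p.2 = map bwd xs.

Definition X0v (v : vert) : set (set gpath) :=
  Xv v `&` [set T | forall p, maxl T p -> ~ ends_in_inverse p].
Definition X0 : set (set gpath) := \bigcup_v X0v v.

(* g = g0 w with g0 a vertex or a prefix ending in an edge, and w a product of
   inverse edges; this determines g0. *)
Definition edge_part (g g0 : gpath) := exists w, [/\ g = pcat g0 w,
  inverse_word w & g0.2 = [::] \/ ends_in_edge g0].

Definition edge_path (e : edge) : gpath := (src e, [:: fwd e]).
Definition first_letter p : gpath := (psrc p, take 1 p.2).

Definition nbr (v : vert) : set gpath :=
  [set p | FCv v p /\ exists (xs : seq edge) y, p.2 = rcons (map bwd xs) (fwd y)].

Definition nbr_split T (g g' : gpath) :=
  [/\ T g, nbr (prng g) g', FC (pcat g g'), ~ T (pcat g (first_letter g'))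
    & X0 (T `|` down [set pcat g g'])].

Definition nbrT T : set gpath :=
  [set p | exists g g', nbr_split T g g' /\ p = pcat g g'].

(* the component lambda_0 of a neighbor lambda of T *)
Definition nbr_base T (p : gpath) : gpath :=
  xget p [set g | exists g', nbr_split T g g' /\ p = pcat g g'].

Definition mul_edges p X : set gpath := [set pcat p (edge_path x) | x in X].

(* [block T h w X] : h w X is an admissible block of a blocking family for T,
   h and w being the components gamma_0 and gamma_1. *)
Definition block T (h w : gpath) X :=
  [/\ psrc w = prng h, inverse_word w,
      @sep E (prng (pcat h w)) X /\ finite_set X
    & forall x, X x -> nbr_split T h (pcat w (edge_path x))].

Definition blocking_family T F :=
  [/\ finite_set F, F `<=` nbrT T
    & exists (r : nat) (h w : 'I_r -> gpath) (X : 'I_r -> set edge),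
      [/\ forall i, block T (h i) (w i) (X i),
          trivIset setT (fun i => mul_edges (pcat (h i) (w i)) (X i))
        & F = \bigcup_i mul_edges (pcat (h i) (w i)) (X i)]].

Definition blocked T F (h : gpath) := exists w X,
  block T h w X /\ mul_edges (pcat h w) X `<=` F.

(* Partiality matters: when there are no edges the only choice function is the
   empty one. *)
Record choice_function := ChoiceFunction {
  choice_edge : {X : set edge | @sep_fin E X} -> edge;
  choice_edgeP : forall Y, sval Y (choice_edge Y) }.

Definition choice_reduced (ch : choice_function) (p : gpath) :=
  forall w Y, p.2 <> rcons w (fwd (choice_edge ch Y)).

Definition reduced_rel (ch : choice_function) T F (g0 : gpath) :=
  forall h, maxl T h -> ~ blocked T F h -> h <> g0 -> choice_reduced ch h.

End Paths.

Section Relations.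
Variables (K : comPzRingType) (c : involution K) (E : sepGraph).
Local Notation vert := (vert E).
Local Notation edge := (edge E).
Variables (A : starAlgType c) (V : vert -> A) (Y : edge -> A).

Inductive cohn_rel : A -> A -> Prop :=
| cohn_starV v : cohn_rel (star (V v)) (V v)
| cohn_VV v : cohn_rel (V v · V v) (V v)
| cohn_VV0 v w : v <> w -> cohn_rel (V v · V w) 0
| cohn_srcl e : cohn_rel (V (src e) · Y e) (Y e)
| cohn_rngr e : cohn_rel (Y e · V (rng e)) (Y e)
| cohn_srcr e : cohn_rel (star (Y e) · V (src e)) (star (Y e))
| cohn_rngl e : cohn_rel (V (rng e) · star (Y e)) (star (Y e))
| cohn_ee e : cohn_rel (star (Y e) · Y e) (V (rng e))
| cohn_ef X e f : @sep_all E X -> X e -> X f -> e <> f ->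
    cohn_rel (star (Y e) · Y f) 0.

Inductive cuntz_krieger_rel : A -> A -> Prop :=
| cuntz_krieger v X : @sep E v X -> finite_set X ->
    cuntz_krieger_rel (V v) (\sum_(e <- fset_set X) Y e · star (Y e)).

Inductive leavitt_rel : A -> A -> Prop :=
| leavitt_cohn a b : cohn_rel a b -> leavitt_rel a b
| leavitt_ck a b : cuntz_krieger_rel a b -> leavitt_rel a b.

(* the multiplicative *-subsemigroup generated by the vertices and edges *)
Inductive star_monomial : A -> Prop :=
| smon_V v : star_monomial (V v)
| smon_Y e : star_monomial (Y e)
| smon_mul a b : star_monomial a -> star_monomial b -> star_monomial (a · b)
| smon_star a : star_monomial a -> star_monomial (star a).

Inductive tame_rel : A -> A -> Prop :=
| tame_comm x y : star_monomial x -> star_monomial y ->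
    tame_rel ((x · star x) · (y · star y)) ((y · star y) · (x · star x)).

(* The commutators [xx*, yy*] are skew-adjoint, so that dividing by the *-ideal
   they generate, as [quot] does, is dividing by the two-sided ideal. *)
Lemma tame_idealE : rel_ideal tame_rel =
  smallest two_sided_ideal [set d | exists x y,
    [/\ star_monomial x, star_monomial y &
     d = (x · star x) · (y · star y) - (y · star y) · (x · star x)]].
Proof.
rewrite /rel_ideal; set S := (X in smallest star_ideal X).
set S' := (X in _ = smallest _ X).
have -> : S' = S.
  apply/seteqP; split=> [_ [x [y [Hx Hy ->]]]|_ [_ [_ [[x y Hx Hy] ->]]]].
    by eexists; eexists; split; [exact: (tame_comm Hx Hy)|].
  by exists x, y.
apply: smallest_star_idealE => _ [_ [_ [[x y Hx Hy] ->]]]; right.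
eexists; eexists; split; first exact: (tame_comm Hx Hy).
by rewrite starD starN !starM !starK opprB.
Qed.

End Relations.

Section PathAlgebras.
Variables (K : comPzRingType) (c : involution K) (E : sepGraph).
Local Notation vert := (vert E).
Local Notation edge := (edge E).

Definition freeV (v : vert) : free_star c (vert + edge) := free_gen c (inl v).
Definition freeY (e : edge) : free_star c (vert + edge) := free_gen c (inr e).

Definition cohn : starAlgType c := quot (cohn_rel freeV freeY).
Definition cohnV (v : vert) : cohn := quot_pi _ (freeV v).
Definition cohnY (e : edge) : cohn := quot_pi _ (freeY e).

Definition leavitt : starAlgType c := quot (leavitt_rel freeV freeY).
Definition leavittV (v : vert) : leavitt := quot_pi _ (freeV v).
Definition leavittY (e : edge) : leavitt := quot_pi _ (freeY e).

Definition cohn_ab : starAlgType c := quot (tame_rel cohnV cohnY).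
Definition cohn_abV (v : vert) : cohn_ab := quot_pi _ (cohnV v).
Definition cohn_abY (e : edge) : cohn_ab := quot_pi _ (cohnY e).

Definition leavitt_ab : starAlgType c := quot (tame_rel leavittV leavittY).
Definition leavitt_abV (v : vert) : leavitt_ab := quot_pi _ (leavittV v).
Definition leavitt_abY (e : edge) : leavitt_ab := quot_pi _ (leavittY e).

Definition cohn_to_leavitt : cohn -> leavitt :=
  quot_lift (quot_pi (leavitt_rel freeV freeY)).

Definition tame_proj : cohn_ab -> leavitt_ab :=
  quot_lift (quot_pi (tame_rel leavittV leavittY) \o cohn_to_leavitt).

Definition tame_kernel : set cohn_ab := [set a | tame_proj a = 0].

Let pi_cohn := quot_pi_morphism (cohn_rel freeV freeY).
Let pi_leavitt := quot_pi_morphism (leavitt_rel freeV freeY).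
Let pi_cohn_ab := quot_pi_morphism (tame_rel cohnV cohnY).
Let pi_leavitt_ab := quot_pi_morphism (tame_rel leavittV leavittY).

Lemma cohn_to_leavitt_pi a :
  cohn_to_leavitt (quot_pi (cohn_rel freeV freeY) a) =
  quot_pi (leavitt_rel freeV freeY) a.
Proof.
by apply: quot_lift_pi => // x y xy; apply/quot_pi_rel/leavitt_cohn.
Qed.

Lemma cohn_to_leavitt_morphism : star_morphism cohn_to_leavitt.
Proof.
by apply: quot_lift_morphism => // x y xy; apply/quot_pi_rel/leavitt_cohn.
Qed.

Lemma star_monomial_morph (A B : starAlgType c) (V : vert -> A) (Y : edge -> A)
    (f : A -> B) (V' : vert -> B) (Y' : edge -> B) :
    star_morphism f -> (forall v, f (V v) = V' v) -> (forall e, f (Y e) = Y' e) ->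
  forall x, star_monomial V Y x -> star_monomial V' Y' (f x).
Proof.
move=> fm fV fY x; elim=> {x} [v|e|a b _ Ha _ Hb|a _ Ha].
- by rewrite fV; constructor.
- by rewrite fY; constructor.
- by rewrite (star_morphM fm); constructor.
- by rewrite (star_morphS fm); constructor.
Qed.

Lemma tame_rel_morph (A B : starAlgType c) (V : vert -> A) (Y : edge -> A)
    (f : A -> B) (V' : vert -> B) (Y' : edge -> B) :
    star_morphism f -> (forall v, f (V v) = V' v) -> (forall e, f (Y e) = Y' e) ->
  forall a b, tame_rel V Y a b -> tame_rel V' Y' (f a) (f b).
Proof.
move=> fm fV fY _ _ [x y Hx Hy].
rewrite !(star_morphM fm) !(star_morphS fm).
by constructor; exact: (star_monomial_morph fm).
Qed.

Let tame_proj_rel a b : tame_rel cohnV cohnY a b ->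
  (quot_pi (tame_rel leavittV leavittY) \o cohn_to_leavitt) a =
  (quot_pi (tame_rel leavittV leavittY) \o cohn_to_leavitt) b.
Proof.
move=> ab; apply: quot_pi_rel; apply: (tame_rel_morph _ _ _ ab).
- exact: cohn_to_leavitt_morphism.
- by move=> v; exact: cohn_to_leavitt_pi.
- by move=> v; exact: cohn_to_leavitt_pi.
Qed.

Let tame_proj_comp := star_morph_comp cohn_to_leavitt_morphism pi_leavitt_ab.

Lemma tame_proj_morphism : star_morphism tame_proj.
Proof. exact: (quot_lift_morphism tame_proj_comp tame_proj_rel). Qed.

Let tame_proj_pi a : tame_proj (quot_pi (tame_rel cohnV cohnY) a) =
  quot_pi (tame_rel leavittV leavittY) (cohn_to_leavitt a).
Proof. exact: (quot_lift_pi tame_proj_comp tame_proj_rel). Qed.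

Lemma tame_projV v : tame_proj (cohn_abV v) = leavitt_abV v.
Proof. by rewrite tame_proj_pi cohn_to_leavitt_pi. Qed.

Lemma tame_projY e : tame_proj (cohn_abY e) = leavitt_abY e.
Proof. by rewrite tame_proj_pi cohn_to_leavitt_pi. Qed.

(* [tame_kernel] is the two-sided ideal generated by the elements q_X. *)
Lemma tame_kernelE : tame_kernel = smallest two_sided_ideal
  [set q | exists v X, [/\ @sep E v X, finite_set X &
    q = cohn_abV v - \sum_(e <- fset_set X) cohn_abY e · star (cohn_abY e)]].
Proof.
set S := (X in smallest _ X); pose R := cuntz_krieger_rel cohn_abV cohn_abY.
have starE_V v : star (cohn_abV v) = cohn_abV v.
  have -> : star (cohn_abV v) =
      quot_pi _ (quot_pi (cohn_rel freeV freeY) (star (freeV v))).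
    by rewrite (star_morphS pi_cohn) (star_morphS pi_cohn_ab).
  by congr (quot_pi _ _); apply/quot_pi_rel/cohn_starV.
have RS : rel_ideal R = smallest two_sided_ideal S.
  rewrite /rel_ideal; set S' := (X in smallest star_ideal X).
  have -> : S = S'.
    apply/seteqP; split=> [_ [v [X [vX fX ->]]]|_ [_ [_ [[v X vX fX] ->]]]].
      by eexists; eexists; split; [exact: (cuntz_krieger _ _ vX fX)|].
    by exists v, X.
  apply: smallest_star_idealE => _ [_ [_ [[v X vX fX] ->]]]; left.
  eexists; eexists; split; first exact: (cuntz_krieger _ _ vX fX).
  rewrite starD starN starE_V star_sum; congr (_ - _).
  by apply: eq_bigr => e _; rewrite starM starK.
rewrite -RS; apply/seteqP; split; last first.
  rewrite RS => a; apply; split; first by case: (star_morph_ker tame_proj_morphism).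
  move=> _ [v [X [vX fX ->]]]; have tm := tame_proj_morphism.
  suff : tame_proj (cohn_abV v -
    \sum_(e <- fset_set X) cohn_abY e · star (cohn_abY e)) = 0 by [].
  rewrite (star_morphD tm) (star_morphN tm) (star_morph_sum tm) tame_projV.
  apply/eqP; rewrite subr_eq0; apply/eqP; under eq_bigr do
    rewrite (star_morphM tm) (star_morphS tm) tame_projY.
  under eq_bigr do rewrite -(star_morphS pi_leavitt_ab) -(star_morphM pi_leavitt_ab)
    -(star_morphS pi_leavitt) -(star_morphM pi_leavitt).
  rewrite -(star_morph_sum pi_leavitt_ab) -(star_morph_sum pi_leavitt).
  congr (quot_pi _ _); apply: quot_pi_rel; apply: leavitt_ck.
  exact: cuntz_krieger.
have pi_R := quot_pi_morphism R.
pose h1 : cohn -> quot R := quot_pi R \o quot_pi (tame_rel cohnV cohnY).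
pose h : free_star c (vert + edge) -> quot R :=
  h1 \o quot_pi (cohn_rel freeV freeY).
have h1m : star_morphism h1 := star_morph_comp pi_cohn_ab pi_R.
have hm : star_morphism h := star_morph_comp pi_cohn h1m.
have h_rel a b : leavitt_rel freeV freeY a b -> h a = h b.
  case=> {a b} [a b ab|_ _ [v X vX fX]].
    by congr (h1 _); exact: quot_pi_rel.
  rewrite (star_morph_sum hm).
  under eq_bigr do rewrite (star_morphM hm) (star_morphS hm).
  have -> : h (freeV v) = quot_pi R (cohn_abV v) by [].
  rewrite (quot_pi_rel (cuntz_krieger _ _ vX fX)) (star_morph_sum pi_R).
  by apply: eq_bigr => e _; rewrite (star_morphM pi_R) (star_morphS pi_R).
pose k1 : leavitt -> quot R := quot_lift h.
have k1m : star_morphism k1 := quot_lift_morphism hm h_rel.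
have k1_pi a : k1 (quot_pi _ a) = h a := quot_lift_pi hm h_rel a.
have k1_mon x : star_monomial leavittV leavittY x ->
    exists2 y, star_monomial cohnV cohnY y & k1 x = h1 y.
  elim=> {x} [v|e|a b _ [a' Ha aE] _ [b' Hb bE]|a _ [a' Ha aE]].
  - by exists (cohnV v); [constructor|rewrite k1_pi].
  - by exists (cohnY e); [constructor|rewrite k1_pi].
  - exists (a' · b'); first by constructor.
    by rewrite (star_morphM k1m) (star_morphM h1m) aE bE.
  - exists (star a'); first by constructor.
    by rewrite (star_morphS k1m) (star_morphS h1m) aE.
have k1_rel a b : tame_rel leavittV leavittY a b -> k1 a = k1 b.
  case=> {a b} x y /k1_mon[x' Hx xE] /k1_mon[y' Hy yE].
  rewrite !(star_morphM k1m) !(star_morphS k1m) xE yE.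
  rewrite -!(star_morphS h1m) -!(star_morphM h1m).
  by congr (quot_pi R _); exact/quot_pi_rel/tame_comm.
pose k : leavitt_ab -> quot R := quot_lift k1.
have km : star_morphism k := quot_lift_morphism k1m k1_rel.
have k_pi x : k (quot_pi _ x) = k1 x := quot_lift_pi k1m k1_rel x.
have kE a : k (tame_proj a) = quot_pi R a.
  have [a1 ->] := quot_pi_surj a; have [a2 ->] := quot_pi_surj a1.
  by rewrite tame_proj_pi cohn_to_leavitt_pi k_pi k1_pi.
move=> a /= a0; have := kE a; rewrite a0 (star_morph0 km).
by rewrite -(star_morph0 pi_R) => /esym/quot_piP; rewrite subr0.
Qed.

Definition letter_elt (y : letter E) : cohn_ab :=
  if y.2 then star (cohn_abY y.1) else cohn_abY y.1.

(* The trailing vertex is a right unit for nontrivial paths, and is the value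
   of the product for trivial ones. *)
Definition path_elt (p : gpath E) : cohn_ab :=
  \big[amul/cohn_abV (prng p)]_(y <- p.2) letter_elt y.

Definition path_proj (p : gpath E) : cohn_ab := path_elt p · star (path_elt p).

(* The factors of the following two products, for T in X_0(v), commute and lie
   in the corner of [cohn_ab] at v, the unit of which is the vertex v. *)
Definition eT (v : vert) (T : set (gpath E)) : cohn_ab :=
  \big[amul/cohn_abV v]_(p <- fset_set (maxl T)) path_proj p.

Definition eTF (v : vert) (T F : set (gpath E)) : cohn_ab :=
  eT v T · \big[amul/cohn_abV v]_(p <- fset_set F)
             (path_proj (nbr_base T p) - path_proj p).

Definition basis_elt (T F : set (gpath E)) (g : gpath E) : cohn_ab :=
  eTF (psrc g) T F · path_elt g.

Definition kernel_basis (ch : choice_function E) : set cohn_ab :=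
  [set b | exists (T F : set (gpath E)) (g g0 : gpath E),
    [/\ X0v (psrc g) T,
        blocking_family T F /\ F !=set0,
        FC g /\ (edge_part g g0 /\ T g0),
        reduced_rel ch T F g0
      & b = basis_elt T F g]].

End PathAlgebras.
Arguments tame_kernel {K} c E _.
Arguments kernel_basis {K} c {E} ch _.

Definition lin_indep (K : comPzRingType) (M : lmodType K) (B : set M) :=
  forall (s : seq M) (a : M -> K), uniq s -> [set` s] `<=` B ->
    \sum_(x <- s) a x *: x = 0 -> forall x, x \in s -> a x = 0.

Definition lin_span (K : comPzRingType) (M : lmodType K) (B : set M) : set M :=
  [set y | exists (s : seq M) (a : M -> K),
    [set` s] `<=` B /\ y = \sum_(x <- s) a x *: x].

Definition is_basis (K : comPzRingType) (M : lmodType K) (B N : set M) :=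
  lin_indep B /\ lin_span B = N.

(* Main.v *)
(* Reading the reduced prefixes of a word as a tree (Munn) shows that
   the elements e(T) g with T in X_0 and g_0 in T span the tame Cohn algebra,
   and that m q_X m' is 0 or some e(T \ gamma X) g for monomials m, m'.  The
   elements e(T) g are independent: letting letters move points of the closure
   of S under inverse edges defines a representation in which e(T) g sends the
   delta function at h to a function with value [T contained in S][g = h] at
   the root of S.

   Everything else follows from
     e(T \ F u gamma X) = e(T \ F) - sum_(x in X) e(T u {gamma x} \ F).
   Solved for the term of the distinguished x in X, it removes a maximal
   element of T ending in a distinguished edge, which gives the spanning
   property; iterated, it expands e(T \ F) with leading term
   e(T u {gamma x : gamma X in F, x distinguished}), and for reduced (T, F)
   the leading term determines (T, F), which gives linear independence. *)
Require Import Defs.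
From HB Require Import structures.
From mathcomp Require Import all_boot all_algebra finmap all_classical.

Set Implicit Arguments.
Unset Strict Implicit.
Unset Printing Implicit Defensive.

Import GRing.Theory Defs.
Local Open Scope classical_set_scope.
Local Open Scope ring_scope.

(** * Linear independence and triangular families *)

(** Since e*e = r(e), appending inverse edges to a path does not change its range projection. So a
    tree that acquires maximal elements ending in inverse edges, be it a Munn tree or a tree that
    has lost a maximal element, can be trimmed to its [core]. The exception made for g_0 is forced:
    rewriting deletes a maximal element of T, and g_0 must stay in T for the new terms to be
    admissible. It does no harm to independence, because g, hence g_0, is part of the index and
    tells which maximal element to disregard when F is read off the leading term. One number, the
    count of paths in a tree that end in a distinguished edge, serves both as the measure that makes
    the rewriting terminate and as the order in which the expansion is triangular. Leading
    coefficients are 1 or -1, so the argument works over any commutative ring K. *)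

Section WeightedLists.
Variables (K : comPzRingType) (M : lmodType K) (I : choiceType).
Implicit Types (s : seq (K * I)) (e : I -> M) (D : set I) (B : set M).

Definition coef s (i : I) : K := \sum_(x <- s | x.2 == i) x.1.
Definition combo e s : M := \sum_(x <- s) x.1 *: e x.2.
Definition supported D s := forall x, x \in s -> D x.2.

(** Indices may repeat in [s], so expansions can be concatenated as they come; only [coef] collects
    multiplicities. Independence concerns the family rather than its image. *)
Definition indep D e :=
  forall s, supported D s -> combo e s = 0 -> forall i, coef s i = 0.

Lemma comboE e s :
  combo e s = \sum_(i <- undup [seq x.2 | x <- s]) coef s i *: e i.
Proof.
rewrite /combo /coef; under [RHS]eq_bigr do rewrite big_mkcond scaler_suml.
rewrite exchange_big /= big_seq [RHS]big_seq; apply: eq_bigr => x xs.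
have xu : x.2 \in undup [seq x.2 | x <- s] by rewrite mem_undup map_f.
rewrite (bigD1_seq x.2) ?undup_uniq //= eqxx big1 ?addr0 // => i /negbTE.
by rewrite eq_sym => ->; rewrite scale0r.
Qed.

Lemma smallest_submodule B : submodule (smallest submodule B).
Proof.
split=> [N [[]]//|a b Ba Bb N HN|k a Ba N HN].
  by have [[_ + _] _] := HN; apply; [exact: Ba|exact: Bb].
by have [[_ _ +] _] := HN; apply; exact: Ba.
Qed.

Lemma submodule_sum (N : set M) (J : eqType) (r : seq J) (F : J -> M) :
  submodule N -> (forall j, j \in r -> N (F j)) -> N (\sum_(j <- r) F j).
Proof.
move=> [N0 ND _] NF; rewrite big_seq.
by elim/big_ind: _ => // j; exact: NF.
Qed.

Lemma span_combo D e y : smallest submodule (e @` D) y ->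
  exists2 s, supported D s & y = combo e s.
Proof.
move=> Sy; apply: (Sy [set y | exists2 s, supported D s & y = combo e s]).
split; last first.
  move=> _ [i Di <-]; exists [:: (1, i)].
    by move=> x; rewrite inE => /eqP ->.
  by rewrite /combo big_seq1 scale1r.
split=> /=.
- by exists [::] => //; rewrite /combo big_nil.
- move=> a b [s Ds ->] [t Dt ->]; exists (s ++ t).
    by move=> x; rewrite mem_cat => /orP[/Ds|/Dt].
  by rewrite /combo big_cat.
- move=> k a [s Ds ->]; exists [seq (k * x.1, x.2) | x <- s].
    by move=> x /mapP[z zs ->]; exact: (Ds z zs).
  rewrite /combo big_map scaler_sumr; apply: eq_bigr => x _ /=.
  by rewrite scalerA.
Qed.

End WeightedLists.

Lemma lin_spanE (K : comPzRingType) (M : lmodType K) (B : set M) :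
  lin_span B = smallest submodule B.
Proof.
apply/seteqP; split=> [_ [s [a [sB ->]]]|y].
  have SM := smallest_submodule B.
  apply: submodule_sum => // x xs.
  by case: SM => _ _; apply; apply: sub_gen_smallest; exact: sB.
rewrite -[B in smallest _ B]image_id => /span_combo[s sB ->].
exists (undup [seq x.2 | x <- s]), (coef s); split; last exact: comboE.
by move=> x /=; rewrite mem_undup => /mapP[z /sB ? ->].
Qed.

(** Among the indices with nonzero coefficient, take one whose leading term has the largest measure.
    No lower term of any expansion reaches that leading index and no other leading term equals it,
    so its total coefficient is, up to sign, the chosen one. *)
Lemma indep_triangular (K : comPzRingType) (M : lmodType K) (I J : choiceType)
    (e : I -> M) (D : set I) (b : J -> M) (DJ : set J) (lead : J -> I)
    (m : I -> nat) :
  indep D e -> {in DJ &, injective lead} -> (forall j, DJ j -> D (lead j)) ->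
  (forall j, DJ j -> exists (d : bool) y, b j = (-1) ^+ d *: e (lead j) + y /\
    smallest submodule (e @` [set i | D i /\ (m i < m (lead j))%N]) y) ->
  indep DJ b.
Proof.
move=> De lead_inj Dlead blead s Ds; rewrite comboE.
set L := undup _ => L0 j0; apply: contrapT => /eqP cj0.
pose L' := [seq j <- L | coef s j != 0].
have LD j : j \in L -> DJ j by rewrite mem_undup => /mapP[x /Ds ? ->].
have : exists2 j, j \in L' & forall i, i \in L' -> (m (lead i) <= m (lead j))%N.
  have : j0 \in L'.
    rewrite mem_filter cj0; have [//|nL] := boolP (j0 \in L).
    case/eqP: cj0; rewrite /coef big_seq_cond big1 // => x /andP[xs /eqP xj].
    by case/negP: nL; rewrite mem_undup -xj map_f.
  elim: L' (j0) => // x r IH y _; case: r IH => [_|z r IH].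
    by exists x => [|i]; rewrite inE // => /eqP ->.
  have [|j jr jmax] := IH z; first by rewrite inE eqxx.
  have [jx|xj] := leqP (m (lead x)) (m (lead j)).
    by exists j; [rewrite inE jr orbT|move=> i; rewrite inE => /orP[/eqP ->|/jmax]].
  exists x => [|i]; first by rewrite inE eqxx.
  by rewrite inE => /orP[/eqP ->//|/jmax /leq_trans]; apply; exact: ltnW.
move=> [j jL' jmax]; have := jL'; rewrite mem_filter => /andP[cj jL].
(* Outside [DJ] the pair is arbitrary, which makes the choice of expansions total. *)
have {}blead i : exists dt : bool * seq (K * I), DJ i -> 
    b i = combo e (((-1) ^+ dt.1, lead i) :: dt.2) /\
    supported [set i' | D i' /\ (m i' < m (lead i))%N] dt.2.
  have [/blead[d [y [-> /span_combo[t Dt ->]]]]|nD] := pselect (DJ i).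
    by exists (d, t) => _; split=> //; rewrite /combo big_cons.
  by exists (false, [::]).
have {blead}[f fP] := choice blead.
pose l i := [seq (coef s i * x.1, x.2) | x <- ((-1) ^+ (f i).1, lead i) :: (f i).2].
have /(De (flatten [seq l i | i <- L'])) : supported D (flatten [seq l i | i <- L']).
  move=> x /flatten_mapP[i]; rewrite mem_filter => /andP[_ /LD Di].
  move=> /mapP[y yl ->] /=; move: yl; rewrite inE => /orP[/eqP ->/=|].
    exact: Dlead.
  by case: (fP i Di) => _ /[apply] -[].
have bl i : i \in L' -> combo e (l i) = coef s i *: b i.
  rewrite mem_filter => /andP[_ /LD Di]; have [-> _] := fP i Di.
  rewrite /combo big_map scaler_sumr; apply: eq_bigr => x _ /=.
  by rewrite scalerA.
have -> : combo e (flatten [seq l i | i <- L']) = 0.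
  rewrite /combo big_flatten big_map big_seq -[RHS]L0.
  under eq_bigr => i iL' do rewrite -/(combo e (l i)) bl //.
  rewrite -big_seq big_filter [RHS](bigID (fun i => coef s i != 0)) /=.
  by rewrite [X in _ + X]big1 ?addr0 // => i /negPn/eqP ->; rewrite scale0r.
move=> /(_ erefl (lead j)).
rewrite /coef big_flatten big_map (bigD1_seq j) ?filter_uniq ?undup_uniq //=.
have low i : i \in L' -> \sum_(x <- (f i).2 | x.2 == lead j) coef s i * x.1 = 0.
  move=> iL'; have := iL'; rewrite mem_filter => /andP[_ /LD Di].
  rewrite big_seq_cond big1 // => x /andP[xf /eqP xj].
  have [_ /(_ x xf) /= [_]] := fP i Di.
  by rewrite xj ltnNge jmax.
rewrite big_cons /= eqxx big_map low // addr0 big_seq_cond big1 ?addr0; last first.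
  move=> i /andP[iL' ij]; rewrite big_cons /= big_map low // addr0.
  case: eqP => // lij; case/eqP: ij; apply: lead_inj => //; apply/mem_set/LD.
    by have := iL'; rewrite mem_filter => /andP[].
  by have := jL'; rewrite mem_filter => /andP[].
move/eqP; rewrite mulrC; case: (f j).1 => /=; last by rewrite expr0 mul1r (negbTE cj).
by rewrite expr1 mulN1r oppr_eq0 (negbTE cj).
Qed.

Lemma indep_lin_indep (K : comPzRingType) (M : lmodType K) (J : choiceType)
    (b : J -> M) (DJ : set J) : indep DJ b -> lin_indep (b @` DJ).
Proof.
move=> Db s a us sB s0 x xs; have [j0 _ _] := sB x xs.
have ex y : exists j, y \in s -> DJ j /\ b j = y.
  have [ys|nys] := boolP (y \in s); last by exists j0.
  by have [j ? ?] := sB y ys; exists j.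
have [f fP] := choice ex.
have := Db [seq (a x, f x) | x <- s] _ _ (f x).
rewrite /coef big_map big_mkcond (bigD1_seq x) //= eqxx.
rewrite big_seq_cond big1 ?addr0; last first.
  move=> y /andP[ys yx]; case: eqP => // fyx.
  by case/eqP: yx; rewrite -(fP y ys).2 fyx (fP x xs).2.
apply.
  by move=> y /mapP[z zs ->] /=; exact: (fP z zs).1.
rewrite /combo big_map /= -[RHS]s0 big_seq [RHS]big_seq.
by apply: eq_bigr => y ys; rewrite (fP y ys).2.
Qed.

(** * Separated words *)

Section Words.
Variable E : sepGraph.
Local Notation vert := (vert E).
Local Notation edge := (edge E).
Local Notation letter := (letter E).
Local Notation gpath := (gpath E).
Implicit Types (y z : letter) (u w : seq letter) (e f : edge) (v : vert).
Implicit Types (p q : gpath) (T F : set gpath) (X : set edge).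

Lemma linvK : involutive (@linv E).
Proof. by case=> e b; rewrite /linv /= negbK. Qed.

Lemma lsrc_linv y : lsrc (linv y) = lrng y.
Proof. by case: y => e []. Qed.

Lemma lrng_linv y : lrng (linv y) = lsrc y.
Proof. by case: y => e []. Qed.

Definition same_block e f : bool :=
  `[< exists X, [/\ @sep_all E X, X e & X f] >].

Lemma same_blockP e f :
  reflect (exists X, [/\ @sep_all E X, X e & X f]) (same_block e f).
Proof. exact: asboolP. Qed.

Lemma sep_src v X e : @sep E v X -> X e -> src e = v.
Proof.
by have [+ _ _] := @sepP E v => /seteqP[sv _] vX Xe; apply: sv; exists X.
Qed.

Lemma sep_unique X Y e : @sep_all E X -> @sep_all E Y -> X e -> Y e -> X = Y.
Proof.
move=> [v _ vX] [w _ wY] Xe Ye.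
have := wY; rewrite -(sep_src wY Ye) (sep_src vX Xe) => vY.
by have [_ /(_ X Y vX vY) tr _] := @sepP E v; apply: tr; exists e.
Qed.

Lemma sep_neq0 v X : @sep E v X -> X !=set0.
Proof. by have [_ _ +] := @sepP E v; exact. Qed.

Lemma same_block_in X e f : @sep_all E X -> X e -> same_block e f -> X f.
Proof. by move=> sX Xe /same_blockP[Y [sY Ye Yf]]; rewrite (sep_unique sX sY Xe Ye). Qed.

Lemma same_block_sym : symmetric same_block.
Proof. by move=> e f; apply/same_blockP/same_blockP => -[X [? ? ?]]; exists X. Qed.

(** Reducedness and separatedness both forbid certain two-letter subwords, so together they amount
    to sortedness for one relation. Prefixes, inverses and concatenations of C-separated paths are
    then handled by [sorted]. *)
Definition follows y z : bool :=
  (z != linv y) && ~~ [&& y.2, ~~ z.2 & same_block y.1 z.1].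

Lemma follows_linv y z : follows (linv z) (linv y) = follows y z.
Proof.
rewrite /follows linvK -[in X in ~~ X && _](inj_eq (can_inj linvK)) linvK eq_sym.
by case: y z => [e []] [f []] //=; rewrite same_block_sym.
Qed.

Definition walk_end v w := last v [seq lrng y | y <- w].

Lemma walk_end_cat v u w : walk_end v (u ++ w) = walk_end (walk_end v u) w.
Proof. by rewrite /walk_end map_cat last_cat. Qed.

Lemma walk_end_rcons v u y : walk_end v (rcons u y) = lrng y.
Proof. by rewrite /walk_end map_rcons last_rcons. Qed.

Lemma is_walk_cat v u w :
  is_walk v (u ++ w) = is_walk v u && is_walk (walk_end v u) w.
Proof. by elim: u v => [|y u IH] v //=; rewrite IH andbA. Qed.

Lemma is_walk_rcons v u y :
  is_walk v (rcons u y) = is_walk v u && (lsrc y == walk_end v u).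
Proof. by rewrite -cats1 is_walk_cat /= andbT. Qed.

Definition word_inv w := rev [seq linv y | y <- w].

Lemma word_inv_cat u w : word_inv (u ++ w) = word_inv w ++ word_inv u.
Proof. by rewrite /word_inv map_cat rev_cat. Qed.

Lemma word_inv_cons y w : word_inv (y :: w) = rcons (word_inv w) (linv y).
Proof. by rewrite /word_inv /= rev_cons. Qed.

Lemma walk_end_inv v w : is_walk v w -> walk_end (walk_end v w) (word_inv w) = v.
Proof.
elim: w v => //= y w IH v /andP[/eqP yv ?].
by rewrite word_inv_cons walk_end_rcons lrng_linv.
Qed.

Lemma is_walk_inv v w : is_walk v w -> is_walk (walk_end v w) (word_inv w).
Proof.
elim: w v => //= y w IH v /andP[/eqP yv wy].
rewrite word_inv_cons is_walk_rcons lsrc_linv -[walk_end v _]/(walk_end (lrng y) w).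
by rewrite walk_end_inv // IH //= eqxx.
Qed.

Lemma sorted_word_inv w : sorted follows (word_inv w) = sorted follows w.
Proof.
rewrite rev_sorted sorted_map; apply: eq_sorted => y z /=.
exact: follows_linv.
Qed.



Lemma FCP p : FC p <-> is_walk p.1 p.2 /\ sorted follows p.2.
Proof.
split=> [[pw pr ps]|[pw ps]].
  split=> //; suff sub w : infix w p.2 -> sorted follows w by exact: sub (infix_refl _).
  elim: w => // y [//|z w] IH wp /=; have /= -> : sorted follows (z :: w).
    by apply: IH; move: wp; rewrite -cat1s => /catl_infix.
  rewrite andbT.
  have yz : infix [:: y; z] p.2.
    by move: wp; rewrite -[_ :: _]/([:: y; z] ++ w) => /catr_infix.
  apply/andP; split; first by apply/eqP => zy; move: (pr y); rewrite -zy yz.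
  apply/negP => /and3P[y2 z2 /same_blockP[X [sX Xy Xz]]].
  move: (ps X _ _ sX Xy Xz); rewrite /bwd /fwd.
  by case: y z y2 z2 yz {Xy Xz wp IH} => ? [] [? []] //= _ _ ->.
have ok y z : infix [:: y; z] p.2 -> follows y z.
  by move=> /infix_sorted /(_ ps) /=; rewrite andbT.
split=> // [y|X x y sX Xx Xy].
  by apply/negP => /ok; rewrite /follows eqxx.
apply/negP => /ok /andP[_ /negP]; apply; apply/and3P; split=> //.
by apply/same_blockP; exists X.
Qed.



End Words.

(** * Branching paths, compatibility, and the decomposition g = g_0 w *)

Section Trees.
Variable E : sepGraph.
Local Notation vert := (vert E).
Local Notation edge := (edge E).
Local Notation letter := (letter E).
Local Notation gpath := (gpath E).
Implicit Types (y z : letter) (u w c : seq letter) (e f : edge) (v : vert).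
Implicit Types (p q : gpath) (T U F : set gpath) (X : set edge).

(** Incompatibility in terms of words: the paths part along two distinct edges of one block, so that
    the quotient of one by the other contains f^-1 e at the junction. *)
Definition branch u w : Prop := exists c e f,
  [/\ e != f, same_block e f, prefix (rcons c (fwd e)) u
    & prefix (rcons c (fwd f)) w].

Lemma branch_sym u w : branch u w -> branch w u.
Proof.
by move=> [c [e [f [ef sef eu fw]]]]; exists c, f, e; rewrite eq_sym same_block_sym.
Qed.

Lemma branch_prefix u u' w w' :
  prefix u u' -> prefix w w' -> branch u w -> branch u' w'.
Proof.
move=> uu' ww' [c [e [f [ef sef eu fw]]]]; exists c, e, f.
by rewrite (prefix_trans eu uu') (prefix_trans fw ww').
Qed.

Lemma branch_irr u : ~ branch u u.
Proof.
move=> [c [e [f [ef _ /prefixP[a ->]]]]].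
rewrite cat_rcons -cats1 prefix_catr // eqxx /= => /andP[/eqP[fe] _].
by rewrite fe eqxx in ef.
Qed.

Lemma common_prefix u w : exists c a b,
  [/\ u = c ++ a, w = c ++ b & forall y a' z b', a = y :: a' -> b = z :: b' -> y != z].
Proof.
elim: u w => [|y u IH] [|z w]; [by exists [::], [::], [::]|by exists [::], [::], (z :: w)|
  by exists [::], (y :: u), [::]|].
have [<-|yz] := eqVneq y z; last first.
  by exists [::], (y :: u), (z :: w); split=> // _ _ _ _ [<- _] [<- _].
by have [c [a [b [-> -> ab]]]] := IH w; exists (y :: c), a, b.
Qed.

Lemma reduce_inv_cat c a : sorted (@follows E) (c ++ a) ->
  foldr (@reduce_cons E) [::] (word_inv c ++ c ++ a) = a.
Proof.
have reduce_sorted w : sorted (@follows E) w -> foldr (@reduce_cons E) [::] w = w.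
  elim: w => // y [//|z w] IH /= /andP[/andP[/negbTE zy _] zw].
  rewrite -[LHS]/(reduce_cons y (foldr (@reduce_cons E) [::] (z :: w))).
  by rewrite IH //= zy.
elim: c => [|y c IH] ca; first exact: reduce_sorted.
rewrite word_inv_cons cat_rcons foldr_cat.
have -> : foldr (@reduce_cons E) [::] (linv y :: (y :: c) ++ a) = c ++ a.
  by rewrite [LHS]/= -[reduce_cons y _]/(foldr (@reduce_cons E) [::] ((y :: c) ++ a))
    reduce_sorted //= linvK eqxx.
have ca' : sorted (@follows E) (c ++ a) by move: ca => /= /path_sorted.
by rewrite -[in RHS](IH ca') foldr_cat reduce_sorted.
Qed.

(** Once the common prefix is cancelled, the quotient admits no further cancellation and its two
    halves are already separated. Membership in [FC] is decided by the two letters at the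
    junction. *)
Lemma compatibleP v p q : FCv v p -> FCv v q -> compatible p q <-> ~ branch p.2 q.2.
Proof.
case: p q => [v1 u] [v2 w] [/FCP/= + /= v1v] [/FCP/= + /= v2v].
rewrite {}v1v {}v2v => -[wu su] [ww sw].
have [c [a [b [uE wE ab]]]] := common_prefix u w.
have sb : sorted (@follows E) (word_inv b).
  by rewrite sorted_word_inv; move: sw; rewrite wE => /cat_sorted2[].
have sa : sorted (@follows E) a by move: su; rewrite uE => /cat_sorted2[].
have fold_rev d b' y : sorted (@follows E) (y :: b') ->
    (forall z d', d = z :: d' -> z != y) ->
    foldr (@reduce_cons E) d (word_inv (y :: b')) = word_inv (y :: b') ++ d.
  elim: b' y d => [|z b' IH] y d.
    by move=> _ dy; case: d dy => //= z d dy; rewrite linvK (negbTE (dy z d erefl)).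
  move=> /= /andP[/andP[zy _] zb] dy; rewrite word_inv_cons foldr_rcons cat_rcons.
  have -> : reduce_cons (linv y) d = linv y :: d.
    by case: d dy => //= t d dy; rewrite linvK (negbTE (dy t d erefl)).
  by apply: IH => // _ _ [<- _]; rewrite eq_sym.
have -> : compatible (v, u) (v, w) <-> sorted (@follows E) (word_inv b ++ a).
  rewrite /compatible /pdot /pinv /= -[rev _]/(word_inv w) {1}uE {2}wE.
  rewrite word_inv_cat -catA foldr_cat reduce_inv_cat -?uE //.
  have -> : foldr (@reduce_cons E) a (word_inv b) = word_inv b ++ a.
    case: b ab sb {wE} => // y b ab; rewrite sorted_word_inv => sb.
    by apply: fold_rev => // z d' ad; exact: ab ad erefl.
  rewrite FCP /=; split=> [[]//|]; split=> //.
  move: wu ww; rewrite uE wE /prng /= !is_walk_cat => /andP[_ wa] /andP[_ wb].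
  by rewrite -[last _ _]/(walk_end _ _) walk_end_cat is_walk_inv //= walk_end_inv.
case: b a => [|z b] [|y a] in uE wE ab sb sa *; rewrite ?cats0 /=.
- split=> // _; rewrite uE wE; exact: branch_irr.
- split=> // _ br; apply: (@branch_irr u); apply: branch_prefix br; first exact: prefix_refl.
  by rewrite uE wE cats0; exact: prefix_prefix.
- split=> // _ br; apply: (@branch_irr w); apply: branch_prefix br; last exact: prefix_refl.
  by rewrite uE wE cats0; exact: prefix_prefix.
have yz := ab _ _ _ _ erefl erefl.
move: (sa); rewrite word_inv_cons cat_rcons sorted_cat_cons -word_inv_cons sb /= => ->.
rewrite andbT /follows linvK yz /=; split.
  move=> /negP zy [d [e [f [ef sef]]]]; rewrite uE wE => /prefixP[a' uE'] /prefixP[b' wE'].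
  (* If [d] were shorter than the common prefix [c], the edges [e] and [f] would coincide; if
     longer, the letters [y] and [z] would. *)
  have [m|m] := ltnP (size d) (size c).
    have : nth y (c ++ y :: a) (size d) = nth y (c ++ z :: b) (size d).
      by rewrite !nth_cat m.
    by rewrite uE' wE' !nth_cat !size_rcons !ltnS !leqnn !nth_rcons ltnn eqxx => -[fe]; rewrite fe eqxx in ef.
  have [cd|cd] := ltnP (size c) (size d).
    have : nth y (c ++ y :: a) (size c) = nth y (c ++ z :: b) (size c).
      by rewrite uE' wE' !nth_cat !size_rcons !ltnS m !nth_rcons cd.
    by rewrite !nth_cat ltnn subnn /= => yz'; rewrite yz' eqxx in yz.
  have sdc : size d = size c by apply/eqP; rewrite eqn_leq cd m.
  move: uE' wE'; rewrite !cat_rcons => /eqP; rewrite eqseq_cat ?sdc // => /andP[_ /eqP[yE _]].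
  move=> /eqP; rewrite eqseq_cat ?sdc // => /andP[_ /eqP[zE _]].
  by apply: zy; rewrite yE zE /= same_block_sym.
move=> nb; apply/negP => /andP[z2 /andP[y2 szy]]; apply: nb.
case: y z yz z2 y2 szy uE wE {ab sb sa} => [e []] [f []] //= ef _ _ sfe uE wE.
exists c, e, f; rewrite uE wE same_block_sym sfe; split=> //.
- by apply: contraNneq ef => ->.
- by rewrite -cats1 prefix_catr // eqxx /= eqxx prefix0s.
- by rewrite -cats1 prefix_catr // eqxx /= eqxx prefix0s.
Qed.

Definition ends_inv w : bool := last false [seq y.2 | y <- w].

Lemma ends_inv_rcons w y : ends_inv (rcons w y) = y.2.
Proof. by rewrite /ends_inv map_rcons last_rcons. Qed.

Lemma ends_in_inverseP p : ends_in_inverse p <-> ends_inv p.2.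
Proof.
split=> [[w [x ->]]|]; first by rewrite ends_inv_rcons.
case: p => v /= w; case/lastP: w => // w [x b]; rewrite ends_inv_rcons /= => b1.
by exists w, x; rewrite b1.
Qed.

Lemma edge_endP p : p.2 = [::] \/ ends_in_edge p <-> ~~ ends_inv p.2.
Proof.
split=> [[->//|[w [x ->]]]|]; first by rewrite ends_inv_rcons.
case: p => v /= w; case/lastP: w => [|w [x b]]; first by left.
by rewrite ends_inv_rcons /= => /negbTE b0; right; exists w, x; rewrite b0.
Qed.

Lemma inverse_wordP p : inverse_word p <-> all snd p.2.
Proof.
split=> [[xs ->]|inv_p]; first by elim: xs.
exists [seq y.1 | y <- p.2]; move: inv_p; elim: p.2 => //= -[e b] w IH /andP[/= -> /IH {1}->].
by [].
Qed.

(* the word of g_0 in the decomposition g = g_0 w *)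
Fixpoint strip_inv w := if w is y :: w' then if y.2 then strip_inv w' else w else [::].
Definition epart w := rev (strip_inv (rev w)).

Lemma epart_rcons w y : epart (rcons w y) = if y.2 then epart w else rcons w y.
Proof. by rewrite /epart rev_rcons /=; case: ifP => // _; rewrite rev_cons revK. Qed.

Lemma epartP w : exists2 w1, w = epart w ++ w1 & all snd w1.
Proof.
elim/last_ind: w => [|w y [w1 wE aw]]; first by exists [::].
rewrite epart_rcons; case: ifP => y2; last by exists [::]; rewrite ?cats0.
by exists (rcons w1 y); rewrite ?all_rcons /= ?y2 // -rcons_cat -wE.
Qed.

Lemma prefix_epart w : prefix (epart w) w.
Proof. by have [w1 {2}-> _] := epartP w; exact: prefix_prefix. Qed.

Lemma ends_inv_epart w : ~~ ends_inv (epart w).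
Proof.
elim/last_ind: w => // w y; rewrite epart_rcons; case: ifP => // y2 _.
by rewrite ends_inv_rcons y2.
Qed.

Lemma epart_id w : ~~ ends_inv w -> epart w = w.
Proof. by case/lastP: w => // w y; rewrite ends_inv_rcons epart_rcons => /negbTE ->. Qed.

Lemma epart_cat w w1 : all snd w1 -> epart (w ++ w1) = epart w.
Proof.
elim/last_ind: w1 => [|w1 y IH]; first by rewrite cats0.
by rewrite all_rcons -rcons_cat epart_rcons => /andP[/= -> /IH].
Qed.

Lemma prefix_rconsE u w y : prefix u (rcons w y) = (u == rcons w y) || prefix u w.
Proof.
apply/idP/orP => [/prefixP[t]|[/eqP ->|uw]]; last 2 first.
- exact: prefix_refl.
- exact: prefix_trans uw (prefix_rcons _ _).
case/lastP: t => [|t z]; first by rewrite cats0 => ->; left.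
by rewrite -rcons_cat => /eqP; rewrite eqseq_rcons => /andP[/eqP -> _]; right; exact: prefix_prefix.
Qed.

Lemma prefix_epart_of u w : prefix u w -> ~~ ends_inv u -> prefix u (epart w).
Proof.
elim/last_ind: w => [|w y IH]; first by rewrite prefixs0 => /eqP ->.
rewrite prefix_rconsE => /orP[/eqP -> nu|uw nu].
  by rewrite epart_id //; exact: prefix_refl.
rewrite epart_rcons; case: ifP => _; first exact: IH.
exact: prefix_trans uw (prefix_rcons _ _).
Qed.

Lemma prefix_epart2 u w : prefix u w -> prefix (epart u) (epart w).
Proof.
by move=> uw; apply: prefix_epart_of (ends_inv_epart _); apply: prefix_trans uw; exact: prefix_epart.
Qed.

Lemma edge_partP p q : edge_part p q <-> q = (p.1, epart p.2).
Proof.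
split=> [[w [-> /inverse_wordP aw /edge_endP qe]]|->].
  by rewrite /= epart_cat // epart_id //; case: q {qe}.
have [w1 pE aw] := epartP p.2; exists (p.1, w1); split.
- by case: p pE => v w /= pE; rewrite /pcat /= -pE.
- exact/inverse_wordP.
- exact/edge_endP/ends_inv_epart.
Qed.

End Trees.

(** * Trees and blocking families *)

Section Slots.
Variable E : sepGraph.
Local Notation vert := (vert E).
Local Notation edge := (edge E).
Local Notation letter := (letter E).
Local Notation gpath := (gpath E).
Implicit Types (y z : letter) (u w c : seq letter) (e f : edge) (v : vert).
Implicit Types (p q g : gpath) (T U F : set gpath) (X : set edge).

(** This is [Xv] with compatibility replaced by the absence of branching. Maximal elements may end
    in inverse edges, as they do in Munn trees. *)
Definition tree v U := [/\ finite_set U, U (v, [::]), U `<=` FCv v, lower U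
  & forall p q, U p -> U q -> ~ branch p.2 q.2].

(** For finite sets this is the condition on maximal elements in [X0v], in a form that does not
    mention maximality. *)
Definition edgy U := forall p, U p -> exists q, [/\ U q, pprefix p q & ~~ ends_inv q.2].

(** The largest [edgy] part of a lower set [U]. It is obtained by trimming inverse edges at the
    ends, which leaves the product of the range projections unchanged. *)
Definition core U : set gpath :=
  [set p | exists q, [/\ U q, pprefix p q & ~~ ends_inv q.2]].

Definition part0 p : gpath := (p.1, epart p.2).

Definition rcp p e : gpath := (p.1, rcons p.2 (fwd e)).

Lemma pprefix_refl p : pprefix p p.
Proof. by rewrite /pprefix eqxx prefix_refl. Qed.

Lemma pprefix_trans p q r : pprefix p q -> pprefix q r -> pprefix p r.
Proof.
by move=> /andP[/eqP pq pq2] /andP[/eqP qr qr2]; rewrite /pprefix pq qr eqxx (prefix_trans pq2 qr2).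
Qed.

Lemma pprefix_cat p w : pprefix p (p.1, p.2 ++ w).
Proof. by rewrite /pprefix eqxx prefix_prefix. Qed.

Lemma pprefixP p q : reflect (exists w, q = (p.1, p.2 ++ w)) (pprefix p q).
Proof.
apply: (iffP andP) => [[/eqP pq /prefixP[w qE]]|[w ->]]; last by rewrite /= eqxx prefix_prefix.
by exists w; rewrite pq -qE; case: q {pq qE}.
Qed.

Lemma pprefix_rcp p q e : pprefix p (rcp q e) = (p == rcp q e) || pprefix p q.
Proof. by rewrite /pprefix /= prefix_rconsE -pair_eqE /= andb_orr. Qed.

Lemma FC_prefix p q : pprefix p q -> FC q -> FC p.
Proof.
move=> /pprefixP[w ->] /FCP/= [pw sw]; apply/FCP.
by move: pw; rewrite is_walk_cat => /andP[-> _]; have [] := cat_sorted2 sw.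
Qed.

Lemma FCv_prefix v p q : pprefix p q -> FCv v q -> FCv v p.
Proof.
move=> pq [FCq vq]; split; first exact: FC_prefix FCq.
by have /andP[/eqP pq1 _] := pq; exact: etrans pq1 vq.
Qed.

Lemma part0_prefix p : pprefix (part0 p) p.
Proof. by rewrite /pprefix eqxx prefix_epart. Qed.

Lemma rcp_neq p e : pprefix (rcp p e) p = false.
Proof.
apply/negbTE/negP => /pprefixP[w /(congr1 (fun q => size q.2)) /eqP] /=.
by rewrite size_cat size_rcons addSn -addnS -[X in X == _]addn0 eqn_add2l.
Qed.

Lemma size_bound U : finite_set U -> exists N, forall p, U p -> (size p.2 <= N)%N.
Proof.
move=> fU; exists (\max_(p <- fset_set U) size p.2) => p Up.
by apply: (leq_bigmax_seq p) => //; rewrite in_fset_set // inE.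
Qed.

Lemma maxl_above U p : finite_set U -> U p -> exists2 q, maxl U q & pprefix p q.
Proof.
move=> /size_bound[N UN]; have [n] := ubnP (N - size p.2).
elim: n p => // n IH p np Up.
have [mp|] := pselect (maxl U p); first by exists p => //; exact: pprefix_refl.
move=> nmax; have [q [Uq pq qp]] : exists q, [/\ U q, pprefix p q & q != p].
  apply: contrapT => nq; apply: nmax; split=> // q Uq pq.
  by apply/eqP; apply: contrapT => qp; apply: nq; exists q; split=> //; apply/negP.
have [|//|r mr qr] := IH q; last by exists r => //; exact: pprefix_trans pq qr.
have spq : (size p.2 < size q.2)%N.
  have /pprefixP[[|y w] qE] := pq; first by rewrite qE cats0 -surjective_pairing eqxx in qp.
  by rewrite qE /= size_cat /= addnS ltnS leq_addr.
by rewrite -ltnS; apply: leq_trans np; rewrite ltnS ltn_sub2l // (leq_trans spq) // UN.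
Qed.

Lemma X0vP v T : X0v v T <-> tree v T /\ edgy T.
Proof.
split=> [[[[p Tp] fT TF lT cT] mT]|[[fT Tv TF lT bT] eT]].
  split; last first.
    move=> q /(maxl_above fT)[r mr qr]; exists r; split=> //; first by case: mr.
    by apply/negP => /ends_in_inverseP; exact: mT.
  split=> //.
    apply: (lT _ _ Tp); have [_ vp] := TF _ Tp.
    by rewrite /pprefix prefix0s andbT eq_sym; exact/eqP.
  by move=> q r Tq Tr; apply/(compatibleP (TF _ Tq) (TF _ Tr)); exact: cT.
split.
  split=> //; first by exists (v, [::]).
  by move=> p q Tp Tq; apply/(compatibleP (TF _ Tp) (TF _ Tq)); exact: bT.
move=> p [Tp mp] /ends_in_inverseP pe; have [q [Tq pq]] := eT _ Tp.
by rewrite (mp _ Tq pq) pe.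
Qed.

Lemma finite_down p : finite_set (down [set p]).
Proof.
apply: (@sub_finite_set _ _ [set q : gpath | q \in [seq ((p.1, take n p.2) : gpath) | n <- iota 0 (size p.2).+1]]).
  move=> q [_ -> /pprefixP[w pE]]; apply/mapP; exists (size q.2).
    by rewrite mem_iota /= pE /= size_cat ltnS leq_addr.
  by rewrite pE /= take_size_cat //; case: q {pE}.
exact: finite_seq.
Qed.

Lemma tree_down v U p : tree v U -> FCv v p -> (forall q, U q -> ~ branch q.2 p.2) ->
  tree v (U `|` down [set p]).
Proof.
move=> [fU Uv UF lU bU] pF bp; split.
- by rewrite finite_setU; split=> //; exact: finite_down.
- by left.
- by move=> q [/UF //|[_ -> qp]]; exact: FCv_prefix qp pF.
- move=> q r [Ur|[_ -> rp]] qr; first by left; exact: lU Ur qr.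
  by right; exists p => //; exact: pprefix_trans qr rp.
have pre q : pprefix q p -> prefix q.2 p.2 by case/andP.
move=> q r [Uq|[_ -> /pre qp]] [Ur|[_ -> /pre rp]].
- exact: bU.
- by move/(branch_prefix (prefix_refl _) rp); exact: bp.
- by move/(branch_prefix qp (prefix_refl _))/branch_sym; exact: bp.
- by move/(branch_prefix qp rp)/branch_irr.
Qed.

Lemma edgy_down U p : edgy U -> ~~ ends_inv p.2 -> edgy (U `|` down [set p]).
Proof.
move=> eU pe q [/eU[r [Ur qr re]]|[_ -> qp]]; first by exists r; split=> //; left.
by exists p; split=> //; right; exists p => //; exact: pprefix_refl.
Qed.

Lemma tree_sub v U W : tree v U -> W `<=` U -> lower W -> W (v, [::]) -> tree v W.
Proof.
move=> [fU Uv UF lU bU] WU lW Wv; split=> //.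
- exact: sub_finite_set WU fU.
- by move=> p /WU /UF.
- by move=> p q /WU Up /WU; exact: bU.
Qed.

Lemma core_sub U : lower U -> core U `<=` U.
Proof. by move=> lU p [q [Uq pq _]]; exact: lU Uq pq. Qed.

Lemma core_lower U : lower (core U).
Proof. by move=> p q [r [Ur qr re]] pq; exists r; split=> //; exact: pprefix_trans qr. Qed.

Lemma core_edgy U : edgy (core U).
Proof.
move=> p [q [Uq pq qe]]; exists q; split=> //.
by exists q; split=> //; exact: pprefix_refl.
Qed.

Lemma core_part0 U p : lower U -> U p -> core U (part0 p).
Proof.
move=> lU Up; exists (part0 p); split; [|exact: pprefix_refl|exact: ends_inv_epart].
by apply: (lU _ _ Up); exact: part0_prefix.
Qed.

Lemma core_X0v v U : tree v U -> X0v v (core U).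
Proof.
move=> tU; have [_ Uv _ lU _] := tU; apply/X0vP; split; last exact: core_edgy.
apply: tree_sub tU _ _ _; [exact: core_sub|exact: core_lower|].
by exists (v, [::]); split=> //; exact: pprefix_refl.
Qed.

(* [g X] is an admissible block of a blocking family for [T]; unlike [block],
   this does not mention the decomposition of [g], which [Slot_decomp] recovers
   by taking the longest prefix of [g] in [T]. *)
Definition Slot T g X := [/\ T (part0 g), @sep E (prng g) X, finite_set X
  & forall x, X x -> [/\ FC (rcp g x), ~ T (rcp g x)
      & forall p, T p -> ~ branch p.2 (rcp g x).2]].

Lemma mul_edgesE g X : mul_edges g X = [set rcp g x | x in X].
Proof.
by apply/seteqP; split=> _ [x Xx <-]; exists x; rewrite // /pcat /rcp /= cats1.
Qed.

Lemma rcp_inj g g' x x' : rcp g x = rcp g' x' -> g = g' /\ x = x'.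
Proof.
case: g g' => [v u] [v' u'] [/= -> /rcons_inj[-> ->]].
by [].
Qed.

Lemma Slot_uniq T T' g X g' X' x x' : Slot T g X -> Slot T' g' X' -> X x -> X' x' ->
  rcp g x = rcp g' x' -> g = g' /\ X = X'.
Proof.
move=> [_ sX _ _] [_ sX' _ _] Xx Xx' /rcp_inj[gg' xx']; split=> //.
rewrite -xx' in Xx'.
by apply: (sep_unique _ _ Xx Xx'); [exists (prng g)|exists (prng g')].
Qed.

Lemma Slot_sub T T' g X : Slot T g X -> T' `<=` T -> T' (part0 g) -> Slot T' g X.
Proof.
move=> [_ sX fX gX] T'T T'g; split=> // x /gX[Fgx Tgx bgx]; split=> //.
  by move/T'T.
by move=> p /T'T; exact: bgx.
Qed.

Lemma Slot_X0v v T g X x : X0v v T -> Slot T g X -> X x ->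
  X0v v (T `|` down [set rcp g x]).
Proof.
move=> /X0vP[tT eT] [Tg _ _ /[apply] -[Fgx _ bgx]]; apply/X0vP; split.
  apply: tree_down => //; split=> //.
  by have [_ _ /(_ _ Tg)[]] := tT.
by apply: edgy_down => //; rewrite ends_inv_rcons.
Qed.

(** A branching of the two added paths that takes place below the last letter of either one is a
    branching with an edge-ended prefix, which lies in T, and the slots rule it out. Otherwise both
    paths branch at their last letters; then g = g' and x lies in X', against the assumption. *)
Lemma Slot_down v T g X g' X' x : X0v v T -> Slot T g X -> Slot T g' X' -> X x ->
  (forall x', X' x' -> rcp g x <> rcp g' x') ->
  Slot (T `|` down [set rcp g x]) g' X'.
Proof.
move=> /X0vP[[_ _ TF lT bT] _] Sg Sg' Xx ne.
have [Tg sX fX /(_ x Xx)[Fgx Tgx bgx]] := Sg; have [Tg' sX' fX' gX'] := Sg'.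
have edge_in_T p e : pprefix (rcp p e) g -> T (rcp p e).
  move=> /andP[/= pg1 pg]; apply: (lT _ _ Tg); rewrite /pprefix /= pg1.
  by apply: prefix_epart_of => //; rewrite ends_inv_rcons.
split=> // [|x' Xx']; first by left.
have [Fgx' Tgx' bgx'] := gX' x' Xx'; split=> //.
  move=> [//|[_ -> ]]; rewrite pprefix_rcp => /orP[/eqP/esym|/edge_in_T//].
  exact: ne.
move=> p [|[_ ->]]; first exact: bgx'.
rewrite pprefix_rcp => /orP[/eqP ->|/andP[_ pg]] [c [e [f [ef sef ce cf]]]]; last first.
  apply: (bgx' (part0 g) Tg); exists c, e, f; split=> //=.
  by apply: prefix_epart_of (prefix_trans ce pg) _; rewrite ends_inv_rcons.
move: (ce) (cf); rewrite /= !prefix_rconsE.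
have [/rcons_inj[cg eE] _|_ /= cg] := eqVneq (rcons c (fwd e)) (rcons g.2 (fwd x)); last first.
  case: (bgx' (part0 g) Tg); exists c, e, f; split=> //.
  by apply: prefix_epart_of => //; rewrite ends_inv_rcons.
case/orP => [/eqP/rcons_inj[cg' fE]|cg']; last first.
  case: (bgx (part0 g') Tg'); exists c, f, e; rewrite eq_sym same_block_sym; split=> //.
  by apply: prefix_epart_of => //; rewrite ends_inv_rcons.
have gg' : g = g'.
  have /TF[_ v1] := Tg; have /TF[_ v2] := Tg'.
  by rewrite [g]surjective_pairing [g']surjective_pairing -cg -cg' [g.1]v1 [g'.1]v2.
have sbx : same_block x' x by rewrite -eE -fE same_block_sym.
apply: (ne x); last by rewrite gg'.
by apply: same_block_in sbx => //; exists (prng g').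
Qed.

End Slots.

(** * Blocking families built block by block *)

Section Blocking.
Variable E : sepGraph.
Local Notation vert := (vert E).
Local Notation edge := (edge E).
Local Notation letter := (letter E).
Local Notation gpath := (gpath E).
Implicit Types (y z : letter) (u w c : seq letter) (e f : edge) (v : vert).
Implicit Types (p q g h : gpath) (T U F : set gpath) (X : set edge).

(** This form gives induction on blocks. Its blocks do not carry the components gamma_0 and gamma_1,
    which depend on T and would have to be recomputed whenever T changes. *)
Inductive bfam T : set gpath -> Prop :=
| bfam0 : bfam T set0
| bfamS F g X : bfam T F -> Slot T g X -> (forall x, X x -> ~ F (rcp g x)) ->
    bfam T (F `|` mul_edges g X).

Lemma pcat_edge h (w : gpath) x : pcat h (pcat w (edge_path x)) = rcp (pcat h w) x.
Proof. by rewrite /pcat /rcp /= catA cats1. Qed.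

Lemma block_Slot v T h (w : gpath) X : X0v v T -> block T h w X ->
  [/\ Slot T (pcat h w) X, T h & all snd w.2].
Proof.
move=> TX; have /X0vP[[fT Tv TF lT bT] eT] := TX.
move=> [wh /inverse_wordP aw [sX fX] Xnbr].
have [x0 Xx0] := sep_neq0 sX; have [Th _ _ _ _] := Xnbr x0 Xx0.
split=> //; split=> // [|x Xx].
  by apply: (lT _ _ Th); rewrite /part0 /= epart_cat //; exact: part0_prefix.
have [_ _ Fhx Thx [v' _ /X0vP[[_ _ TxF lTx bTx] _]]] := Xnbr x Xx.
rewrite -pcat_edge; split=> //; last first.
  move=> p Tp; apply: bTx; first by left.
  by right; exists (pcat h (pcat w (edge_path x))) => //; exact: pprefix_refl.
move=> Thwx; apply: Thx; apply: (lT _ _ Thwx).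
by rewrite /pprefix eqxx /= prefix_catr // eqxx prefix_take.
Qed.

Lemma Slot_block v T h w X : X0v v T -> T h -> all snd w ->
  (forall y w', w = y :: w' -> ~ T (h.1, rcons h.2 y)) ->
  Slot T (h.1, h.2 ++ w) X -> block T h (prng h, w) X.
Proof.
move=> TX Th aw hw SX; have [_ sX fX gX] := SX.
split=> //; first exact/inverse_wordP.
move=> x Xx; have [Fgx Tgx bgx] := gX x Xx.
have gE : pcat h (pcat (prng h, w) (edge_path x)) = rcp (h.1, h.2 ++ w) x.
  by rewrite pcat_edge.
split=> //; rewrite ?gE //.
- split; last first.
    by have [xs /= wE] := (inverse_wordP (prng h, w)).2 aw; exists xs, x; rewrite /= cats1 wE.
  split=> //; apply/FCP => /=; have /FCP[/=] := Fgx.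
  rewrite -cats1 -catA is_walk_cat => /andP[_ ->] /cat_sorted2[_ ?]; split=> //.
- rewrite /first_letter /=; case: w aw hw SX {sX gX} Fgx Tgx bgx gE => [|y w] aw hw SX Fgx Tgx bgx gE.
    by move: Tgx; rewrite /rcp /pcat /= cats0 cats1.
  by rewrite /pcat /= take0 cats1; exact: hw.
- by exists v => //; exact: Slot_X0v TX SX Xx.
Qed.

Lemma Slot_decomp v T g X : X0v v T -> Slot T g X ->
  exists h (w : gpath), block T h w X /\ g = pcat h w.
Proof.
move=> TX SX; have [Tg _ _ _] := SX; have /X0vP[[fT _ _ lT _] _] := TX.
have [h [Th hg hmax]] : exists h, [/\ T h, pprefix h g &
    forall q, T q -> pprefix q g -> (size q.2 <= size h.2)%N].
  have [N] := ubnP (size g.2 - size (part0 g).2).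
  elim: N (part0 g) Tg (part0_prefix g) => // N IH h Th hg hN.
  have [q|nq] := pselect (exists q, [/\ T q, pprefix q g & (size h.2 < size q.2)%N]).
    case: q => q [Tq qg hq]; apply: (IH q) => //.
    rewrite -ltnS; apply: leq_trans hN; rewrite ltnS ltn_sub2l // (leq_trans hq) //.
    by case/andP: qg => _ /prefixP[w ->]; rewrite size_cat leq_addr.
  exists h; split=> // q Tq qg; rewrite leqNgt; apply/negP => hq.
  by apply: nq; exists q.
have [w gE] := pprefixP _ _ hg; exists h, (prng h, w); split; last by [].
rewrite gE in SX; apply: (Slot_block TX Th _ _ SX).
  have [w1 gE1 aw1] := epartP g.2.
  (* The prefix [h] is at least as long as [part0 g], so what is left of [g] consists of inverse
     edges. *)
  have := hmax _ Tg (part0_prefix g) => sz.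
  have : w = drop (size h.2) g.2 by rewrite gE /= drop_size_cat.
  rewrite gE1 drop_cat ltnNge sz /= => ->.
  by rewrite -(cat_take_drop (size h.2 - size (epart g.2)) w1) all_cat in aw1; case/andP: aw1.
move=> y w' wE Thy; suff : (size (rcons h.2 y) <= size h.2)%N by rewrite size_rcons ltnn.
apply: (hmax _ Thy).
by rewrite /pprefix gE eqxx wE /= -cat_rcons prefix_prefix.
Qed.

Lemma bfamP v T F : X0v v T -> blocking_family T F <-> bfam T F.
Proof.
move=> TX; split=> [[_ _ [r [h [w [X [bX]]]]]]|].
  elim: r h w X bX F => [|r IH] h w X bX F tX ->.
    rewrite (_ : \bigcup__ _ = set0); first exact: bfam0.
    by apply/seteqP; split=> // x [[]].
  have {}IH := IH _ _ _ (fun i => bX (lift ord_max i)) _ _ erefl.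
  rewrite (_ : \bigcup_i _ = \bigcup_i mul_edges (pcat (h (lift ord_max i))
    (w (lift ord_max i))) (X (lift ord_max i)) `|`
    mul_edges (pcat (h ord_max) (w ord_max)) (X ord_max)).
    have [SX _ _] := block_Slot TX (bX ord_max).
    apply: bfamS => // [|x Xx [i _]].
      apply: IH => i j _ _ /(tX _ _ Logic.I Logic.I); exact: lift_inj.
    rewrite !mul_edgesE => -[x' Xx' xx'].
    case/eqP: (neq_lift ord_max i); apply: tX => //; rewrite !mul_edgesE.
    exists (rcp (pcat (h ord_max) (w ord_max)) x); split; first by exists x.
    by exists x'.
  apply/seteqP; split=> [p [i _ pi]|p [[i _ pi]|pi]].
  - have [j ij|ij] := unliftP ord_max i; [left; exists j; rewrite -?ij|right; rewrite -ij] => //.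
  - by exists (lift ord_max i).
  - by exists ord_max.
suff H : bfam T F -> exists (r : nat) (h w : 'I_r -> gpath) (X : 'I_r -> set edge),
    [/\ forall i, block T (h i) (w i) (X i),
          trivIset setT (fun i => mul_edges (pcat (h i) (w i)) (X i))
        & F = \bigcup_i mul_edges (pcat (h i) (w i)) (X i)].
  move=> bF; have [r [h [w [X [bX tX FE]]]]] := H bF.
  split; last by exists r, h, w, X.
    rewrite FE; apply: bigcup_finite => // i _; have [_ _ [_ fX] _] := bX i.
    exact: finite_image.
  move=> p; rewrite FE => -[i _ [x Xx <-]]; have [_ _ _ /(_ x Xx) nx] := bX i.
  exists (h i), (pcat (w i) (edge_path x)); split=> //.
  by rewrite pcat_edge /rcp /pcat /= cats1.
elim=> {F} [|F g X bF [r [h [w [XX [bX tX FE]]]]] SX gF].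
  by exists 0, (fun=> (v, [::])), (fun=> (v, [::])), (fun=> set0); split=> [[]//|[]//|];
     apply/seteqP; split=> // x [[]].
have [h0 [w0 [b0 gE]]] := Slot_decomp TX SX.
pose ext (A : Type) (a : A) (f : 'I_r -> A) (i : 'I_r.+1) :=
  if unlift ord_max i is Some j then f j else a.
exists r.+1, (ext _ h0 h), (ext _ w0 w), (ext _ X XX); rewrite /ext; split.
- by move=> i; case: unliftP.
- move=> i j _ _; case: unliftP => [i' ->|->]; case: unliftP => [j' ->|->] //.
  + by move=> /(tX _ _ Logic.I Logic.I) ->.
  + rewrite -gE !mul_edgesE => -[p [pi [x Xx pE]]]; case: (gF x Xx).
    by rewrite pE FE; exists i' => //; rewrite mul_edgesE.
  + rewrite -gE !mul_edgesE => -[p [[x Xx pE] pi]]; case: (gF x Xx).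
    by rewrite pE FE; exists j' => //; rewrite mul_edgesE.
- apply/seteqP; split=> [p [|pg]|p [i _]].
  + by rewrite FE => -[i _ pi]; exists (lift ord_max i) => //; rewrite liftK.
  + by exists ord_max => //; rewrite unlift_none -gE.
  + case: unliftP => [j _ pj|_]; last by rewrite -gE; right.
    by left; rewrite FE; exists j.
Qed.

(** At a maximal [h] no letter extends [h] inside T, so the side condition of the decomposition
    holds automatically. *)
Lemma blockedP v T F h : X0v v T -> maxl T h -> blocked T F h <->
  exists w X, [/\ Slot T (h.1, h.2 ++ w) X, all snd w
    & mul_edges (h.1, h.2 ++ w) X `<=` F].
Proof.
move=> TX [Th hmax]; split=> [[w [X [bX XF]]]|[w [X [SX aw XF]]]].
  by have [SX _ aw] := block_Slot TX bX; exists w.2, X.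
exists (prng h, w), X; split=> //; apply: (Slot_block TX Th aw _ SX) => y w' _ Thy.
have := hmax _ Thy; rewrite /pprefix eqxx prefix_rcons => /(_ erefl).
by move=> /(congr1 (fun q => size q.2)) /= /eqP; rewrite size_rcons eqn_leq ltnn.
Qed.

Lemma bfam_Slot T F p : bfam T F -> F p ->
  exists g X x, [/\ Slot T g X, X x, p = rcp g x & mul_edges g X `<=` F].
Proof.
elim=> // {}F g X _ IH SX _ [/IH[g' [X' [x [? ? ? XF]]]]|].
  by exists g', X', x; split=> //; left; apply: XF.
by rewrite mul_edgesE => -[x Xx <-]; exists g, X, x; split=> // q; rewrite mul_edgesE; right.
Qed.

Lemma bfam_finite T F : bfam T F -> finite_set F.
Proof.
elim=> // {}F g X _ fF [_ _ fX _] _; rewrite finite_setU; split=> //.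
exact: finite_image.
Qed.

(** Serves to pass to a larger or a smaller tree while keeping F. *)
Lemma bfam_mono T T' F : bfam T F ->
  (forall g X, Slot T g X -> mul_edges g X `<=` F -> Slot T' g X) -> bfam T' F.
Proof.
elim=> {F} [|F g X bF IH SX gF] TT'; first exact: bfam0.
apply: bfamS => //; last by apply: TT' => // p; right.
by apply: IH => g' X' SX' FX'; apply: TT' => // p /FX'; left.
Qed.

Lemma bfam_notin T F p : bfam T F -> F p -> ~ T p.
Proof.
move=> bF /(bfam_Slot bF)[g [X [x [[_ _ _ gX] Xx -> _]]]].
by have [_ ? _] := gX x Xx.
Qed.

End Blocking.

(** * Path elements and their range projections *)

Section PathElements.
Variables (K : comPzRingType) (c : involution K) (E : sepGraph).
Local Notation vert := (vert E).
Local Notation edge := (edge E).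
Local Notation letter := (letter E).
Local Notation gpath := (gpath E).
Local Notation A := (cohn_ab c E).
Local Notation V := (@cohn_abV K c E).
Local Notation Y := (@cohn_abY K c E).
Local Notation le := (@letter_elt K c E).
Local Notation pe := (@path_elt K c E).
Local Notation pr := (@path_proj K c E).
Implicit Types (y z : letter) (u w : seq letter) (e f : edge) (v : vert).
Implicit Types (p q g h : gpath) (T U F : set gpath) (X : set edge).
Implicit Types (a b : A) (r s : seq gpath).

Let toA := fun x : free_star c (vert + edge) =>
  quot_pi (tame_rel (@cohnV K c E) (@cohnY K c E)) (quot_pi (cohn_rel (@freeV K c E) (@freeY K c E)) x).

Let toA_morph : star_morphism toA.
Proof. exact: star_morph_comp (quot_pi_morphism _) (quot_pi_morphism _). Qed.

Lemma cohn_ab_rel a b : cohn_rel V Y a b -> a = b.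
Proof.
have rel d d' : cohn_rel (@freeV K c E) (@freeY K c E) d d' -> toA d = toA d'.
  by move=> dd'; congr (quot_pi _ _); exact: quot_pi_rel.
have S d : star (toA d) = toA (star d) by rewrite (star_morphS toA_morph).
have M d d' : toA d · toA d' = toA (d · d') by rewrite (star_morphM toA_morph).
have VE v : V v = toA (@freeV K c E v) by [].
have YE e : Y e = toA (@freeY K c E e) by [].
have Z : 0 = toA 0 by rewrite (star_morph0 toA_morph).
case=> [v|v|v w vw|e|e|e|e|e|X e f sX Xe Xf ef];
  rewrite ?VE ?YE ?Z ?S ?M; apply: rel; by [constructor|exact: cohn_ef Xe Xf ef].
Qed.

Lemma starV v : star (V v) = V v. Proof. by apply/cohn_ab_rel; constructor. Qed.
Lemma VV v : V v · V v = V v. Proof. by apply/cohn_ab_rel; constructor. Qed.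
Lemma VV0 v v' : v != v' -> V v · V v' = 0.
Proof. by move=> /eqP ?; apply/cohn_ab_rel; constructor. Qed.

Lemma star_letter y : star (le y) = le (linv y).
Proof. by case: y => e []; rewrite /letter_elt /= ?starK. Qed.

Lemma V_letter y : V (lsrc y) · le y = le y.
Proof. by case: y => e []; apply/cohn_ab_rel; constructor. Qed.

Lemma letter_V y : le y · V (lrng y) = le y.
Proof. by case: y => e []; apply/cohn_ab_rel; constructor. Qed.

Lemma bwd_fwd e : le (bwd e) · le (fwd e) = V (rng e).
Proof. by apply/cohn_ab_rel; constructor. Qed.

Lemma bwd_fwd0 e f : e != f -> same_block e f -> le (bwd e) · le (fwd f) = 0.
Proof.
move=> /eqP ef /same_blockP[X [sX Xe Xf]]; apply/cohn_ab_rel.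
exact: cohn_ef sX Xe Xf ef.
Qed.

Lemma path_elt0 v : pe (v, [::]) = V v.
Proof. by rewrite /path_elt big_nil. Qed.

Lemma path_elt_cons v y w : pe (v, y :: w) = le y · pe (lrng y, w).
Proof. by rewrite /path_elt big_cons. Qed.

Lemma V_path p : is_path p -> V p.1 · pe p = pe p.
Proof.
case: p => v [|y w] /=; first by rewrite path_elt0 VV.
by move=> /andP[/= /eqP <- _]; rewrite path_elt_cons amulA V_letter.
Qed.

Lemma path_V p : pe p · V (prng p) = pe p.
Proof.
case: p => v w; elim: w v => [|y w IH] v; first by rewrite path_elt0 VV.
by rewrite path_elt_cons -amulA -[prng _]/(prng (lrng y, w)) IH.
Qed.

Lemma path_elt_cat v u w : is_walk (walk_end v u) w ->
  pe (v, u ++ w) = pe (v, u) · pe (walk_end v u, w).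
Proof.
elim: u v => [|y u IH] v uw; first by rewrite path_elt0 (@V_path (v, w)).
by rewrite /= !path_elt_cons -amulA -IH.
Qed.

Lemma path_elt_rcons v u y : lsrc y = walk_end v u ->
  pe (v, rcons u y) = pe (v, u) · le y.
Proof.
move=> yu; rewrite -cats1 path_elt_cat /= ?yu ?eqxx //.
by rewrite path_elt_cons path_elt0 letter_V.
Qed.

Lemma path_elt_mul p q : is_path p -> is_path q ->
  pe p · pe q = if prng p == q.1 then pe (p.1, p.2 ++ q.2) else 0.
Proof.
case: p q => [v u] [v' w] pu qw; case: eqP => [pq|/eqP pq].
  by rewrite path_elt_cat -[walk_end _ _]/(prng (v, u)) pq.
by rewrite -path_V -(V_path qw) -amulA [V _ · (_ · _)]amulA VV0 // amul0r amulr0.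
Qed.

Lemma star_path p : is_path p -> star (pe p) = pe (pinv p).
Proof.
case: p => v w; rewrite /pinv /= -/(word_inv w) -[prng _]/(walk_end v w).
elim: w v => [|y w IH] v; first by rewrite !path_elt0 starV.
rewrite /is_path /= => /andP[/eqP yv wy]; rewrite path_elt_cons starM IH // star_letter.
rewrite word_inv_cons -[walk_end v _]/(walk_end (lrng y) w).
by rewrite path_elt_rcons // lsrc_linv walk_end_inv.
Qed.

Lemma path_monomial p : star_monomial V Y (pe p).
Proof.
case: p => v w; elim: w v => [|[e b] w IH] v; first by rewrite path_elt0; constructor.
by rewrite path_elt_cons; apply: smon_mul => //; case: b; rewrite /letter_elt /=; do ?constructor.
Qed.

Lemma cohn_ab_comm a b : star_monomial V Y a -> star_monomial V Y b ->
  (a · star a) · (b · star b) = (b · star b) · (a · star a).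
Proof.
have lift x : star_monomial V Y x ->
    exists2 x', star_monomial (@cohnV K c E) (@cohnY K c E) x' & x = quot_pi _ x'.
  elim=> {x} [v|e|x x' _ [d Hd ->] _ [d' Hd' ->]|x _ [d Hd ->]].
  - by exists (@cohnV K c E v); [constructor|].
  - by exists (@cohnY K c E e); [constructor|].
  - by exists (d · d'); [constructor|rewrite (star_morphM (quot_pi_morphism _))].
  - by exists (star d); [constructor|rewrite (star_morphS (quot_pi_morphism _))].
move=> /lift[a' Ha ->] /lift[b' Hb ->].
have pm := quot_pi_morphism (tame_rel (@cohnV K c E) (@cohnY K c E)).
rewrite -(star_morphS pm a') -(star_morphS pm b') -(star_morphM pm a' (star a')).
rewrite -(star_morphM pm b' (star b')) -(star_morphM pm (a' · star a') (b' · star b')).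
rewrite -(star_morphM pm (b' · star b') (a' · star a')).
exact/quot_pi_rel/tame_comm.
Qed.

(** Tameness makes a product of partial isometries a partial isometry: bb* and a*a commute, which
    turns a bb* a*a b into aa*a bb*b. *)
Lemma monomial_iso a : star_monomial V Y a -> a · star a · a = a.
Proof.
have letter_iso e : star (Y e) · Y e = V (rng e) := bwd_fwd e.
have YV e : Y e · V (rng e) = Y e := letter_V (fwd e).
elim=> {a} [v|e|a b Ha IHa Hb IHb|a Ha IHa].
- by rewrite starV !VV.
- by rewrite -amulA letter_iso YV.
- have := cohn_ab_comm Hb (smon_star Ha); rewrite starK => ab.
  rewrite starM -!amulA (amulA b) (amulA (star a)) (amulA (b · star b)) ab.
  by rewrite !amulA IHa -!amulA (amulA b) IHb.
- by rewrite starK -[in RHS]IHa !starM starK amulA.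
Qed.

Lemma proj_comm p q : pr p · pr q = pr q · pr p.
Proof. exact: cohn_ab_comm (path_monomial _) (path_monomial _). Qed.

Lemma proj_path p : pr p · pe p = pe p.
Proof. exact: monomial_iso (path_monomial _). Qed.

Lemma proj_idem p : pr p · pr p = pr p.
Proof. by rewrite {2}/path_proj amulA proj_path. Qed.

Lemma proj0 v : pr (v, [::]) = V v.
Proof. by rewrite /path_proj path_elt0 starV VV. Qed.

Lemma proj_prefix p q : is_path q -> pprefix p q -> pr p · pr q = pr q.
Proof.
move=> + /pprefixP[w qE]; rewrite {}qE => pw; case: p pw => v u /=.
rewrite /is_path is_walk_cat => /andP[_ uw].
by rewrite {2 3}/path_proj path_elt_cat // !amulA proj_path.
Qed.

(** An inverse edge contributes the factor e*e = r(e), which the path before it absorbs. Hence e(T)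
    sees only the parts g_0 of the elements of T. *)
Lemma proj_inv v u w : is_walk v (u ++ w) -> all snd w -> pr (v, u ++ w) = pr (v, u).
Proof.
elim/last_ind: w => [|w y IH]; first by rewrite cats0.
rewrite all_rcons -rcons_cat is_walk_rcons => /andP[uw /eqP yw] /andP[y2 aw].
rewrite -[RHS]IH // /path_proj path_elt_rcons // starM -!amulA (amulA (le y)).
case: y y2 yw => e [] //= _ yw; have := bwd_fwd e; rewrite /letter_elt /= starK => ->.
by rewrite -[rng e]/(lsrc (e, true)) yw [pe _ · (_ · _)]amulA -[walk_end _ _]/(prng (v, u ++ w)) path_V.
Qed.

Lemma proj_part0 p : is_path p -> pr (part0 p) = pr p.
Proof.
case: p => v w pw; have [w1 wE aw1] := epartP w.
by rewrite /part0 /= [in RHS]wE proj_inv // -wE.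
Qed.

(** In a reduced word the only possible violation is a subword x^-1 y with distinct x, y in one
    block, and x*y = 0. *)
Lemma path_elt_bad p : is_path p -> sorted (fun y z => z != linv y) p.2 ->
  ~~ sorted (@follows E) p.2 -> pe p = 0.
Proof.
case: p => v w /=; rewrite /is_path /=; elim: w v => // y [//|z w] IH v.
move=> /andP[yv wz] /= /andP[zy rw]; rewrite negb_and => /orP[|fw]; last first.
  by rewrite path_elt_cons IH ?amulr0.
rewrite /follows zy /= negbK => /and3P[y2 z2 syz].
rewrite !path_elt_cons amulA; case: y z y2 z2 zy syz {IH yv wz rw} => e [] [f []] //= _ _ zy syz.
by rewrite bwd_fwd0 ?amul0r //; apply: contraNneq zy => ->.
Qed.

(** By [proj_prefix] the two paths may be cut right after the edges e and f at which they part. With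
    x the common part, commuting ee* past x*x brings e* next to f. *)
Lemma proj_branch p q : is_path p -> is_path q -> p.1 = q.1 -> branch p.2 q.2 ->
  pr p · pr q = 0.
Proof.
case: p q => [v u] [v' w] pu qw /= vv'; rewrite -{}vv' in qw * => -[d [e [f [ef sef eu fw]]]].
have pre : pprefix (v, rcons d (fwd e)) (v, u) by rewrite /pprefix eqxx.
have prf : pprefix (v, rcons d (fwd f)) (v, w) by rewrite /pprefix eqxx.
rewrite -(proj_prefix pu pre) -(proj_prefix qw prf) [pr _ · pr (v, u)]proj_comm.
rewrite -amulA (amulA (pr (v, rcons d (fwd e)))) [X in _ · (X · _)](_ : _ = 0).
  by rewrite amul0r amulr0.
have de : is_walk v (rcons d (fwd e)).
  by move: pu; case/prefixP: eu => t ->; rewrite /is_path /= is_walk_cat => /andP[].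
have df : is_walk v (rcons d (fwd f)).
  by move: qw; case/prefixP: fw => t ->; rewrite /is_path /= is_walk_cat => /andP[].
move: de df; rewrite !is_walk_rcons => /andP[_ /eqP de] /andP[_ /eqP df].
rewrite /path_proj !path_elt_rcons // !starM; set x := pe (v, d).
set ye := le (fwd e); set yf := le (fwd f).
have xy : (ye · star ye) · (star x · x) = (star x · x) · (ye · star ye).
  have := cohn_ab_comm (smon_Y V Y e) (smon_star (path_monomial (v, d))).
  by rewrite starK.
transitivity (x · ((ye · star ye) · (star x · x)) · yf · (star yf · star x)).
  by rewrite !amulA.
rewrite xy; transitivity (x · (star x · x) · ye · (star ye · yf) · (star yf · star x)).
  by rewrite !amulA.
by rewrite /ye star_letter bwd_fwd0 // amulr0 amul0r.
Qed.

End PathElements.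

Lemma mem_fset (I : choiceType) (S : set I) i : finite_set S -> (i \in fset_set S) = `[< S i >].
Proof. by move=> fS; rewrite in_fset_set. Qed.

(** * Products of range projections and of their complements *)

Section ProjectionOperators.
Variables (K : comPzRingType) (c : involution K) (E : sepGraph).
Local Notation vert := (vert E).
Local Notation edge := (edge E).
Local Notation gpath := (gpath E).
Local Notation A := (cohn_ab c E).
Local Notation pe := (@path_elt K c E).
Local Notation pr := (@path_proj K c E).
Implicit Types (v : vert) (p q g h : gpath) (T U F : set gpath) (X : set edge).
Implicit Types (a b : A) (r s : seq gpath).

(** The algebra has no unit, so an empty product of projections and a complement 1 - pp* exist only
    as operators; [Pset] and [Nset] are such products acting from the left, and all their factors
    commute. *)
Definition Pset r a : A := foldr (fun p b => pr p · b) a r.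
Definition Nset r a : A := foldr (fun p b => b - pr p · b) a r.

Lemma proj_Pset p r a : pr p · Pset r a = Pset r (pr p · a).
Proof. by elim: r => //= q r <-; rewrite amulA proj_comm -amulA. Qed.

Lemma proj_Nset p r a : pr p · Nset r a = Nset r (pr p · a).
Proof. by elim: r => //= q r <-; rewrite amulDr amulNr amulA proj_comm -amulA. Qed.

Lemma PsetM r a b : Pset r (a · b) = Pset r a · b.
Proof. by elim: r => //= q r ->; rewrite amulA. Qed.

Lemma PsetB r a b : Pset r (a - b) = Pset r a - Pset r b.
Proof. by elim: r => //= q r ->; rewrite amulDr amulNr. Qed.

Lemma NsetB r a b : Nset r (a - b) = Nset r a - Nset r b.
Proof.
elim: r => //= q r ->; rewrite amulDr amulNr !opprD !opprK !addrA.
by congr (_ + _); exact: addrAC.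
Qed.

Lemma Pset0 r : Pset r 0 = 0.
Proof. by elim: r => //= q r ->; rewrite amulr0. Qed.

Lemma Pset_sum r (I : Type) (s : seq I) (f : I -> A) :
  Pset r (\sum_(i <- s) f i) = \sum_(i <- s) Pset r (f i).
Proof.
have D : {morph Pset r : a b / a + b}.
  by move=> a b; rewrite -{1}[b]opprK PsetB -sub0r PsetB Pset0 sub0r opprK.
exact: (big_morph (Pset r) D (Pset0 r)).
Qed.

Lemma Pset_comm r s a : Pset r (Pset s a) = Pset s (Pset r a).
Proof. by elim: r => //= q r ->; rewrite proj_Pset. Qed.

Lemma Nset_comm r s a : Nset r (Nset s a) = Nset s (Nset r a).
Proof.
by elim: r => //= q r ->; rewrite NsetB proj_Nset.
Qed.

Lemma proj_Pset_in p r a : p \in r -> pr p · Pset r a = Pset r a.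
Proof.
elim: r => //= q r IH; rewrite inE => /orP[/eqP ->|/IH pr_r].
  by rewrite amulA proj_idem.
by rewrite amulA proj_comm -amulA pr_r.
Qed.

Lemma proj_Nset_in p r a : p \in r -> pr p · Nset r a = 0.
Proof.
elim: r => //= q r IH; rewrite inE => /orP[/eqP ->|/IH pr_r].
  by rewrite amulDr amulNr amulA proj_idem subrr.
by rewrite amulDr amulNr amulA proj_comm -amulA pr_r amulr0 subrr.
Qed.

Lemma Pset_absorb r s a : (forall p, p \in r -> exists2 q, q \in s & pr p · pr q = pr q) ->
  Pset r (Pset s a) = Pset s a.
Proof.
elim: r => //= p r IH rs; rewrite IH; last by move=> q qr; apply: rs; rewrite inE qr orbT.
have [|q qs pq] := rs p; first by rewrite inE eqxx.
by rewrite -(proj_Pset_in a qs) amulA pq.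
Qed.

(** Mutual cofinality in the order of projections suffices. This allows the maximal elements of a
    tree, all its elements, or those of its core to be used interchangeably. *)
Lemma eq_Pset r s a : (forall p, p \in r -> exists2 q, q \in s & pr p · pr q = pr q) ->
  (forall p, p \in s -> exists2 q, q \in r & pr p · pr q = pr q) -> Pset r a = Pset s a.
Proof. by move=> rs sr; rewrite -(Pset_absorb a rs) Pset_comm Pset_absorb. Qed.

Lemma Nset_absorb r s a : {subset r <= s} -> Nset r (Nset s a) = Nset s a.
Proof.
elim: r => //= p r IH rs; rewrite IH; last by move=> q qr; apply: rs; rewrite inE qr orbT.
by rewrite proj_Nset_in ?subr0 // rs ?inE ?eqxx.
Qed.

Lemma eq_Nset r s a : r =i s -> Nset r a = Nset s a.
Proof.
move=> rs; rewrite -(@Nset_absorb r s) => [|p]; last by rewrite rs.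
by rewrite Nset_comm Nset_absorb // => p; rewrite rs.
Qed.

Lemma Pset_eq0 r a p q : p \in r -> q \in r -> pr p · pr q = 0 -> Pset r a = 0.
Proof.
move=> pin qin pq; rewrite -(proj_Pset_in a pin) -(proj_Pset_in a qin).
by rewrite amulA pq amul0r.
Qed.

Lemma Nset_orth r a : uniq r -> {in r &, forall p q, p != q -> pr p · pr q = 0} ->
  Nset r a = a - \sum_(p <- r) pr p · a.
Proof.
have sum0 p s : (forall q, q \in s -> pr p · pr q = 0) ->
    pr p · (\sum_(q <- s) pr q · a) = 0.
  elim: s => [_|q s IH orth]; first by rewrite big_nil amulr0.
  rewrite big_cons amulDr IH ?addr0; last by move=> q' qs; apply: orth; rewrite inE qs orbT.
  by rewrite amulA orth ?amul0r // inE eqxx.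
elim: r => [|p r IH] /=; first by rewrite big_nil subr0.
move=> /andP[pnr ur] orth; rewrite IH //; last first.
  by move=> q q' qr qr'; apply: orth; rewrite inE ?qr ?qr' orbT.
have S0 : pr p · (\sum_(q <- r) pr q · a) = 0.
  apply: sum0 => q qr; apply: orth; rewrite ?inE ?eqxx ?qr ?orbT //.
  by apply: contraNneq pnr => ->.
by rewrite big_cons amulDr amulNr S0 subr0 opprD addrA addrAC.
Qed.

(** A form of [basis_elt] in which the maximal elements of T and the base points of the neighbours
    do not occur, so that changes of T and F are easy to follow; [basis_eltE] compares the two. *)
Definition elt T F g : A := Pset (fset_set T) (Nset (fset_set F) (pe g)).

Lemma Slot_orth v T g X x y : X0v v T -> Slot T g X -> X x -> X y -> x != y ->
  pr (rcp g x) · pr (rcp g y) = 0.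
Proof.
move=> TX [_ sX _ gX] Xx Xy xy; have [[px _ _] _ _] := gX x Xx; have [[py _ _] _ _] := gX y Xy.
apply: proj_branch => //; exists g.2, x, y; rewrite !prefix_refl; split=> //.
by apply/same_blockP; exists X; split=> //; exists (prng g).
Qed.

(** The members of a block branch pairwise, so their projections are orthogonal and the product of
    the complements is one minus the sum. *)
Lemma elt_slot_proj v T F g0 g X : X0v v T -> finite_set F -> Slot T g X ->
  elt T (F `|` mul_edges g X) g0 =
  elt T F g0 - \sum_(x <- fset_set X) pr (rcp g x) · elt T F g0.
Proof.
move=> TX fF SX; have /X0vP[[fT Tv TF lT bT] eT] := TX.
have [Tg sX fX gX] := SX.
rewrite /elt; set a := Nset (fset_set F) _.
have memX x : (x \in fset_set X) = `[< X x >] by rewrite in_fset_set.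
pose r := [seq rcp g x | x <- fset_set X].
have -> : Nset (fset_set (F `|` mul_edges g X)) (pe g0) = Nset r a.
  rewrite -[RHS](_ : Nset (r ++ fset_set F) (pe g0) = _); last by rewrite /Nset foldr_cat.
  apply: eq_Nset => p; rewrite mem_cat orbC !mem_fset //; last first.
    by rewrite finite_setU; split=> //; exact: finite_image.
  rewrite mul_edgesE; apply/asboolP/orP => [[Fp|[x Xx <-]]|[/asboolP Fp|/mapP[x]]].
  - by left; apply/asboolP.
  - by right; apply/map_f; rewrite memX; apply/asboolP.
  - by left.
  - by rewrite memX => /asboolP Xx ->; right; exists x.
rewrite Nset_orth; first last.
- move=> p q /mapP[x + ->] /mapP[y + ->]; rewrite !memX => /asboolP Xx /asboolP Xy xy.
  by apply: (Slot_orth TX SX) => //; apply: contraNneq xy => ->.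
- by rewrite map_inj_uniq ?fset_uniq // => x y /rcp_inj[].
rewrite PsetB Pset_sum big_map; congr (_ - _).
by apply: eq_bigr => x _; rewrite proj_Pset.
Qed.

Lemma elt_down T F g p : finite_set T -> is_path p ->
  elt (T `|` down [set p]) F g = pr p · elt T F g.
Proof.
move=> fT pp; rewrite /elt; set a := Nset _ _; have fTp : finite_set (T `|` down [set p]).
  by rewrite finite_setU; split=> //; exact: finite_down.
rewrite -[RHS]/(Pset (p :: fset_set T) a); apply: eq_Pset => q.
  rewrite mem_fset // => /asboolP[Tq|[_ -> qp]]; last first.
    by exists p; rewrite ?inE ?eqxx // proj_prefix.
  by exists q; rewrite ?proj_idem // inE mem_fset // orbC; apply/orP; left; apply/asboolP.
rewrite inE mem_fset // => /orP[/eqP ->|/asboolP Tq].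
  exists p; rewrite ?proj_idem // mem_fset //; apply/asboolP; right.
  by exists p => //; exact: pprefix_refl.
by exists q; rewrite ?proj_idem // mem_fset //; apply/asboolP; left.
Qed.

Lemma elt_slot v T F g0 g X : X0v v T -> finite_set F -> Slot T g X ->
  elt T (F `|` mul_edges g X) g0 =
  elt T F g0 - \sum_(x <- fset_set X) elt (T `|` down [set rcp g x]) F g0.
Proof.
move=> TX fF SX; rewrite (elt_slot_proj g0 TX fF SX); congr (_ - _).
have /X0vP[[fT _ _ _ _] _] := TX; have [_ _ fX gX] := SX.
rewrite big_seq [RHS]big_seq; apply: eq_bigr => x.
rewrite mem_fset // => /asboolP Xx; have [[pgx _ _] _ _] := gX x Xx.
by rewrite elt_down.
Qed.

Lemma basis_eltE T F g : X0v (psrc g) T -> bfam T F -> is_path g ->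
  basis_elt c T F g = elt T F g.
Proof.
move=> TX bF pg; have /X0vP[[fT Tv TF lT bT] eT] := TX.
have fF := bfam_finite bF.
have [_ FN _] := (bfamP F TX).2 bF.
have fM : finite_set (maxl T) by apply: sub_finite_set fT => p [].
rewrite /basis_elt /eTF /eT -amulA; set b := (X in _ · X).
have -> a : \big[amul/cohn_abV c (psrc g)]_(p <- fset_set (maxl T)) pr p · a =
    Pset (fset_set (maxl T)) (cohn_abV c (psrc g) · a).
  elim: (enum_fset (fset_set (maxl T))) => [|p r IH]; first by rewrite big_nil.
  by rewrite big_cons -amulA IH.
have maxE a : Pset (fset_set (maxl T)) a = Pset (fset_set T) a.
  apply: eq_Pset => p; rewrite !mem_fset // => /asboolP Tp.
    by exists p; rewrite ?proj_idem // mem_fset //; apply/asboolP; case: Tp.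
  have [q mq pq] := maxl_above fT Tp; exists q; first by rewrite mem_fset //; apply/asboolP.
  by apply: proj_prefix => //; case: mq => /TF[[]].
(* The vertex is the projection of the trivial path, a member of T, and is absorbed. *)
rewrite maxE -proj0 -proj_Pset proj_Pset_in ?mem_fset //; last exact/asboolP.
have base p : F p -> nbr_base T p \in fset_set T.
  move=> /FN; rewrite mem_fset // => -[h [h' [hh' pE]]]; apply/asboolP.
  (* The default value of [xget] does not occur, since F consists of neighbours of T. *)
  rewrite /nbr_base; case: xgetP => [y _ [y' [[]]]//|].
  by move=> /(_ h) []; exists h'.
have {base} : forall p, p \in (fset_set F : seq _) -> nbr_base T p \in fset_set T.
  by move=> p; rewrite (mem_fset p fF) => /asboolP; exact: base.
rewrite {}/b /elt; elim: (enum_fset (fset_set F)) => [|p r IH] base.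
  by rewrite big_nil -[_ · pe g]/(cohn_abV c g.1 · pe g) V_path.
rewrite big_cons -amulA amulDl amulNl PsetB -!proj_Pset IH; last first.
  by move=> q qr; apply: base; rewrite inE qr orbT.
(* The base point lies in T, so its projection acts as the identity and the factor becomes a plain
   complement. *)
rewrite proj_Pset_in; last by apply: base; rewrite inE eqxx.
by rewrite /= PsetB proj_Pset.
Qed.

End ProjectionOperators.

(** * Munn trees and the kernel *)

Section Munn.
Variables (K : comPzRingType) (c : involution K) (E : sepGraph).
Local Notation vert := (vert E).
Local Notation edge := (edge E).
Local Notation letter := (letter E).
Local Notation gpath := (gpath E).
Local Notation A := (cohn_ab c E).
Local Notation V := (@cohn_abV K c E).
Local Notation Y := (@cohn_abY K c E).
Local Notation le := (@letter_elt K c E).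
Local Notation pe := (@path_elt K c E).
Local Notation pr := (@path_proj K c E).
Implicit Types (y z : letter) (u w h : seq letter) (e f x : edge) (v : vert).
Implicit Types (p q g : gpath) (T U F : set gpath) (X : set edge).
Implicit Types (a b : A) (r s : seq gpath).

(** [reduce_cons] cancels at the left end of a word, whereas Munn trees grow at the right end. *)
Definition rsnoc u y := rev (reduce_cons y (rev u)).

Lemma rsnoc_cancel u y : rsnoc (rcons u (linv y)) y = u.
Proof. by rewrite /rsnoc rev_rcons /= eqxx revK. Qed.

Lemma rsnoc_rcons u y : (forall u', u <> rcons u' (linv y)) -> rsnoc u y = rcons u y.
Proof.
case/lastP: u => [//|u z] nu; rewrite /rsnoc rev_rcons /=.
case: eqP => [zy|_]; first by case: (nu u); rewrite zy.
by rewrite !rev_cons revK.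
Qed.

Variant rsnoc_spec u y : seq letter -> Prop :=
| RsnocCancel u' of u = rcons u' (linv y) : rsnoc_spec u y u'
| RsnocRcons of (forall u', u <> rcons u' (linv y)) : rsnoc_spec u y (rcons u y).

Lemma rsnocP u y : rsnoc_spec u y (rsnoc u y).
Proof.
have [[u' uE]|nu] := pselect (exists u', u = rcons u' (linv y)).
  by rewrite uE rsnoc_cancel; constructor.
have {}nu u' : u <> rcons u' (linv y) by move=> uE; apply: nu; exists u'.
by rewrite rsnoc_rcons //; constructor.
Qed.

Definition reduced_word u := sorted (fun y z => z != linv y) u.

Lemma rsnoc_reduced u y : reduced_word u -> reduced_word (rsnoc u y).
Proof.
case: rsnocP => [u' ->|nu ru]; first by rewrite /reduced_word -cats1 => /cat_sorted2[].
case/lastP: u nu ru => // u z nu; rewrite /reduced_word -[rcons (rcons _ _) _]cats1.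
rewrite cat_rcons sorted_cat_cons => -> /=; rewrite andbT.
by apply/eqP => yz; apply: (nu u); rewrite yz linvK.
Qed.

Lemma rsnoc_walk v u y : is_walk v u -> lsrc y = walk_end v u -> is_walk v (rsnoc u y).
Proof.
case: rsnocP => [u' ->|_ uw yu]; first by rewrite is_walk_rcons => /andP[].
by rewrite is_walk_rcons uw yu eqxx.
Qed.

Lemma walk_end_rsnoc v u y : is_walk v u -> walk_end v (rsnoc u y) = lrng y.
Proof.
case: rsnocP => [u' ->|_ _]; last by rewrite walk_end_rcons.
by rewrite is_walk_rcons lsrc_linv => /andP[_ /eqP].
Qed.

(** If y cancels the last letter, the product x y*y is not x but x cut down by the projection of the
    longer path; this follows by commuting y*y with x*x. *)
Lemma path_elt_rsnoc v u y : is_walk v u -> lsrc y = walk_end v u ->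
  pe (v, u) · le y = pr (v, u) · pe (v, rsnoc u y).
Proof.
case: rsnocP => [u' ->|_ _ yu]; last first.
  by rewrite path_elt_rcons // amulA proj_path.
rewrite is_walk_rcons walk_end_rcons lrng_linv => /andP[uw /eqP yu] _.
rewrite /path_proj path_elt_rcons // starM star_letter linvK; set x := pe (v, u').
have := cohn_ab_comm (path_monomial c (lsrc (linv y), [:: linv y]))
  (smon_star (path_monomial c (v, u'))).
rewrite path_elt_cons path_elt0 letter_V star_letter linvK starK -/x => xy.
transitivity (x · ((le (linv y) · le y) · (star x · x))); last by rewrite !amulA.
by rewrite xy !amulA (monomial_iso (path_monomial _ _)).
Qed.

(** The points of the Munn tree of [w], walked from [h]. Repetitions are harmless, because [Pset]
    depends only on the set of points. *)
Fixpoint trail h w := h :: if w is y :: w' then trail (rsnoc h y) w' else [::].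

Lemma mem_trail h w : h \in trail h w.
Proof. by case: w => [|y w]; rewrite inE eqxx. Qed.

Lemma mem_trail_end h w : foldl rsnoc h w \in trail h w.
Proof. by elim: w h => [|y w IH] h /=; rewrite inE ?eqxx // IH orbT. Qed.

Lemma trail_cat h w w' : trail h (w ++ w') =i trail h w ++ trail (foldl rsnoc h w) w'.
Proof.
elim: w h => [|y w IH] h u; rewrite /= !inE; last by rewrite IH.
by have [->|//] := eqVneq u h; rewrite mem_trail.
Qed.

Lemma trail_walk v h w : is_walk v h -> reduced_word h -> is_walk (walk_end v h) w ->
  forall u, u \in trail h w -> is_walk v u && reduced_word u.
Proof.
elim: w h => [|y w IH] h hw hr /= => [_ u|/andP[/eqP yh yw] u].
  by rewrite inE => /eqP ->; rewrite hw.
rewrite inE => /orP[/eqP ->|]; first by rewrite hw.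
apply: IH; [exact: rsnoc_walk|exact: rsnoc_reduced|by rewrite walk_end_rsnoc].
Qed.

(** A step of the walk either backs up or appends one letter, so the proper prefixes of a new point
    have been met before. The set [S] stands for the points already available and grows along the
    induction. *)
Lemma trail_prefix (S : set (seq letter)) h w :
  (forall u u', S u -> prefix u' u -> S u') -> S h ->
  forall u u', u \in trail h w -> prefix u' u -> S u' \/ u' \in trail h w.
Proof.
elim: w h S => [|y w IH] h S Sp Sh u u' /=.
  by rewrite inE => /eqP -> /(Sp _ _ Sh); left.
rewrite !inE => /orP[/eqP -> /(Sp _ _ Sh)|ut u'u]; first by left.
have [||[Su'|->]|->] := IH _ (S `|` [set rsnoc h y]) _ _ _ _ ut u'u; rewrite ?orbT.
- move=> {u u' ut u'u}.
  move=> t t' [St t't|->]; first by left; exact: Sp St t't.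
  case: rsnocP => [h' hE|_] tt'.
    left; apply: (Sp _ _ Sh); apply: prefix_trans tt' _.
    by rewrite hE; exact: prefix_rcons.
  move: tt'; rewrite prefix_rconsE => /orP[/eqP ->|th]; first by right.
  by left; exact: Sp Sh th.
- by right.
- by left.
- by right; rewrite mem_trail orbT.
- by right.
Qed.

Lemma walk_end_foldl v h w : is_walk v h -> is_walk (walk_end v h) w ->
  is_walk v (foldl rsnoc h w) /\ walk_end v (foldl rsnoc h w) = walk_end (walk_end v h) w.
Proof.
elim: w h => [|y w IH] h hw //= /andP[/eqP yh yw].
have yw' : is_walk (walk_end v (rsnoc h y)) w by rewrite walk_end_rsnoc.
by have [? ->] := IH _ (rsnoc_walk hw yh) yw'; rewrite walk_end_rsnoc.
Qed.

(* A path is the product of the projections onto the reductions of its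
   prefixes with its own reduction, as in Munn's description of the free
   inverse semigroup. *)
Lemma path_elt_munn v h w : is_walk v h -> is_walk (walk_end v h) w ->
  pe (v, h) · pe (walk_end v h, w) =
  Pset [seq (v, u) | u <- trail h w] (pe (v, foldl rsnoc h w)).
Proof.
elim: w h => [|y w IH] h hw /=.
  by move=> _; rewrite path_elt0 -[walk_end v h]/(prng (v, h)) path_V proj_path.
move=> /andP[/eqP yh yw]; rewrite path_elt_cons amulA path_elt_rsnoc // -amulA.
by rewrite -(@walk_end_rsnoc v h y) // IH ?walk_end_rsnoc //; exact: rsnoc_walk.
Qed.

End Munn.

(** * Products of paths with a defect q_X *)

Section Kernel.
Variables (K : comPzRingType) (c : involution K) (E : sepGraph).
Local Notation vert := (vert E).
Local Notation edge := (edge E).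
Local Notation letter := (letter E).
Local Notation gpath := (gpath E).
Local Notation A := (cohn_ab c E).
Local Notation V := (@cohn_abV K c E).
Local Notation Y := (@cohn_abY K c E).
Local Notation le := (@letter_elt K c E).
Local Notation pe := (@path_elt K c E).
Local Notation pr := (@path_proj K c E).
Implicit Types (y z : letter) (u w h : seq letter) (e f x : edge) (v : vert).
Implicit Types (p q g : gpath) (T U F : set gpath) (X : set edge).
Implicit Types (a b : A) (r s : seq gpath).

Definition ck_defect v X : A := V v - \sum_(e <- fset_set X) Y e · star (Y e).

(** The canonical elements freed from reducedness; they span the kernel before any choice function
    enters. *)
Definition kernel_elt : set A := [set a | exists T F g,
  [/\ X0v (psrc g) T, bfam T F /\ F !=set0, FC g, T (part0 g) & a = elt c T F g]].

Lemma Pset_core v U a : tree v U ->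
  Pset (fset_set U) a = Pset (fset_set (core U)) a.
Proof.
move=> tU; have [fU Uv UF lU bU] := tU.
have fC : finite_set (core U) by apply: sub_finite_set fU; exact: core_sub.
apply: eq_Pset => p; rewrite mem_fset // => /asboolP Up.
  exists (part0 p); first by rewrite mem_fset //; apply/asboolP; exact: core_part0.
  by have [[pp _ _] _] := UF _ Up; rewrite proj_part0 // proj_idem.
exists p; rewrite ?proj_idem // mem_fset //; apply/asboolP.
exact: core_sub lU _ Up.
Qed.

(** Every obstruction would put some [rsnoc h (fwd x)] into U: if [h] ended in the inverse of an
    edge of X, cancelling would give a prefix of [h]; and an element of U branching off along
    another edge of X would have that extension of [h] as a prefix. *)
Lemma tree_Slot v U h X : tree v U -> U (v, h) -> @sep E (walk_end v h) X ->
  finite_set X -> (forall x, X x -> ~ U (v, rsnoc h (fwd x))) ->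
  Slot (core U) (v, h) X.
Proof.
move=> tU Uh sX fX nX; have [fU Uv UF lU bU] := tU.
have sXa : @sep_all E X by exists (walk_end v h).
have no_inv x : X x -> forall u, h <> rcons u (bwd x).
  move=> Xx u hE; apply: (nX x Xx); rewrite hE.
  rewrite (@rsnoc_cancel _ u (fwd x)); apply: (lU _ _ Uh).
  by rewrite /pprefix eqxx hE prefix_rcons.
split=> // [|x Xx]; first exact: core_part0 lU Uh.
have rE : rsnoc h (fwd x) = rcons h (fwd x) by rewrite rsnoc_rcons // => u; exact: no_inv.
have Ux : ~ U (rcp (v, h) x) by have := nX x Xx; rewrite rE.
have [FCh _] := UF _ Uh; split.
- apply/FCP; have /FCP[/= hw hs] := FCh; split=> /=.
    by rewrite is_walk_rcons hw /= [lsrc _](sep_src sX Xx) eqxx.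
  case/lastP: h {Uh sX nX rE Ux FCh hw} hs no_inv => // h y hs no_inv.
  rewrite -[rcons (rcons _ _) _]cats1 cat_rcons sorted_cat_cons hs /= andbT /follows.
  apply/andP; split; first by apply/eqP => /(congr1 (@linv E)); rewrite linvK => yE; apply: (no_inv x Xx h); rewrite -yE.
  apply/and3P => -[y2 _ sy]; apply: (no_inv y.1 _ h).
    by apply: same_block_in sXa Xx _; rewrite same_block_sym.
  by case: y y2 {hs no_inv sy} => e [].
- by move/(core_sub lU).
- move=> p /(core_sub lU) Up [d [e [f [ef sef dp]]]] /=; rewrite prefix_rconsE => /orP[/eqP/rcons_inj[dh fx]|dh].
    have Xe : X e by apply: (same_block_in sXa Xx); rewrite same_block_sym -fx.
    apply: (nX e Xe); rewrite rsnoc_rcons; last exact: no_inv.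
    have [_ pv] := UF _ Up; apply: (lU _ _ Up).
    by rewrite /pprefix /= -dh dp andbT eq_sym; exact/eqP.
  by apply: (bU _ _ Up Uh); exists d, e, f.
Qed.

(** In the application [U] is a Munn tree. The difference vanishes unless U is a C-compatible tree
    that avoids all extensions of [h] along X, and then it is an element with the single block
    hX. *)
Lemma tree_defect_span v U h g X : finite_set U -> U (v, [::]) -> lower U ->
  (forall p, U p -> [/\ p.1 = v, is_path p & reduced_word p.2]) ->
  U (v, h) -> U g -> @sep E (walk_end v h) X -> finite_set X ->
  smallest submodule kernel_elt (Pset (fset_set U) (pe g) -
    \sum_(x <- fset_set X) pr (v, rsnoc h (fwd x)) · Pset (fset_set U) (pe g)).
Proof.
move=> fU Uv lU UP Uh Ug sX fX; set P := Pset _ _.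
have [S0 _ _] := smallest_submodule kernel_elt.
have P0 : P = 0 -> smallest submodule kernel_elt (P -
    \sum_(x <- fset_set X) pr (v, rsnoc h (fwd x)) · P).
  by move=> ->; rewrite big1 ?subr0 // => x _; rewrite amulr0.
have memU p : U p -> p \in fset_set U by move=> Up; rewrite mem_fset //; apply/asboolP.
have [sU|/existsNP[p /not_implyP[Up /negP sp]]] :=
    pselect (forall p, U p -> sorted (@follows E) p.2); last first.
  apply: P0; have [_ pp rp] := UP p Up.
  by rewrite /P -(proj_Pset_in _ (memU p Up)) {1}/path_proj path_elt_bad // !amul0r.
have [bU|] := pselect (forall p q, U p -> U q -> ~ branch p.2 q.2); last first.
  move=> /existsNP[p /existsNP[q /not_implyP[Up /not_implyP[Uq /contrapT pq]]]].
  have [pv pp _] := UP p Up; have [qv qq _] := UP q Uq.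
  by apply: P0; apply: (Pset_eq0 _ (memU p Up) (memU q Uq)); apply: proj_branch => //; rewrite pv qv.
have tU : tree v U.
  split=> // p Up; have [pv pp _] := UP p Up; split=> //; apply/FCP; split=> //.
  exact: sU.
(* An extension of [h] that lies in U has a projection fixing [P], and the projections of the other
   extensions kill [P]. *)
have [[x0 [Xx0 Ux0]]|nU] := pselect (exists x, X x /\ U (v, rsnoc h (fwd x))).
  suff -> : P - \sum_(x <- fset_set X) pr (v, rsnoc h (fwd x)) · P = 0 by [].
  rewrite (bigD1_seq x0) ?fset_uniq //=; last by rewrite mem_fset //; apply/asboolP.
  rewrite proj_Pset_in ?memU // big_seq_cond big1 ?addr0 ?subrr // => x.
  rewrite mem_fset // => /andP[/asboolP Xx xx0].
  have sxx0 : same_block x0 x.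
    by apply/same_blockP; exists X; split=> //; exists (walk_end v h).
  have [_ hw _] := UP _ Uh.
  have xh e : X e -> lsrc (fwd e) = walk_end v h by exact: sep_src.
  suff pp0 : pr (v, rsnoc h (fwd x)) · pr (v, rsnoc h (fwd x0)) = 0.
    by rewrite /P -(proj_Pset_in _ (memU _ Ux0)) amulA pp0 amul0r.
  (* If [h] ends in the inverse of [x0], then [h] followed by [x] contains x0^-1 x, and its path
     element is 0. *)
  move: Ux0; case: (rsnocP h (fwd x0)) => [u hE|nx0] Ux0.
    have -> : pr (v, rsnoc h (fwd x)) = 0; last by rewrite amul0r.
    rewrite rsnoc_rcons; last first.
      by move=> u'; rewrite hE => /rcons_inj[_ x0x]; rewrite x0x eqxx in xx0.
    rewrite /path_proj path_elt_rcons ?xh // hE path_elt_rcons; last first.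
      by move: hw; rewrite hE /is_path is_walk_rcons => /andP[_ /eqP].
    by rewrite -[pe _ · _ · _]amulA bwd_fwd0 1?eq_sym // amulr0 amul0r.
  case: (rsnocP h (fwd x)) => [u hE|nx].
    have /= := sU _ Ux0; rewrite hE -cats1 cat_rcons sorted_cat_cons /= => /and3P[_ /andP[_ /negP[]]].
    by rewrite /= same_block_sym.
  apply: proj_branch => //=.
  - by rewrite /is_path /= is_walk_rcons xh // eqxx andbT.
  - by rewrite /is_path /= is_walk_rcons xh // eqxx andbT.
  - by exists h, x, x0; rewrite xx0 same_block_sym sxx0 !prefix_refl.
have SX : Slot (core U) (v, h) X.
  by apply: tree_Slot => // x Xx Ux; apply: nU; exists x.
have CX := core_X0v tU; have [_ _ _ gX] := SX.
have -> : P - \sum_(x <- fset_set X) pr (v, rsnoc h (fwd x)) · P =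
    elt c (core U) (set0 `|` mul_edges (v, h) X) g.
  rewrite (elt_slot_proj c _ CX (finite_set0 _) SX) /elt fset_set0 /= -(Pset_core _ tU).
  congr (_ - _).
  rewrite big_seq [RHS]big_seq; apply: eq_bigr => x; rewrite mem_fset // => /asboolP Xx.
  rewrite rsnoc_rcons // => u hE; apply: nU; exists x; split=> //.
  by rewrite hE (rsnoc_cancel u (fwd x)); apply: (lU _ _ Uh); rewrite /pprefix eqxx hE prefix_rcons.
apply: sub_gen_smallest; exists (core U), (set0 `|` mul_edges (v, h) X), g.
have [_ _ UF _ _] := tU; have [FCg gv] := UF _ Ug.
split=> //; first by rewrite gv.
  split; first by apply: (bfamS (bfam0 _) SX) => x _.
  have [x Xx] := sep_neq0 sX; exists (rcp (v, h) x); right.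
  by rewrite mul_edgesE; exists x.
exact: core_part0.
Qed.

(** Moves the projection yy* to the left of a path, where it becomes the projection of one more
    point of a Munn tree. *)
Lemma path_elt_edge v h y : is_walk v h -> lsrc y = walk_end v h ->
  pe (v, h) · (le y · star (le y)) = pr (v, rsnoc h y) · pe (v, h).
Proof.
move=> hw yh; have ymon : star_monomial V Y (le y).
  by have := path_monomial c (lsrc y, [:: y]); rewrite path_elt_cons path_elt0 letter_V.
case: rsnocP hw yh => [u ->|_ _ yh].
  rewrite is_walk_rcons => /andP[_ /eqP yu] _.
  rewrite path_elt_rcons // [in RHS]amulA proj_path star_letter -!amulA.
  have := monomial_iso (smon_star ymon); rewrite starK star_letter -amulA => ->.
  by [].
rewrite /path_proj path_elt_rcons // starM; set x := pe (v, h).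
have xmon : star_monomial V Y x := path_monomial c (v, h).
have := cohn_ab_comm ymon (smon_star xmon); rewrite starK => xy.
transitivity (x · ((le y · star (le y)) · (star x · x))); last by rewrite !amulA.
by rewrite xy !amulA (monomial_iso xmon).
Qed.

Lemma ck_defect_l v X : @sep E v X -> finite_set X ->
  ck_defect v X = V v · ck_defect v X.
Proof.
move=> sX fX; rewrite /ck_defect amulDr amulNr VV; congr (_ - _).
rewrite (big_morph (amul (V v)) (amulDr _) (amulr0 _)) big_seq [RHS]big_seq.
apply: eq_bigr => e; rewrite mem_fset // amulA => /asboolP Xe.
by rewrite -(sep_src sX Xe) (V_letter _ (fwd e)).
Qed.

Lemma ck_defect_r v X : @sep E v X -> finite_set X ->
  ck_defect v X = ck_defect v X · V v.
Proof.
move=> sX fX; rewrite /ck_defect amulDl amulNl VV; congr (_ - _).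
rewrite (big_morph (fun a => a · V v) (fun a b => amulDl a b _) (amul0r _)).
rewrite big_seq [RHS]big_seq; apply: eq_bigr => e; rewrite mem_fset // -amulA => /asboolP Xe.
by rewrite -(sep_src sX Xe) (letter_V _ (bwd e)).
Qed.

(** If the endpoints match, the vertex in the defect leaves the product p p' unchanged, and each ee*
    moves to the front as the projection of the point reached from the end of p along e. All terms
    then share the Munn tree of p p'. *)
Lemma path_defect_span p p' v X : is_path p -> is_path p' -> @sep E v X -> finite_set X ->
  smallest submodule kernel_elt (pe p · ck_defect v X · pe p').
Proof.
move=> pp pp' sX fX; have [S0 _ _] := smallest_submodule kernel_elt.
have qV := ck_defect_l sX fX; have Vq := ck_defect_r sX fX.
have [pv|pv] := eqVneq (prng p) v; last first.
  by rewrite qV -path_V !amulA -[pe p · _ · _]amulA VV0 // amulr0 !amul0r.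
have [p'v|p'v] := eqVneq p'.1 v; last first.
  by rewrite Vq -(V_path c pp') -!amulA [V v · _]amulA VV0 1?eq_sym // amul0r !amulr0.
case: p p' pp pp' pv p'v => [v0 w] [v' w'] /= pw pw' pv v'v; subst v'.
have hw0 : is_walk v0 [::] by [].
have [hw hend] := walk_end_foldl hw0 pw; have pM := path_elt_munn c hw0 pw.
move: pw pw' pM hw hend; rewrite /is_path /= -[walk_end v0 [::]]/v0 => pw pw'.
set h := foldl _ _ w => pM hw hend.
have {pM}pE : pe (v0, w) = Pset [seq (v0, u) | u <- trail [::] w] (pe (v0, h)).
  by rewrite -pM path_elt0; exact: esym (V_path c (p := (v0, w)) pw).
have hv : walk_end v0 h = v by rewrite hend -pv.
rewrite -hv in sX pw' qV Vq *.
have pM' := path_elt_munn c hw pw'.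
set g := (v0, foldl (@rsnoc E) h w'); set R := trail [::] (w ++ w').
have PR : pe (v0, w) · pe (walk_end v0 h, w') = Pset [seq (v0, u) | u <- R] (pe g).
  rewrite pE -PsetM pM' -[LHS](_ : Pset ([seq (v0, u) | u <- trail [::] w] ++
    [seq (v0, u) | u <- trail h w']) (pe g) = _); last by rewrite /Pset foldr_cat.
  rewrite -map_cat; have mR := trail_cat [::] w w'; rewrite -/h -/R in mR.
  by apply: eq_Pset => _ /mapP[u uR ->]; exists (v0, u); rewrite ?proj_idem // map_f // ?mR // -mR.
pose U := [set p : gpath | p \in [seq (v0, u) | u <- R]].
have fU : finite_set U by exact: finite_seq.
have memU p : U p <-> p.1 = v0 /\ p.2 \in R.
  rewrite /U /=; split=> [/mapP[u uR ->]//|[]]; case: p => /= a u -> uR.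
  exact: map_f.
have PU : Pset [seq (v0, u) | u <- R] (pe g) = Pset (fset_set U) (pe g).
  by apply: eq_Pset => q qR; exists q; rewrite ?proj_idem // ?mem_fset // in qR *; [apply/asboolP|move/asboolP: qR].
have ww' : is_walk v0 (w ++ w').
  by rewrite is_walk_cat pw; move: pw'; rewrite hend.
have -> : pe (v0, w) · ck_defect (walk_end v0 h) X · pe (walk_end v0 h, w') =
   Pset (fset_set U) (pe g) -
   \sum_(x <- fset_set X) pr (v0, rsnoc h (fwd x)) · Pset (fset_set U) (pe g).
  rewrite -PU -PR /ck_defect amulDr amulNr amulDl amulNl; congr (_ - _).
    by rewrite -[walk_end v0 h]/(prng (v0, h)) [X in V X](_ : _ = prng (v0, w)) ?path_V.
  rewrite (big_morph (amul _) (amulDr _) (amulr0 _)).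
  rewrite (big_morph (fun a => a · _) (fun a b => amulDl a b _) (amul0r _)).
  rewrite big_seq [RHS]big_seq; apply: eq_bigr => x; rewrite mem_fset // => /asboolP Xx.
  rewrite [in RHS]amulA; congr (_ · _).
  rewrite pE -PsetM proj_Pset; congr (Pset _ _).
  have xh : lsrc (fwd x) = walk_end v0 h := sep_src sX Xx.
  exact: path_elt_edge hw xh.
apply: tree_defect_span => //.
- by apply/memU; rewrite mem_trail.
- move=> q q' /memU[q'v q'R] /andP[/eqP qq' pq]; apply/memU; split; first by rewrite qq'.
  have [] := @trail_prefix _ [set [::]] [::] (w ++ w') _ erefl _ _ q'R pq => //.
    by move=> u [|y u'] ->.
  by move=> ->; exact: mem_trail.
- move=> q /memU[qv qR]; split=> //; have /andP[] := trail_walk hw0 isT ww' qR => //.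
  by rewrite /is_path qv.
- apply/memU; split=> //; have := trail_cat [::] w w' h; rewrite -/R => ->.
  by rewrite mem_cat mem_trail_end.
- apply/memU; split=> //; have := trail_cat [::] w w' (foldl (@rsnoc E) h w'); rewrite -/R => ->.
  by rewrite mem_cat mem_trail_end orbT.
Qed.

End Kernel.

(** * The kernel as the span of the elements e(T \ F) g *)

Section KernelSpan.
Variables (K : comPzRingType) (c : involution K) (E : sepGraph).
Local Notation vert := (vert E).
Local Notation edge := (edge E).
Local Notation gpath := (gpath E).
Local Notation A := (cohn_ab c E).
Local Notation V := (@cohn_abV K c E).
Local Notation Y := (@cohn_abY K c E).
Local Notation pe := (@path_elt K c E).
Local Notation pr := (@path_proj K c E).
Implicit Types (x : edge) (v : vert) (p q g : gpath) (T F : set gpath) (X : set edge).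
Implicit Types (a b : A).

Lemma smallest_submodule_sub (M : lmodType K) (B N : set M) :
  submodule N -> B `<=` N -> smallest submodule B `<=` N.
Proof. by move=> HN BN y; apply; split. Qed.

Lemma submodule_linear (M N : lmodType K) (f : M -> N) (S : set N) :
  linear f -> submodule S -> submodule (f @^-1` S).
Proof.
move=> lf [S0 SD SZ].
have f0 : f 0 = 0 by apply: (addrI (f 0)); rewrite -{1}[f 0]scale1r -lf scale1r !addr0.
split=> /= [|a b Sa Sb|k a Sa]; first by rewrite f0.
  by rewrite -[a]scale1r lf scale1r; exact: SD.
by rewrite -[k *: a]addr0 lf f0 addr0; exact: SZ.
Qed.

Lemma amul_linear_l a : linear (amul a : A -> A).
Proof. by move=> k b d; rewrite amulDr amulZr. Qed.

Lemma amul_linear_r b : linear ((fun a => a · b) : A -> A).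
Proof. by move=> k a d; rewrite amulDl amulZl. Qed.

Definition path_elts : set A := [set pe p | p in @is_path E].

(** Unreduced paths are included, so a product of path elements is a path element or 0 and the star
    of one is another; the span is therefore closed under all operations. *)
Lemma path_span a : smallest submodule path_elts a.
Proof.
set S := smallest submodule path_elts; have SS : submodule S := smallest_submodule _.
have [S0 SD SZ] := SS.
have gen p : is_path p -> S (pe p) by move=> pp; apply: sub_gen_smallest; exists p.
have SM b d : S b -> S d -> S (b · d).
  move=> Sb Sd; suff : S `<=` [set b | S (b · d)] by apply.
  apply: smallest_submodule_sub; first exact: submodule_linear (amul_linear_r d) SS.
  move=> _ [p pp <-] /=; suff : S `<=` [set d | S (pe p · d)] by apply.
  apply: smallest_submodule_sub; first exact: submodule_linear (amul_linear_l _) SS.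
  move=> _ [q pq <-] /=; rewrite path_elt_mul //; case: eqP => // pvq.
  apply: gen; rewrite /is_path /= is_walk_cat; apply/andP; split=> //.
  by rewrite -[walk_end _ _]/(prng p) pvq.
have [a1 ->] := quot_pi_surj a; have [a2 ->] := quot_pi_surj a1.
pose f (t : free_star c (vert + edge)) : A := quot_pi (tame_rel (@cohnV K c E) (@cohnY K c E))
  (quot_pi (cohn_rel (@freeV K c E) (@freeY K c E)) t).
rewrite -[X in S X]/(f a2).
have fm : star_morphism f := star_morph_comp (quot_pi_morphism _) (quot_pi_morphism _).
elim/free_ind: a2 => [[v|x]||b Sb|b d Sb Sd|k b Sb|b d Sb Sd|b Sb].
- by rewrite -[f _]/(V v) -path_elt0; exact: gen.
- rewrite -[f _]/(letter_elt c (fwd x)) -letter_V -(path_elt0 c).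
  rewrite -(path_elt_cons c (src x)).
  by apply: (gen (src x, _)); rewrite /is_path /= eqxx.
- by rewrite (star_morph0 fm).
- by rewrite (star_morphN fm) -scaleN1r; exact: SZ.
- by rewrite (star_morphD fm); exact: SD.
- by rewrite (star_morphZ fm); exact: SZ.
- by rewrite (star_morphM fm); exact: SM.
- rewrite (star_morphS fm); move: (f b) Sb => d Sd {b}.
  move: d Sd; suff : S `<=` [set d | S (star d)] by apply.
  apply: smallest_submodule_sub => [|_ [p pp <-] /=].
    split=> /= [|d d' Sd Sd'|k d Sd]; first by rewrite star0.
      by rewrite starD; exact: SD.
    by rewrite starZ; exact: SZ.
  rewrite star_path //; apply: gen; rewrite /is_path /pinv /=.
  exact: is_walk_inv.
Qed.

Lemma tame_kernel_sub : tame_kernel c E `<=` smallest submodule (@kernel_elt K c E).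
Proof.
pose B : set A := [set a | exists p p' v X,
  [/\ is_path p, is_path p', @sep E v X, finite_set X & a = pe p · ck_defect c v X · pe p']].
have BS : smallest submodule B `<=` smallest submodule (@kernel_elt K c E).
  apply: smallest_submodule_sub; first exact: smallest_submodule.
  by move=> _ [p [p' [v [X [pp pp' sX fX ->]]]]]; exact: path_defect_span.
have SB := smallest_submodule B; have [S0 _ _] := SB.
apply: subset_trans BS; rewrite tame_kernelE => a; apply; split; last first.
  move=> _ [v [X [sX fX ->]]]; apply: sub_gen_smallest; exists (v, [::]), (v, [::]), v, X.
  split=> //; rewrite path_elt0 -/(ck_defect c v X).
  by rewrite -(ck_defect_l c sX fX) -(ck_defect_r c sX fX).
split=> // b d.
  move: d; apply: smallest_submodule_sub; first exact: submodule_linear (amul_linear_l b) SB.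
  move=> _ [p [p' [v [X [pp pp' sX fX ->]]]]] /=.
  move: b (path_span b); apply: smallest_submodule_sub.
    exact: submodule_linear (amul_linear_r _) SB.
  move=> _ [q pq <-] /=; rewrite !amulA path_elt_mul //.
  case: eqP => [pvq|_]; last by rewrite !amul0r.
  apply: sub_gen_smallest; exists (q.1, q.2 ++ p.2), p', v, X; split=> //.
  rewrite /is_path /= is_walk_cat; apply/andP; split=> //.
  by rewrite -[walk_end _ _]/(prng q) pvq.
move: b; apply: smallest_submodule_sub; first exact: submodule_linear (amul_linear_r d) SB.
move=> _ [p [p' [v [X [pp pp' sX fX ->]]]]] /=.
move: d (path_span d); apply: smallest_submodule_sub.
  exact: submodule_linear (amul_linear_l _) SB.
move=> _ [q pq <-] /=; rewrite -!amulA path_elt_mul //.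
case: eqP => [pvq|_]; last by rewrite !amulr0.
apply: sub_gen_smallest; exists p, (p'.1, p'.2 ++ q.2), v, X; rewrite !amulA; split=> //.
rewrite /is_path /= is_walk_cat; apply/andP; split=> //.
by rewrite -[walk_end _ _]/(prng p') pvq.
Qed.

(** Splitting off one block, carried by g', writes the element as g' q_X times a further factor. *)
Lemma elt_tame_kernel v T F g : X0v v T -> bfam T F -> F !=set0 ->
  tame_kernel c E (elt c T F g).
Proof.
move=> TX; case=> [[] //|{}F g' X bF SX _ _].
have [Tg sX fX gX] := SX; have /X0vP[[fT _ TF _ _] _] := TX.
rewrite (elt_slot_proj c g TX (bfam_finite bF) SX); set b := elt c T F g.
have [x0 Xx0] := sep_neq0 sX.
have pg : is_path g'.
  have [[+ _ _] _ _] := gX x0 Xx0; rewrite /is_path /= is_walk_rcons => /andP[+ _].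
  by [].
have gb : pr g' · b = b.
  by rewrite /b /elt -proj_part0 // proj_Pset_in // mem_fset //; apply/asboolP.
have -> : b - \sum_(x <- fset_set X) pr (rcp g' x) · b =
    pe g' · ck_defect c (prng g') X · (star (pe g') · b).
  rewrite /ck_defect amulDr amulNr amulDl amulNl path_V amulA -/(pr g') gb; congr (_ - _).
  rewrite (big_morph (amul _) (amulDr _) (amulr0 _)).
  rewrite (big_morph (fun a => a · _) (fun a b => amulDl a b _) (amul0r _)).
  rewrite big_seq [RHS]big_seq; apply: eq_bigr => x; rewrite mem_fset // => /asboolP Xx.
  have xg : lsrc (fwd x) = walk_end g'.1 g'.2 := sep_src sX Xx.
  rewrite /path_proj /rcp (path_elt_rcons c xg) starM -surjective_pairing.
  by rewrite -[letter_elt c _]/(Y x) !amulA.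
have [[_ Il Ir] _] := star_morph_ker (tame_proj_morphism c E).
suff Kq : tame_kernel c E (ck_defect c (prng g') X) by apply: Ir; apply: Il.
by rewrite tame_kernelE; apply: sub_gen_smallest; exists (prng g'), X.
Qed.

Lemma tame_kernel_span : tame_kernel c E = smallest submodule (@kernel_elt K c E).
Proof.
apply/seteqP; split; first exact: tame_kernel_sub.
apply: smallest_submodule_sub.
  by have [[]] := star_morph_ker (tame_proj_morphism c E).
by move=> _ [T [F [g [TX [bF F0] _ _ ->]]]]; exact: elt_tame_kernel TX bF F0.
Qed.

End KernelSpan.

(** * A representation separating the elements e(T) g *)

Section CohnLift.
Variables (K : comPzRingType) (c : involution K) (E : sepGraph).
Variables (B : starAlgType c) (V : vert E -> B) (Y : edge E -> B).
Hypothesis cohnB : forall a b, cohn_rel V Y a b -> a = b.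
Hypothesis tameB : forall a b, tame_rel V Y a b -> a = b.

(** The universal property of the tame Cohn algebra, obtained by passing through the free algebra
    and the two quotients. *)
Lemma cohn_ab_lift : exists rho : cohn_ab c E -> B,
  [/\ star_morphism rho, forall v, rho (cohn_abV c v) = V v
    & forall e, rho (cohn_abY c e) = Y e].
Proof.
pose f0 : free_star c (vert E + edge E) -> B :=
  free_eval (fun i => match i with inl v => V v | inr e => Y e end).
have f0m : star_morphism f0 := free_eval_morphism _.
have f0V v : f0 (freeV c v) = V v by exact: free_eval_gen.
have f0Y e : f0 (freeY c e) = Y e by exact: free_eval_gen.
have f0r a b : cohn_rel (@freeV K c E) (@freeY K c E) a b -> f0 a = f0 b.
  move=> ab; apply: cohnB; case: ab => [v|v|v w vw|e|e|e|e|e|X e f sX Xe Xf ef];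
    rewrite ?(star_morphM f0m) ?(star_morphS f0m) ?(star_morph0 f0m) ?f0V ?f0Y.
  1-8: by constructor.
  exact: cohn_ef sX Xe Xf ef.
pose f1 := quot_lift f0 : cohn c E -> B.
have f1m : star_morphism f1 := quot_lift_morphism f0m f0r.
have f1V v : f1 (cohnV c v) = V v by rewrite -f0V; exact: quot_lift_pi.
have f1Y e : f1 (cohnY c e) = Y e by rewrite -f0Y; exact: quot_lift_pi.
have f1r a b : tame_rel (@cohnV K c E) (@cohnY K c E) a b -> f1 a = f1 b.
  by move=> ab; apply: tameB; exact: (tame_rel_morph f1m f1V f1Y).
exists (quot_lift f1); split; first exact: quot_lift_morphism.
- by move=> v; rewrite -f1V; exact: quot_lift_pi.
- by move=> e; rewrite -f1Y; exact: quot_lift_pi.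
Qed.

End CohnLift.

(* An operator together with an adjoint: reversing the product on the second
   component lets the star be the swap, so that any representation by partial
   bijections extends to the universal *-algebras. *)
Record adj_op (K : comPzRingType) (c : involution K) (W : Type) := AdjOp {
  adj_l : (W -> K^o) -> (W -> K^o);
  adj_r : (W -> K^o) -> (W -> K^o);
  adj_l_linear : linear adj_l;
  adj_r_linear : linear adj_r }.

HB.instance Definition _ K c W := gen_eqMixin (@adj_op K c W).
HB.instance Definition _ K c W := gen_choiceMixin (@adj_op K c W).

Section AdjointOperators.
Variables (K : comPzRingType) (c : involution K) (W : Type).
Local Notation M := (W -> K^o).
Local Notation op := (adj_op c W).
Implicit Types (x y z : op) (f : M).

Lemma adj_opP x y : adj_l x =1 adj_l y -> adj_r x =1 adj_r y -> x = y.
Proof.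
case: x y => [l r ll rl] [l' r' ll' rl'] /= /funext ll'E /funext rr'E.
by subst l' r'; congr AdjOp; exact: Prop_irrelevance.
Qed.

Lemma linear0_op : linear (fun _ : M => 0 : M).
Proof. by move=> k u w; rewrite scaler0 addr0. Qed.

Lemma linearD_op (f g : M -> M) : linear f -> linear g -> linear (fun u => f u + g u).
Proof. by move=> lf lg k u w; rewrite lf lg scalerDr addrACA. Qed.

Lemma linearZ_op d (f : M -> M) : linear f -> linear (fun u => d *: f u).
Proof. by move=> lf k u w; rewrite lf scalerDr !scalerA mulrC. Qed.

Lemma linear_comp_op (f g : M -> M) : linear f -> linear g -> linear (fun u => f (g u)).
Proof. by move=> lf lg k u w; rewrite lg lf. Qed.

Definition adj0 : op := AdjOp c linear0_op linear0_op.
Definition adjZ k x : op := AdjOp c (linearZ_op k (@adj_l_linear _ _ _ x))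
  (linearZ_op (c k) (@adj_r_linear _ _ _ x)).
Definition adjN x : op := AdjOp c (linearZ_op (-1) (@adj_l_linear _ _ _ x))
  (linearZ_op (-1) (@adj_r_linear _ _ _ x)).
Definition adjD x y : op :=
  AdjOp c (linearD_op (@adj_l_linear _ _ _ x) (@adj_l_linear _ _ _ y))
    (linearD_op (@adj_r_linear _ _ _ x) (@adj_r_linear _ _ _ y)).
Definition adjM x y : op :=
  AdjOp c (linear_comp_op (@adj_l_linear _ _ _ x) (@adj_l_linear _ _ _ y))
    (linear_comp_op (@adj_r_linear _ _ _ y) (@adj_r_linear _ _ _ x)).
Definition adj_star x : op := AdjOp c (@adj_r_linear _ _ _ x) (@adj_l_linear _ _ _ x).

Fact adj_addA : associative adjD.
Proof. by move=> x y z; apply: adj_opP => f /=; rewrite addrA. Qed.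
Fact adj_addC : commutative adjD.
Proof. by move=> x y; apply: adj_opP => f /=; rewrite addrC. Qed.
Fact adj_add0 : left_id adj0 adjD.
Proof. by move=> x; apply: adj_opP => f /=; rewrite add0r. Qed.
Fact adj_addN : left_inverse adj0 adjN adjD.
Proof. by move=> x; apply: adj_opP => f /=; rewrite scaleN1r addNr. Qed.

HB.instance Definition _ :=
  GRing.isZmodule.Build op adj_addA adj_addC adj_add0 adj_addN.

Fact adj_scaleA k l x : adjZ k (adjZ l x) = adjZ (k * l) x.
Proof. by apply: adj_opP => f /=; rewrite scalerA ?rmorphM. Qed.
Fact adj_scale1 : left_id 1 adjZ.
Proof. by move=> x; apply: adj_opP => f /=; rewrite ?rmorph1 scale1r. Qed.
Fact adj_scaleDr : right_distributive adjZ +%R.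
Proof. by move=> k x y; apply: adj_opP => f /=; rewrite scalerDr. Qed.
Fact adj_scaleDl x : {morph adjZ^~ x : k l / k + l}.
Proof. by move=> k l; apply: adj_opP => f /=; rewrite ?rmorphD scalerDl. Qed.

HB.instance Definition _ := GRing.Zmodule_isLmodule.Build K op
  adj_scaleA adj_scale1 adj_scaleDr adj_scaleDl.

Lemma linearD_fun (f : M -> M) : linear f -> forall u w, f (u + w) = f u + f w.
Proof. by move=> lf u w; rewrite -[u]scale1r lf !scale1r. Qed.

Lemma linearZ_fun (f : M -> M) : linear f -> forall k u, f (k *: u) = k *: f u.
Proof.
move=> lf k u; have f0 : f 0 = 0.
  by apply: (addrI (f 0)); rewrite -linearD_fun // !addr0.
by rewrite -[k *: u]addr0 lf f0 addr0.
Qed.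

Fact adj_mulA : associative adjM.
Proof. by move=> x y z; apply: adj_opP. Qed.
Fact adj_mulDl : left_distributive adjM +%R.
Proof.
move=> x y z; apply: adj_opP => f //=.
by rewrite (linearD_fun (@adj_r_linear _ _ _ z)).
Qed.
Fact adj_mulDr : right_distributive adjM +%R.
Proof.
move=> x y z; apply: adj_opP => f //=.
by rewrite (linearD_fun (@adj_l_linear _ _ _ x)).
Qed.
Fact adj_mulZl k x y : adjM (k *: x) y = k *: adjM x y.
Proof.
by apply: adj_opP => f //=; rewrite (linearZ_fun (@adj_r_linear _ _ _ y)).
Qed.
Fact adj_mulZr k x y : adjM x (k *: y) = k *: adjM x y.
Proof.
by apply: adj_opP => f //=; rewrite (linearZ_fun (@adj_l_linear _ _ _ x)).
Qed.
Fact adj_starK : involutive adj_star.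
Proof. by move=> x; apply: adj_opP. Qed.
Fact adj_starD : {morph adj_star : x y / x + y}.
Proof. by move=> x y; apply: adj_opP. Qed.
Fact adj_starZ k x : adj_star (k *: x) = c k *: adj_star x.
Proof. by apply: adj_opP => f //=; rewrite conj_ofK. Qed.
Fact adj_starM x y : adj_star (adjM x y) = adjM (adj_star y) (adj_star x).
Proof. by apply: adj_opP. Qed.

HB.instance Definition _ := Lmodule_isStarAlgebra.Build K c op
  adj_mulA adj_mulDl adj_mulDr adj_mulZl adj_mulZr
  adj_starK adj_starD adj_starZ adj_starM.

(** Functions are transported contravariantly, so a product of operators follows the letters of a
    path from left to right. The inverse partial map supplies the adjoint. *)
Definition pullback (al : W -> option W) (f : M) : M := fun p => if al p is Some q then f q else 0.

Lemma pullback_linear al : linear (pullback al).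
Proof.
move=> k u w; apply/funext => p; rewrite /pullback.
rewrite -[RHS]/(k * pullback al u p + pullback al w p) /pullback.
by case: (al p) => [q|] //; rewrite mulr0 addr0.
Qed.

Definition pullop al be : op := AdjOp c (pullback_linear al) (pullback_linear be).

Definition pthen (al be : W -> option W) p := obind be (al p).

Lemma pullopM al be al' be' : pullop al be · pullop al' be' = pullop (pthen al al') (pthen be' be).
Proof.
by apply: adj_opP => f /=; apply/funext => p; rewrite /pullback /pthen /=; case: (_ p).
Qed.

Lemma pullop_star al be : star (pullop al be) = pullop be al.
Proof. exact: adj_opP. Qed.

Lemma pullop0 : pullop (fun=> None) (fun=> None) = 0.
Proof. exact: adj_opP. Qed.

End AdjointOperators.

(** * Partial bijections of the hull of a tree *)

Section Representation.
Variables (K : comPzRingType) (c : involution K) (E : sepGraph).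
Variables (v0 : vert E) (S0 : set (gpath E)).
Hypothesis S0X : X0v v0 S0.
Local Notation vert := (vert E).
Local Notation edge := (edge E).
Local Notation letter := (letter E).
Local Notation gpath := (gpath E).
Local Notation op := (adj_op c gpath).
Implicit Types (y z : letter) (u w h : seq letter) (e f x : edge) (v : vert).
Implicit Types (p q g : gpath) (T U F : set gpath) (X : set edge).

(* the closure of [S0] under right multiplication by inverse edges *)
Definition hull p := [/\ FC p, p.1 = v0 & S0 (part0 p)].

Definition vstep v p : option gpath :=
  if `[< hull p /\ prng p = v >] then Some p else None.

(** Requiring both ends of a move to lie in the hull makes the actions of y and y^-1 inverse partial
    bijections. *)
Definition step y p : option gpath :=
  if `[< [/\ hull p, prng p = lsrc y & hull (p.1, rsnoc p.2 y)] >]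
  then Some (p.1, rsnoc p.2 y) else None.

Lemma stepP y p q : step y p = Some q <->
  [/\ hull p, prng p = lsrc y, hull q & q = (p.1, rsnoc p.2 y)].
Proof.
rewrite /step; case: asboolP => [[hp py hq]|n]; split=> //; first by case=> <-.
  by case=> _ _ _ ->.
by case=> hp py hq qE; case: n; rewrite -qE.
Qed.

Lemma FC_reduced p : FC p -> reduced_word p.2.
Proof.
move=> /FCP[_]; rewrite /reduced_word; case: p.2 => // y w /=.
by apply: sub_path => a b /andP[].
Qed.

Lemma rsnocK u y : reduced_word u -> rsnoc (rsnoc u y) (linv y) = u.
Proof.
case: (rsnocP u y) => [u' ->|_ _]; last by rewrite -{1}(linvK y) rsnoc_cancel.
move=> ru; apply: rsnoc_rcons => u'' uE; move: ru.
rewrite uE linvK /reduced_word -[rcons (rcons _ _) _]cats1 cat_rcons sorted_cat_cons.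
by rewrite /= eqxx andbF.
Qed.

Lemma step_inv y p q : step y p = Some q -> step (linv y) q = Some p.
Proof.
move=> /stepP[hp py hq qE]; apply/stepP; split=> //.
  have [/FCP[wp _] _ _] := hp.
  by rewrite lsrc_linv qE [prng _](walk_end_rsnoc y wp).
have [Fp _ _] := hp.
by rewrite qE /= rsnocK -?surjective_pairing //; exact: FC_reduced.
Qed.

Definition mutual (al be : gpath -> option gpath) :=
  forall p q, al p = Some q <-> be q = Some p.

Lemma step_mutual y : mutual (step y) (step (linv y)).
Proof.
by move=> p q; split=> [/step_inv//|/step_inv]; rewrite linvK.
Qed.

Lemma vstep_mutual v : mutual (vstep v) (vstep v).
Proof.
move=> p q; rewrite /vstep.
by split; case: asboolP => // H [E1]; move: H; rewrite E1 => H; case: asboolP.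
Qed.

Lemma mutual_comp al be al' be' : mutual al be -> mutual al' be' ->
  mutual (pthen al al') (pthen be' be).
Proof.
move=> H H' p q; rewrite /pthen; split.
  by case E1: (al p) => [r|] //= /H' ->; apply/H.
by case E1: (be' q) => [r|] //= /H ->; apply/H'.
Qed.

Lemma mutual_sym al be : mutual al be -> mutual be al.
Proof. by move=> H p q; split=> /H. Qed.

Definition repV v : op := pullop c (vstep v) (vstep v).
Definition repY e : op := pullop c (step (fwd e)) (step (bwd e)).

Lemma vstep_step y : pthen (vstep (lsrc y)) (step y) = step y.
Proof.
apply/funext => p; rewrite /pthen /vstep; case: asboolP => //= n.
case E1 : (step y p) => [q|] //; case: n.
by have /stepP[] := E1.
Qed.

Lemma step_vstep y : pthen (step y) (vstep (lrng y)) = step y.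
Proof.
apply/funext => p; rewrite /pthen; case E1 : (step y p) => [q|] //=.
have /stepP[hp py hq qE] := E1; rewrite /vstep; case: asboolP => // -[]; split=> //.
have [/FCP[wp _] _ _] := hp.
by rewrite qE [prng _](walk_end_rsnoc y wp).
Qed.

(** The relation e*e = r(e) asks e^-1 to act at every point of the hull with range r(e); this is why
    the hull is closed under inverse edges. *)
Lemma step_bwd_fwd e : pthen (step (bwd e)) (step (fwd e)) = vstep (rng e).
Proof.
apply/funext => p; rewrite /pthen /vstep; case: asboolP => [[hp pe]|n]; last first.
  case E1 : (step _ p) => [q|] //; case: n.
  by have /stepP[] := E1.
suff [q pq] : exists q, step (bwd e) p = Some q by rewrite pq /=; exact: (step_inv pq).
have [Fp pv Sp] := hp.
exists (p.1, rsnoc p.2 (bwd e)); apply/stepP; split=> //.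
have /FCP[wp sp] := Fp; have [_ wr] := (wp, rsnoc_walk wp (esym pe : lsrc (bwd e) = _)).
case: rsnocP wr => [u uE _|nu wr].
  have up : pprefix (p.1, u) p by rewrite /pprefix eqxx uE prefix_rcons.
  split=> //; first exact: FC_prefix up Fp.
  have /X0vP[[_ _ _ lS _] _] := S0X; apply: (lS _ _ Sp).
  by case/andP: up => _ up; rewrite /pprefix eqxx prefix_epart2.
split=> //; last by rewrite /part0 /= epart_rcons.
apply/FCP; split=> //=; case/lastP: {wr} p.2 nu sp => // u y nu sp.
rewrite -[rcons (rcons _ _) _]cats1 cat_rcons sorted_cat_cons sp /= andbT /follows.
rewrite andbF andbT; apply/eqP => yE; apply: (nu u); congr rcons.
by rewrite yE linvK.
Qed.

(** If e^-1 followed by f acted somewhere, the hull would contain q e and q f for some q. If q ends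
    in e^-1 or f^-1, one of these is not separated; otherwise the two branch inside [S0]. *)
Lemma step_bwd_fwd0 e f : e != f -> same_block e f ->
  pthen (step (bwd e)) (step (fwd f)) = fun=> None.
Proof.
move=> ef sef; apply/funext => p; rewrite /pthen.
case E1 : (step (bwd e) p) => [q|] //=; case E2 : (step (fwd f) q) => [r|] //.
have /step_inv/stepP[hq qe hp pE] := E1; have /stepP[_ _ hr rE] := E2.
have /X0vP[[_ _ SF lS bS] _] := S0X; exfalso.
have [Fp _ Sp] := hp; have [Fr _ Sr] := hr.
rewrite -[linv _]/(fwd e) in pE; rewrite {}pE {}rE in Fp Sp Fr Sr.
have nfol h : ~ sorted (@follows E) (rcons (rcons h (bwd e)) (fwd f)).
  rewrite -[rcons (rcons _ _) _]cats1 cat_rcons sorted_cat_cons /= => /and3P[_ /andP[_ /negP[]]].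
  by [].
have nfol' h : ~ sorted (@follows E) (rcons (rcons h (bwd f)) (fwd e)).
  rewrite -[rcons (rcons _ _) _]cats1 cat_rcons sorted_cat_cons /= => /and3P[_ /andP[_ /negP[]]].
  by rewrite /= same_block_sym.
move: Fp Fr Sp Sr; case: (rsnocP q.2 (fwd e)) => [h hE|_]; case: (rsnocP q.2 (fwd f)) => [h' hE'|_].
- by move: hE; rewrite hE' => /rcons_inj[_ fe]; rewrite fe eqxx in ef.
- by move=> _ /FCP[_]; rewrite hE => /nfol.
- by move=> /FCP[_ /=]; rewrite hE' => /nfol'.
- move=> _ _; rewrite /part0 /= !epart_id ?ends_inv_rcons // => Se Sf.
  by apply: (bS _ _ Se Sf); exists q.2, e, f; rewrite !prefix_refl.
Qed.

Lemma rep_cohn a b : cohn_rel repV repY a b -> a = b.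
Proof.
case=> [v|v|v w vw|e|e|e|e|e|X e f sX Xe Xf ef]; rewrite ?pullop_star ?pullopM //.
- congr pullop; apply/funext => p; rewrite /pthen /vstep; by case: asboolP => //= ?; case: asboolP.
- have n p : pthen (vstep v) (vstep w) p = None /\ pthen (vstep w) (vstep v) p = None.
    rewrite /pthen /vstep; split; case: asboolP => //= -[_ pv]; case: asboolP => //= -[_ pw].
      by case: vw; rewrite -pv.
    by case: vw; rewrite -pw.
  by rewrite -pullop0; congr pullop; apply/funext => p; case: (n p).
- by rewrite (vstep_step (fwd e)) (step_vstep (bwd e)).
- by rewrite (vstep_step (bwd e)) (step_vstep (fwd e)).
- by rewrite (step_vstep (bwd e)) (vstep_step (fwd e)).
- by rewrite (step_vstep (fwd e)) (vstep_step (bwd e)).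
- by rewrite !step_bwd_fwd.
- have sef : same_block e f by apply/same_blockP; exists X.
  rewrite -pullop0 !step_bwd_fwd0 //; first by rewrite eq_sym; exact/eqP.
    by rewrite same_block_sym.
  exact/eqP.
Qed.

Lemma rep_monomial a : star_monomial repV repY a ->
  exists al be, mutual al be /\ a = pullop c al be.
Proof.
elim=> {a} [v|e|a b _ [al [be [H ->]]] _ [al' [be' [H' ->]]]|a _ [al [be [H ->]]]].
- by exists (vstep v), (vstep v); split=> //; exact: vstep_mutual.
- by exists (step (fwd e)), (step (bwd e)); split=> //; exact: step_mutual.
- by exists (pthen al al'), (pthen be' be); split; [exact: mutual_comp|exact: pullopM].
- by exists be, al; split; [exact: mutual_sym|exact: pullop_star].
Qed.

Definition restr (D : pred gpath) p : option gpath := if D p then Some p else None.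

Lemma mutual_restr al be : mutual al be -> pthen al be = restr (fun p => al p != None).
Proof.
move=> H; apply/funext => p; rewrite /pthen /restr; case E1 : (al p) => [q|] //=.
exact/H.
Qed.

Lemma restr_comm (D D' : pred gpath) : pthen (restr D) (restr D') = pthen (restr D') (restr D).
Proof.
apply/funext => p; rewrite /pthen /restr.
by case E1 : (D p) => /=; case E2 : (D' p) => /=; rewrite ?E1 ?E2.
Qed.

(** For a partial bijection, aa* is the restriction to its domain, and restrictions commute. *)
Lemma rep_tame a b : tame_rel repV repY a b -> a = b.
Proof.
case=> x y /rep_monomial[al [be [H ->]]] /rep_monomial[al' [be' [H' ->]]].
rewrite !pullop_star !pullopM (mutual_restr H) (mutual_restr H').
by congr pullop; exact: restr_comm.
Qed.

Let root : gpath := (v0, [::]).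

Lemma hull_root : hull root.
Proof.
by have /X0vP[[_ Sr SF _ _] _] := S0X; split=> //; have [] := SF _ Sr.
Qed.

Lemma hull_prefix p q : pprefix p q -> hull q -> hull p.
Proof.
move=> pq [Fq qv Sq]; have /X0vP[[_ _ _ lS _] _] := S0X; have /andP[/eqP pq1 pq2] := pq.
split; [exact: FC_prefix pq Fq|by rewrite pq1|apply: (lS _ _ Sq)].
by rewrite /pprefix /= pq1 eqxx prefix_epart2.
Qed.

(** A C-separated path started at the root never cancels, so the walk along it visits its prefixes.
    The hull is closed under prefixes, so the walk can be completed exactly when the whole path lies
    in it. *)
Lemma rep_path rho : star_morphism rho ->
    (forall v, rho (cohn_abV c v) = repV v) -> (forall e, rho (cohn_abY c e) = repY e) ->
  forall p, FC p -> exists al be, [/\ mutual al be, rho (path_elt c p) = pullop c al be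
    & al root = if `[< hull p >] then Some p else None].
Proof.
move=> rm rV rY [v w]; elim/last_ind: w => [|w y IH] Fp.
  exists (vstep v), (vstep v); rewrite path_elt0 rV; split=> //; first exact: vstep_mutual.
  rewrite /vstep; case: asboolP => [[hr vr]|n]; case: asboolP => [h|n'].
  - by rewrite -vr.
  - by case: n'; rewrite -vr.
  - by case: n; split; [exact: hull_root|case: h].
  - by [].
have pw : pprefix (v, w) (v, rcons w y) by rewrite /pprefix eqxx prefix_rcons.
have [al [be [H rE alE]]] := IH (FC_prefix pw Fp).
have /FCP[/=] := Fp; rewrite is_walk_rcons => /andP[ww /eqP yw] _.
exists (pthen al (step y)), (pthen (step (linv y)) be); split.
- exact: mutual_comp (step_mutual y).
- rewrite path_elt_rcons // (star_morphM rm) rE; case: y {Fp pw yw} => e b.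
  case: b; last by rewrite rY pullopM.
  by rewrite (star_morphS rm) rY pullop_star pullopM.
rewrite /pthen alE; case: asboolP => [hw|nw] /=; last first.
  by case: asboolP => // hp; case: nw; exact: hull_prefix pw hp.
have rE' : rsnoc w y = rcons w y.
  apply: rsnoc_rcons => u wE; have /= := FC_reduced Fp.
  rewrite wE /reduced_word -[rcons (rcons _ _) _]cats1 cat_rcons sorted_cat_cons.
  by rewrite /= linvK eqxx andbF.
rewrite /step /= rE'; case: asboolP => [[_ _ hp]|n]; case: asboolP => [hp'|n'] //.
by case: n.
Qed.

(** [ev d a] is the value at the root of the image of [d] under [a]. Only linearity and these values
    are retained from the representation. *)
Lemma rep_elt : exists ev : (gpath -> K^o) -> cohn_ab c E -> K,
  [/\ forall d, {morph ev d : a b / a + b}, forall d k a, ev d (k *: a) = k * ev d a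
    & forall d T g, FC g -> finite_set T -> (forall p, T p -> FC p) ->
      ev d (elt c T set0 g) =
      if `[< (forall p, T p -> hull p) /\ hull g >] then d g else 0].
Proof.
have [rho [rm rV rY]] := cohn_ab_lift rep_cohn rep_tame.
exists (fun d a => adj_l (rho a) d root); split.
- by move=> d a b; rewrite (star_morphD rm).
- by move=> d k a; rewrite (star_morphZ rm).
move=> d T g Fg fT TF; rewrite /elt fset_set0 /=.
have rpe p : FC p -> adj_l (rho (path_elt c p)) d root = if `[< hull p >] then d p else 0.
  by move=> Fp; have [al [be [_ -> alE]]] := rep_path rm rV rY Fp; rewrite /= /pullback alE; case: asboolP.
have rpr p a : FC p -> adj_l (rho (path_proj c p · a)) d root =
    if `[< hull p >] then adj_l (rho a) d root else 0.
  move=> Fp; have [al [be [H rE alE]]] := rep_path rm rV rY Fp.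
  rewrite !(star_morphM rm) (star_morphS rm) rE pullop_star pullopM (mutual_restr H).
  by rewrite -[LHS]/(pullback (restr _) (adj_l (rho a) d) root) /pullback /restr alE; case: asboolP.
have rPset (r : seq gpath) : (forall p, p \in r -> FC p) ->
    adj_l (rho (Pset r (path_elt c g))) d root =
    if `[< forall p, p \in r -> hull p >] then adj_l (rho (path_elt c g)) d root else 0.
  elim: r => [_|p r IH rF].
    by case: asboolP => // n; case: n.
  rewrite -[Pset _ _]/(path_proj c p · Pset r (path_elt c g)).
  rewrite rpr; last by apply: rF; rewrite inE eqxx.
  rewrite IH; last by move=> q qr; apply: rF; rewrite inE qr orbT.
  have -> : `[< forall q, q \in p :: r -> hull q >] =
      `[< hull p >] && `[< forall q, q \in r -> hull q >].
    apply/asboolP/andP => [hpr|[/asboolP hp /asboolP hr] q].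
      split; apply/asboolP; first by apply: hpr; rewrite inE eqxx.
      by move=> q qr; apply: hpr; rewrite inE qr orbT.
    by rewrite inE => /orP[/eqP ->|/hr].
  by case: `[< hull p >].
rewrite rPset => [|p]; last by rewrite mem_fset // => /asboolP/TF.
have -> : `[< (forall p, T p -> hull p) /\ hull g >] =
    `[< forall p, p \in (fset_set T : seq _) -> hull p >] && `[< hull g >].
  apply/asboolP/andP => [[hT hg]|[/asboolP hT /asboolP hg]]; split=> //; do ?exact/asboolP.
    by apply/asboolP => p; rewrite mem_fset // => /asboolP/hT.
  by move=> p Tp; apply: hT; rewrite mem_fset //; exact/asboolP.
by rewrite rpe //; case: `[< forall p, _ >].
Qed.

End Representation.

(** * Independence of the elements e(T) g *)

Section EltIndependence.
Variables (K : comPzRingType) (c : involution K) (E : sepGraph).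

Definition elt_index : set (set (gpath E) * gpath E) :=
  [set i | [/\ X0v (psrc i.2) i.1, FC i.2 & i.1 (part0 i.2)]].

(** Take an index whose tree is smallest among those with nonzero coefficient, represent on the hull
    of that tree and evaluate at the delta function of its g. A surviving term has the same g and a
    tree contained in the chosen one, hence equal to it by minimality. *)
Lemma elt_indep : indep elt_index (fun i => elt c i.1 set0 i.2).
Proof.
move=> s Ds; rewrite comboE; set L := undup _ => L0 i0; apply: contrapT => /eqP ci0.
have LD i : i \in L -> elt_index i by rewrite mem_undup => /mapP[x /Ds ? ->].
pose sz (i : set (gpath E) * gpath E) := #|` fset_set i.1|.
have [i [iL ci imin]] : exists i, [/\ i \in L, coef s i != 0 &
    forall j, j \in L -> coef s j != 0 -> (sz i <= sz j)%N].
  have i0L : i0 \in L.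
    have [//|nL] := boolP (i0 \in L); case/eqP: ci0; rewrite /coef big_seq_cond big1 //.
    by move=> x /andP[xs /eqP xi]; case/negP: nL; rewrite mem_undup -xi map_f.
  have [N] := ubnP (sz i0); elim: N i0 i0L ci0 => // N IH i iL ci iN.
  have [[j [jL cj ji]]|n] := pselect (exists j, [/\ j \in L, coef s j != 0 & (sz j < sz i)%N]).
    by apply: (IH j) => //; apply: leq_trans ji _.
  exists i; split=> // j jL cj; rewrite leqNgt; apply/negP => ji; apply: n; exists j.
  by [].
have [iX Fi Ti] := LD i iL; have /X0vP[[fi _ iF li _] _] := iX.
have [ev [evD evZ evE]] := rep_elt c iX.
pose d : gpath E -> K^o := fun p => (p == i.2)%:R.
have ev0 : ev d 0 = 0 by rewrite -[0 in LHS](scale0r (0 : cohn_ab c E)) evZ mul0r.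
have hulli p : i.1 p -> hull (psrc i.2) i.1 p.
  move=> ip; have [Fp pv] := iF _ ip; split=> //; apply: (li _ _ ip); exact: part0_prefix.
case/eqP: ci; have := congr1 (ev d) L0; rewrite ev0 (big_morph _ (evD d) ev0) => <-.
rewrite (bigD1_seq i) ?undup_uniq //= big_seq_cond big1 ?addr0.
  rewrite evZ evE //; last by move=> p /iF[].
  case: asboolP => [_|[]]; first by rewrite /d eqxx mulr1.
  by split=> //; split.
move=> j /andP[jL ji]; have [jX Fj Tj] := LD j jL; have /X0vP[[fj _ jF lj _] ej] := jX.
rewrite evZ; have [->|cj] := eqVneq (coef s j) 0; first by rewrite mul0r.
rewrite evE //; last by move=> p /jF[].
case: asboolP => [[hT hg]|_]; last by rewrite mulr0.
rewrite /d; have [gij|_] := eqVneq j.2 i.2; last by rewrite mulr0.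
case/eqP: ji; rewrite [i]surjective_pairing [j]surjective_pairing gij; congr (_, _).
(* A tree in [X0v] is generated by paths that do not end in an inverse edge, and on these the hull
   and [i.1] agree. *)
have ji : j.1 `<=` i.1.
  move=> p /ej[q [jq pq qe]]; have [_ _] := hT _ jq; rewrite /part0 epart_id // => iq.
  by apply: (li _ _ iq); move: pq; rewrite -surjective_pairing.
have : fset_set j.1 = fset_set i.1.
  apply/eqP; rewrite eqEfcard imin // andbT; apply/fsubsetP => p.
  by rewrite !mem_fset // => /asboolP/ji ip; apply/asboolP.
move=> eij; apply/seteqP; split=> // p ip.
by have := mem_fset p fj; rewrite eij mem_fset // asboolT // => /esym/asboolP.
Qed.

End EltIndependence.

(** * Distinguished edges *)

Section Choice.
Variables (E : sepGraph) (ch : choice_function E).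
Local Notation vert := (vert E).
Local Notation edge := (edge E).
Local Notation letter := (letter E).
Local Notation gpath := (gpath E).
Implicit Types (y z : letter) (u w : seq letter) (e f x : edge) (v : vert).
Implicit Types (p q g h : gpath) (T U F S : set gpath) (X : set edge).

Definition is_choice e := exists Y, e = choice_edge ch Y.
Definition ends_choice p := exists w e, p.2 = rcons w (fwd e) /\ is_choice e.

Lemma choice_reducedP p : choice_reduced ch p <-> ~ ends_choice p.
Proof.
split=> [cp [w [e [pE [Y eE]]]]|np w Y pE]; first by apply: (cp w Y); rewrite -eE.
by apply: np; exists w, (choice_edge ch Y); split=> //; exists Y.
Qed.

Lemma ends_choice_rcp g e : ends_choice (rcp g e) <-> is_choice e.
Proof.
split=> [[w [f [/= /rcons_inj[_ ->]]]]|ce] //.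
by exists g.2, e.
Qed.

Lemma ends_choice_edge p : ends_choice p -> ~~ ends_inv p.2.
Proof. by case=> w [e [-> _]]; rewrite ends_inv_rcons. Qed.

(** Blocks are disjoint, so a distinguished edge lying in X can only be the one chosen for X. *)
Lemma block_choice X : @sep_all E X -> finite_set X -> exists x0,
  [/\ X x0, is_choice x0 & forall e, X e -> is_choice e -> e = x0].
Proof.
move=> sX fX; pose Y : {X : set edge | @sep_fin E X} := exist _ X (conj sX fX).
exists (choice_edge ch Y); split; [exact: (choice_edgeP ch Y)|by exists Y|].
move=> e Xe [Y' eE]; rewrite eE; congr choice_edge.
have Ye : sval Y' e by rewrite eE; exact: choice_edgeP.
case: Y' Ye {eE} => X' [sX' fX'] /= X'e; have XX' := sep_unique sX' sX X'e Xe.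
by subst X'; congr exist; exact: Prop_irrelevance.
Qed.

Definition nchoice U := #|` fset_set (U `&` ends_choice)|.

Lemma nchoice_lt U S h : finite_set U -> finite_set S ->
  (forall p, U p -> ends_choice p -> S p) -> S h -> ends_choice h -> ~ U h ->
  (nchoice U < nchoice S)%N.
Proof.
move=> fU fS US Sh ch_h Uh; rewrite /nchoice.
have fUc : finite_set (U `&` ends_choice) by exact: finite_setIl.
have fSc : finite_set (S `&` ends_choice) by exact: finite_setIl.
apply: fproper_ltn_card; rewrite fproperEneq; apply/andP; split.
  apply/eqP => e; apply: Uh.
  have : h \in fset_set (S `&` ends_choice) by rewrite mem_fset //; apply/asboolP.
  by rewrite -e mem_fset // => /asboolP[].
apply/fsubsetP => p; rewrite !mem_fset // => /asboolP[Up cp].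
by apply/asboolP; split=> //; exact: US.
Qed.

Lemma Slot_edge_in v T g X p : X0v v T -> Slot T g X -> pprefix p g -> ~~ ends_inv p.2 -> T p.
Proof.
move=> /X0vP[[_ _ _ lT _] _] [Tg _ _ _] /andP[/eqP pg1 pg2] pe; apply: (lT _ _ Tg).
by rewrite /pprefix pg1 eqxx prefix_epart_of.
Qed.

(* Expanding e(T \ F) over the choices of at most one edge in each block of F,
   the term using the distinguished edge everywhere has the largest number of
   elements ending in a distinguished edge. *)
Definition lead T F : set gpath :=
  T `|` [set p | exists q, [/\ F q, ends_choice q & pprefix p q]].

Lemma lead0 T : lead T set0 = T.
Proof. by apply/seteqP; split=> [p [//|[q []]]//|p]; left. Qed.

(** New points of [lead] lie below a member of a block at some g; apart from that member itself they
    lie below g, and those not ending in an inverse edge are then in T. *)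
Lemma in_lead_edge v T F p : X0v v T -> bfam T F -> lead T F p -> ~~ ends_inv p.2 ->
  T p \/ F p /\ ends_choice p.
Proof.
move=> TX bF [|[q [Fq cq pq]]] pe; first by left.
have [g [X [x [SX Xx qE XF]]]] := bfam_Slot bF Fq.
move: pq; rewrite qE pprefix_rcp => /orP[/eqP ->|pg].
  by right; rewrite -qE.
by left; exact: Slot_edge_in TX SX pg pe.
Qed.

Lemma bfam_lead_max v T F p q : X0v v T -> bfam T F -> F p -> ends_choice p ->
  lead T F q -> pprefix p q -> q = p.
Proof.
move=> TX bF Fp cp [Tq|[r [Fr cr qr]]] pq.
  have /X0vP[[_ _ _ lT _] _] := TX.
  by case: (bfam_notin bF Fp); exact: lT Tq pq.
have [g [X [x [SX Xx rE XF]]]] := bfam_Slot bF Fr.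
move: qr; rewrite rE pprefix_rcp => /orP[/eqP qE|qg].
  move: pq; rewrite qE pprefix_rcp => /orP[/eqP //|pg].
  case: (bfam_notin bF Fp); apply: (Slot_edge_in TX SX pg).
  exact: ends_choice_edge.
case: (bfam_notin bF Fp); apply: (Slot_edge_in TX SX (pprefix_trans pq qg)).
exact: ends_choice_edge.
Qed.

Definition reduced_index : set (set gpath * set gpath * gpath) :=
  [set i | [/\ X0v (psrc i.2) i.1.1, bfam i.1.1 i.1.2, FC i.2, i.1.1 (part0 i.2)
    & reduced_rel ch i.1.1 i.1.2 (part0 i.2)]].

Section LeadInverse.
Variables (v : vert) (T F : set gpath) (g0 : gpath).
Hypotheses (TX : X0v v T) (bF : bfam T F) (Tg0 : T g0) (red : reduced_rel ch T F g0).

(** A maximal element of T that ends in a distinguished edge and differs from [g0] is blocked, by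
    reducedness. The distinguished member of its block extends it inside [lead], so it is no longer
    maximal there. *)
Lemma lead_choice : F `&` ends_choice =
  [set p | [/\ maxl (lead T F) p, ends_choice p & p <> g0]].
Proof.
have /X0vP[[_ _ _ lT _] _] := TX; apply/seteqP; split=> p.
  move=> [Fp cp]; split=> //; last by move=> pg; apply: (bfam_notin bF Fp); rewrite pg.
  split; last by move=> q; exact: bfam_lead_max TX bF Fp cp.
  by right; exists p; split=> //; exact: pprefix_refl.
move=> [[Lp pmax] cp pg0]; have [Tp|//] := in_lead_edge TX bF Lp (ends_choice_edge cp).
have mp : maxl T p by split=> // q Tq; apply: pmax; left.
have [bp|nbp] := pselect (blocked T F p); last first.
  by have /choice_reducedP := red mp nbp pg0.
have [w [X [SX aw XF]]] := (blockedP F TX mp).1 bp.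
have [_ sX fX _] := SX.
have [||x0 [Xx0 cx0 _]] := @block_choice X => //; first by eexists; [|exact: sX].
have := pmax (rcp (p.1, p.2 ++ w) x0).
have Fx0 : F (rcp (p.1, p.2 ++ w) x0) by apply: XF; rewrite mul_edgesE; exists x0.
have pr : pprefix p (rcp (p.1, p.2 ++ w) x0) by rewrite pprefix_rcp pprefix_cat orbT.
move=> /(_ _ pr) e; case: (bfam_notin bF Fx0); rewrite e //.
right; exists (rcp (p.1, p.2 ++ w) x0); split=> //; last exact: pprefix_refl.
exact/ends_choice_rcp.
Qed.

(** Any member of a block determines the block, and each block of F has a distinguished member. *)
Lemma bfam_choiceE : F = [set p | exists g x0 x,
  [/\ p = rcp g x, same_block x0 x & (F `&` ends_choice) (rcp g x0)]].
Proof.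
apply/seteqP; split=> p.
  move=> Fp; have [g [X [x [SX Xx pE XF]]]] := bfam_Slot bF Fp; have [_ sX fX _] := SX.
  have sXa : @sep_all E X by exists (prng g).
  have [x0 [Xx0 cx0 _]] := block_choice sXa fX; exists g, x0, x; split=> //.
    by apply/same_blockP; exists X.
  split; last exact/ends_choice_rcp.
  by apply: XF; rewrite mul_edgesE; exists x0.
move=> [g [x0 [x [-> sx [Fgx _]]]]].
have [g' [X [x' [SX Xx' gE XF]]]] := bfam_Slot bF Fgx.
have [gg' xx'] := rcp_inj gE; have [_ sX _ _] := SX.
apply: XF; rewrite mul_edgesE gg'; exists x => //.
by apply: same_block_in sx; [exists (prng g')|rewrite xx'].
Qed.

Lemma lead_core : T = core (lead T F `\` (F `&` ends_choice)).
Proof.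
have /X0vP[[_ _ _ lT _] eT] := TX; apply/seteqP; split=> p.
  move=> /eT[q [Tq pq qe]]; exists q; split=> //; split; first by left.
  by move=> [Fq _]; exact: bfam_notin bF Fq Tq.
move=> [q [[Lq nFq] pq qe]]; have [Tq|//] := in_lead_edge TX bF Lq qe.
exact: lT Tq pq.
Qed.

End LeadInverse.

Lemma lead_inj : {in reduced_index &, injective (fun i => (lead i.1.1 i.1.2, i.2))}.
Proof.
move=> [[T F] g] [[T' F'] g'] /set_mem[/= TX bF _ Tg red] /set_mem[/= TX' bF' _ Tg' red'].
move=> [e gg']; subst g'.
have chFF : F `&` ends_choice = F' `&` ends_choice.
  by rewrite (lead_choice TX bF Tg red) (lead_choice TX' bF' Tg' red') e.
have FF : F = F' by rewrite (bfam_choiceE bF) (bfam_choiceE bF') chFF.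
by rewrite (lead_core TX bF) (lead_core TX' bF') e FF.
Qed.

End Choice.

(** * Expansion by leading terms and rewriting to reduced elements *)

Section ReducedBasis.
Variables (K : comPzRingType) (c : involution K) (E : sepGraph) (ch : choice_function E).
Local Notation vert := (vert E).
Local Notation edge := (edge E).
Local Notation gpath := (gpath E).
Local Notation elt := (@elt K c E).
Implicit Types (w : seq (letter E)) (e f x : edge) (v : vert).
Implicit Types (p q g h : gpath) (T U F S : set gpath) (X : set edge).

Lemma card_slot T F g X : finite_set F -> Slot T g X -> (forall x, X x -> ~ F (rcp g x)) ->
  (#|` fset_set F| < #|` fset_set (F `|` mul_edges g X)|)%N.
Proof.
move=> fF [_ sX fX _] gF; have [x Xx] := sep_neq0 sX.
have fB : finite_set (mul_edges g X) by exact: finite_image.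
apply: fproper_ltn_card; rewrite fproperEneq fset_setU // fsubsetUl andbT.
apply/eqP => e; apply: (gF x Xx).
have : rcp g x \in (fset_set F `|` fset_set (mul_edges g X))%fset.
  by rewrite in_fsetU orbC mem_fset // asboolT // mul_edgesE; exists x.
by rewrite -e mem_fset // => /asboolP.
Qed.

Lemma bfam_down v T F g X x : X0v v T -> bfam T F -> Slot T g X -> X x ->
  ~ F (rcp g x) -> bfam (T `|` down [set rcp g x]) F.
Proof.
move=> TX bF SX Xx nF; apply: bfam_mono bF _ => g' X' SX' X'F.
apply: (Slot_down TX SX SX' Xx) => x' Xx' e; apply: nF; rewrite e.
by apply: X'F; rewrite mul_edgesE; exists x'.
Qed.

(** Induction on the size of F, one block at a time. The term without the block and those of its
    nondistinguished edges have distinguished endings only within [lead ch T F], which misses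
    [rcp g' x0]. So only the term of [x0] reaches the leading tree, with its sign reversed. *)
Lemma lead_expand T F g : X0v (psrc g) T -> bfam T F -> FC g -> T (part0 g) ->
  X0v (psrc g) (lead ch T F) /\ exists (d : bool) y,
    elt T F g = (-1) ^+ d *: elt (lead ch T F) set0 g + y /\
    smallest submodule ((fun i => elt i.1 set0 i.2) @`
      [set i | elt_index i /\ (nchoice ch i.1 < nchoice ch (lead ch T F))%N]) y.
Proof.
have [N] := ubnP #|` fset_set F|; elim: N T F => // N IH T F FN TX bF Fg Tg.
case: bF FN => [_|{}F g' X bF SX gF FN].
  rewrite lead0; split=> //; exists false, 0; rewrite expr0 scale1r addr0; split=> //.
  by have [] := smallest_submodule ((fun i => elt i.1 set0 i.2) @`
    [set i | elt_index i /\ (nchoice ch i.1 < nchoice ch T)%N]).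
have fF := bfam_finite bF.
have {}FN : (#|` fset_set F| < N)%N.
  by rewrite -ltnS; apply: leq_trans FN; rewrite ltnS; exact: card_slot fF SX gF.
have [Tg' sX fX gX] := SX; have sXa : @sep_all E X by exists (prng g').
have [x0 [Xx0 cx0 x0U]] := block_choice ch sXa fX.
pose Tx x := T `|` down [set rcp g' x].
have IHx x : X x -> _ := fun Xx => IH (Tx x) F FN (Slot_X0v TX SX Xx)
  (bfam_down TX bF SX Xx (gF x Xx)) Fg (or_introl Tg).
(* Adding the distinguished path to T and adding the whole block to F produce the same leading
   tree. *)
have leadx0 : lead ch (Tx x0) F = lead ch T (F `|` mul_edges g' X).
  apply/seteqP; split=> p.
    move=> [[Tp|[_ -> px0]]|[q [Fq cq pq]]]; first by left.
      right; exists (rcp g' x0); split=> //; last exact/ends_choice_rcp.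
      by right; rewrite mul_edgesE; exists x0.
    by right; exists q; split=> //; left.
  rewrite /lead mul_edgesE => -[Tp|[q [[Fq|[x Xx <-]] cq pq]]]; first by left; left.
    by right; exists q.
  left; right; exists (rcp g' x0) => //.
  by rewrite -(x0U x Xx) //; exact/(ends_choice_rcp ch g').
set S := lead ch T (F `|` mul_edges g' X) in leadx0 *.
have [SX0 [d [y [eE yS]]]] := IHx x0 Xx0; rewrite leadx0 in SX0 eE yS; split=> //.
set L := smallest submodule _ in yS *; have LS : submodule L := smallest_submodule _.
have [L0 LD LZ] := LS.
have Sx0 : S (rcp g' x0).
  right; exists (rcp g' x0); split=> //; last exact: pprefix_refl.
    by right; rewrite mul_edgesE; exists x0.
  exact/ends_choice_rcp.
have nlead : ~ lead ch T F (rcp g' x0).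
  have /(ends_choice_rcp ch g') cgx0 := cx0.
  move=> /(in_lead_edge TX bF)/(_ (ends_choice_edge cgx0))[Tgx|[Fgx _]].
    by have [_ + _] := gX x0 Xx0; apply.
  exact: gF Fgx.
have finX0 U v : X0v v U -> finite_set U by move=> /X0vP[[]].
have low U G : X0v (psrc g) U -> bfam U G -> U (part0 g) -> (#|` fset_set G| < N)%N ->
    (forall p, lead ch U G p -> ends_choice ch p -> lead ch T F p) ->
    L (elt U G g).
  move=> UX bG Ug GN UG; have [lX [d' [y' [-> y'S]]]] := IH U G GN UX bG Fg Ug.
  have lt : (nchoice ch (lead ch U G) < nchoice ch S)%N.
    apply: (nchoice_lt (h := rcp g' x0) (finX0 _ _ lX) (finX0 _ _ SX0)) => //.
    - move=> p /UG/[apply] -[Tp|[q [Fq cq pq]]]; first by left.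
      by right; exists q; split=> //; left.
    - exact/ends_choice_rcp.
    - by move=> /UG H; apply: nlead; apply: H; exact/ends_choice_rcp.
  apply: LD.
    apply: LZ; apply: sub_gen_smallest; exists (lead ch U G, g) => //.
    by split=> //; split=> //; left.
  apply: smallest_submodule_sub y'S => // _ [i [Di li] <-].
  by apply: sub_gen_smallest; exists i => //; split=> //; exact: ltn_trans li lt.
have LT : L (elt T F g) by exact: low.
have Lx x : X x -> x != x0 -> L (elt (Tx x) F g).
  move=> Xx xx0; apply: low => //.
  - exact: Slot_X0v TX SX Xx.
  - exact: bfam_down TX bF SX Xx (gF x Xx).
  - by left.
  - move=> p [[Tp|[_ -> px]]|lp] cp; [by left| |by right].
    move: px; rewrite pprefix_rcp => /orP[/eqP pE|pg].
      by move: cp; rewrite pE => /ends_choice_rcp/(x0U x Xx) e; rewrite e eqxx in xx0.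
    by left; exact: Slot_edge_in TX SX pg (ends_choice_edge cp).
exists (~~ d), (elt T F g - y - \sum_(x <- fset_set X | x != x0) elt (Tx x) F g).
split; last first.
  have LN a : L a -> L (- a) by move=> La; rewrite -scaleN1r; exact: LZ.
  apply: (LD); first by apply: (LD) => //; exact: LN.
  apply: LN; rewrite -big_filter; apply: submodule_sum => // x.
  by rewrite mem_filter mem_fset // => /andP[xx0 /asboolP Xx]; exact: Lx.
rewrite (elt_slot c g TX fF SX) (bigD1_seq x0) ?fset_uniq //=; last first.
  by rewrite mem_fset //; apply/asboolP.
rewrite -/(Tx x0) eE !opprD !addrA; congr (_ - _ - _); rewrite addrC; congr (_ + _).
by rewrite -scaleNr; congr (_ *: _); case: (d); rewrite ?expr0 ?expr1 ?opprK.
Qed.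

Lemma reduced_indep : indep (reduced_index ch) (fun i => elt i.1.1 i.1.2 i.2).
Proof.
apply: (indep_triangular (m := fun i => nchoice ch i.1) (@elt_indep K c E) (@lead_inj E ch)).
  move=> [[T F] g] [/= TX bF Fg Tg _]; have [lX _] := lead_expand TX bF Fg Tg.
  by split=> //; left.
by move=> [[T F] g] [/= TX bF Fg Tg _]; have [_] := lead_expand TX bF Fg Tg.
Qed.

Definition kernel_index : set (set gpath * set gpath * gpath) :=
  reduced_index ch `&` [set i | i.1.2 !=set0].

Lemma kernel_basisE : kernel_basis c ch = (fun i => elt i.1.1 i.1.2 i.2) @` kernel_index.
Proof.
apply/seteqP; split=> [_ [T [F [g [g0 [TX [bF F0] [Fg [gg0 Tg0]] red ->]]]]]|].
  move: gg0 => /edge_partP g0E; rewrite -/(part0 g) in g0E; subst g0.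
  have {}bF := (bfamP F TX).1 bF.
  exists (T, F, g); first by split.
  by rewrite basis_eltE //; have [] := Fg.
move=> _ [[[T F] g] [[/= TX bF Fg Tg red] F0] <-]; exists T, F, g, (part0 g); split=> //.
- by split=> //; exact/(bfamP F TX).
- by split=> //; split=> //; exact/edge_partP.
- by rewrite basis_eltE //; have [] := Fg.
Qed.

(** Let h, ending in x0, violate reducedness, and let X be the block of x0. The block identity,
    written for the tree left after deleting h and trimming, is solved for the term of x0, whose
    tree is T. The remaining trees lack h and gain no distinguished ending. *)
Lemma nonreduced_step T F g : X0v (psrc g) T -> bfam T F -> F !=set0 -> FC g -> T (part0 g) ->
  ~ reduced_rel ch T F (part0 g) ->
  exists (s : seq (K * (set gpath * set gpath))),
    elt T F g = \sum_(i <- s) i.1 *: elt i.2.1 i.2.2 g /\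
    forall i, i \in s -> [/\ X0v (psrc g) i.2.1, bfam i.2.1 i.2.2, i.2.2 !=set0,
      i.2.1 (part0 g) & (nchoice ch i.2.1 < nchoice ch T)%N].
Proof.
move=> TX bF F0 Fg Tg /existsNP[h /not_implyP[mh /not_implyP[nbh /not_implyP[hg0]]]].
move=> nred; have ch_h : ends_choice ch h.
  by apply: contrapT => /choice_reducedP.
have {nred} [w [x0 [hw cx0]]] := ch_h.
have /X0vP[tT eT] := TX; have [fT Tv TF lT bT] := tT.
have [Th hmax] := mh; have [Fh hv] := TF _ Th.
set v := psrc g in TX Tv TF tT hv *.
have hE : h = rcp (v, w) x0 by rewrite /rcp /= -hw -hv; case: (h).
have [X [sX fX Xx0]] : exists X, [/\ @sep E (walk_end v w) X, finite_set X & X x0].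
  have [Y xE] := cx0; have : sval Y x0 by rewrite xE; exact: choice_edgeP.
  case: Y {xE} => X [[u _ sX] fX] /= Xx0; exists X; split=> //.
  have /FCP[] := Fh; rewrite hE /= is_walk_rcons => /andP[_ /eqP <-] _.
  by rewrite [lsrc _](sep_src sX Xx0).
have sXa : @sep_all E X by exists (walk_end v w).
pose W := T `\` [set h].
have tW : tree v W.
  apply: (tree_sub tT) => [p []//|p q [Tq qh] pq|].
    by split; [exact: lT Tq pq|move=> ph; apply: qh; apply: hmax => //; rewrite -ph].
  by split=> // e; move: hw; rewrite -e /= => /(congr1 size); rewrite size_rcons.
have WT : W `<=` T by move=> p [].
pose T' := core W; have TX' : X0v v T' := core_X0v tW.
have T'W : T' `<=` W by apply: core_sub; case: tW.
have Ww : W (v, w).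
  split; first by apply: (lT _ _ Th); rewrite hE pprefix_rcp /pprefix eqxx prefix_refl orbT.
  by rewrite hE => /(congr1 (fun p => size p.2)) /eqP; rewrite /= size_rcons -[X in X == _]addn0 -addn1 eqn_add2l.
have SX : Slot T' (v, w) X.
  apply: (tree_Slot tW Ww sX fX) => x Xx; have sx : same_block x0 x.
    by apply/same_blockP; exists X.
  case: (rsnocP w (fwd x)) => [u wE _|_ [Tx xh]].
    have /FCP[_] := Fh; rewrite hE /= wE -[rcons (rcons _ _) _]cats1 cat_rcons sorted_cat_cons.
    by rewrite /= /follows /= same_block_sym sx !andbF.
  have [xx0|xx0] := eqVneq x x0; first by apply: xh; rewrite hE xx0.
  apply: (bT _ _ Tx Th); exists w, x, x0; rewrite xx0 same_block_sym sx hw !prefix_refl.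
  by [].
(* A block of F that meets the new block would coincide with it and contain [h], which lies in T. *)
have F_notin x : X x -> ~ F (rcp (v, w) x).
  move=> Xx Fx; have [g' [X' [x' [SX' Xx' e X'F]]]] := bfam_Slot bF Fx.
  have [gE XE] := Slot_uniq SX SX' Xx Xx' e.
  apply: (bfam_notin bF (p := h)) => //; apply: X'F; rewrite -gE -XE mul_edgesE hE.
  by exists x0.
have part0_in p : T p -> p <> h -> ~~ ends_inv p.2 -> T' p.
  by move=> Tp ph pe; exists p; split=> //; exact: pprefix_refl.
(* Only a block whose carrier has [h] as its edge part could lose its support in the tree, and such
   a block would block [h]. *)
have bF' : bfam T' F.
  apply: bfam_mono bF _ => g' X' SX' X'F; apply: (Slot_sub SX' (subset_trans T'W WT)).
  have [Tg' _ _ _] := SX'; apply: part0_in => //; last exact: ends_inv_epart.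
  move=> g'h; apply: nbh; apply/(blockedP F TX mh).
  have [w1 g'w aw1] := epartP g'.2; exists w1, X'.
  by rewrite -g'h /= -g'w -surjective_pairing.
(* Here it matters that [h] is not g_0. *)
have Tg' : T' (part0 g) by apply: part0_in => //; [exact/nesym|exact: ends_inv_epart].
have fF := bfam_finite bF.
have ThE : T' `|` down [set rcp (v, w) x0] = T.
  rewrite -hE; apply/seteqP; split=> p.
    by move=> [/T'W[]//|[_ -> ph]]; exact: lT Th ph.
  move=> /eT[q [Tq pq qe]]; have [qh|qh] := pselect (q = h).
    by right; exists h => //; rewrite -qh.
  by left; exists q.
have lt U : finite_set U -> (forall p, U p -> ends_choice ch p -> T p) -> ~ U h ->
    (nchoice ch U < nchoice ch T)%N.
  by move=> fU UT nUh; apply: (@nchoice_lt _ ch _ _ h).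
have nT'h : ~ T' h by move=> /T'W[_ []].
have fT' : finite_set T' by have /X0vP[[]] := TX'.
have ltT' : (nchoice ch T' < nchoice ch T)%N by apply: lt => // p /T'W[].
exists ((1, (T', F)) :: (-1, (T', F `|` mul_edges (v, w) X)) ::
  [seq (-1, (T' `|` down [set rcp (v, w) x], F)) | x <- fset_set X & x != x0]).
split.
  rewrite !big_cons /= big_map big_filter scale1r scaleN1r.
  rewrite (elt_slot c g TX' fF SX) (bigD1_seq x0) ?fset_uniq //=; last first.
    by rewrite mem_fset //; apply/asboolP.
  rewrite ThE; set s := \sum_(x <- _ | _) elt _ _ _.
  have -> : \sum_(x <- fset_set X | x != x0) -1 *: elt (T' `|` down [set rcp (v, w) x]) F g = - s.
    by rewrite -sumrN; apply: eq_bigr => x _; rewrite scaleN1r.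
  by rewrite opprB addrAC addrK addrCA subrr addr0.
move=> x; rewrite !inE => /orP[/eqP ->|/orP[/eqP ->|/mapP[y]]] /=.
- by split.
- split=> //; first exact: bfamS bF' SX F_notin.
  by case: F0 => p Fp; exists p; left.
rewrite mem_filter mem_fset // => /andP[yx0 /asboolP Xy] -> /=; split=> //.
- exact: Slot_X0v TX' SX Xy.
- exact: bfam_down TX' bF' SX Xy (F_notin y Xy).
- by left.
- apply: lt.
  + by rewrite finite_setU; split=> //; exact: finite_down.
  + move=> p [/T'W[]//|[_ -> ]]; rewrite pprefix_rcp => /orP[/eqP ->|pw _]; last first.
      exact: lT (WT _ Ww) pw.
    move=> /ends_choice_rcp cy; have [x1 [_ _ x1U]] := block_choice ch sXa fX.
    by case/eqP: yx0; rewrite (x1U y) // (x1U x0).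
  + move=> [//|[_ ->]]; rewrite hE pprefix_rcp => /orP[/eqP/rcp_inj[_ xy]|].
      by rewrite xy eqxx in yx0.
    by rewrite rcp_neq.
Qed.

Lemma kernel_elt_sub : smallest submodule (@kernel_elt K c E) `<=`
  smallest submodule (kernel_basis c ch).
Proof.
set B := smallest submodule (kernel_basis c ch).
have BS : submodule B := smallest_submodule _; have [B0 _ BZ] := BS.
apply: smallest_submodule_sub => // _ [T [F [g [TX [bF F0] Fg Tg ->]]]].
have [N] := ubnP (nchoice ch T); elim: N T F TX bF F0 Tg => // N IH T F TX bF F0 Tg TN.
have [red|nred] := pselect (reduced_rel ch T F (part0 g)).
  by apply: sub_gen_smallest; rewrite kernel_basisE; exists (T, F, g).
have [s [-> sP]] := nonreduced_step TX bF F0 Fg Tg nred.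
apply: submodule_sum => // x /sP[xX bx x0 xg xlt]; apply: BZ; apply: IH => //.
exact: leq_trans xlt TN.
Qed.

End ReducedBasis.

Theorem theorem6p11 (K : comPzRingType) (c : involution K) (E : sepGraph)
    (ch : choice_function E) :
  is_basis (kernel_basis c ch) (tame_kernel c E).
Proof.
split.
  rewrite kernel_basisE; apply: indep_lin_indep => s Ds.
  by apply: (@reduced_indep K c E ch) => x /Ds[].
rewrite lin_spanE tame_kernel_span; apply/seteqP; split; last exact: kernel_elt_sub.
apply: smallest_submodule_sub; first exact: smallest_submodule.
rewrite kernel_basisE => _ [[[T F] g] [[/= TX bF Fg Tg red] F0] <-].
by apply: sub_gen_smallest; exists T, F, g.
Qed.
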